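(* Let $(M,F=\alpha+\beta)$ be a Randers metric that is not flat, let $W\in\mathcal{X}(M)$ be a vector field on $M$ such that $F(-W)<1$, and let $\widetilde F=\widetilde\alpha+\widetilde\beta$ be the solution of Zermelo's navigation problem for $(F,W)$. Let $\psi_t$ denote the flow of $W$. If $W$ is an $F$-Killing field, then: (i) the $\widetilde F$-unit speed geodesics $\widetilde{\mathcal{P}}$ are given by $\widetilde{\mathcal{P}}(t)=\psi_t(\mathcal{P}(t))$, where $\mathcal{P}$ is an $F$-unit speed geodesic; (ii) the point $\widetilde{\mathcal{P}}(l)$ is conjugate to $q=\widetilde{\mathcal{P}}(0)$ along the $\widetilde F$-geodesic $\widetilde{\mathcal{P}}:[0,l]\to M$ if and only if the point $\mathcal{P}(l)$ is conjugate to $q=\mathcal{P}(0)$ along the corresponding $F$-geodesic $\mathcal{P}(t)=\psi_{-t}(\widetilde{\mathcal{P}}(t))$, $t\in[0,l]$; (iii) the point $\hat p$ is an $\widetilde F$-cut point of $q$ if and only if $p=\psi_{-l}(\hat p)$ is an $F$-cut point of $q$, where $l=d_{\widetilde F}(q,\hat p)$.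
   Context: A Randers metric is a Finsler metric $F=\alpha+\beta$ with $\alpha=\sqrt{a_{ij}(x)y^iy^j}$ a Riemannian metric and $\beta=b_i(x)y^i$ a one-form with $\|b\|_\alpha<1$. The solution $\widetilde F$ of Zermelo's navigation problem for $(F,W)$ is the metric whose indicatrix $\{y\in T_xM:\widetilde F(x,y)=1\}$ is, for every $x$, the rigid translate by $W(x)$ of the indicatrix of $F$ in $T_xM$. The condition $F(-W)<1$ is meant at every point of $M$. A vector field $W$ is $F$-Killing if every local one-parameter group of transformations generated by $W$ consists of local isometries of $F$. A point $\gamma(l)$ is conjugate to $q=\gamma(0)$ along a geodesic $\gamma$ if there is a nonzero Jacobi field along $\gamma$ vanishing at both points. A point $p=\gamma(l)$ is an $F$-cut point of $q$ if $\gamma:[0,l]\to M$ is a minimal $F$-geodesic from $q$ to $p$ and no extension of $\gamma$ beyond $p$ is minimizing from $q$. $d_F$ denotes the (possibly non-symmetric) distance function of $F$.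
   Formalization: The vector field W is assumed complete, so that its flow ψ_t is defined on all of M for all times t; for incomplete W the points ψ_{-t}(P̃(t)) and ψ_{-l}(p̂) may be undefined and (i) fails. *)

(* Defs.v *)
From HB Require Import structures.
From mathcomp Require Import all_boot all_order all_algebra.
From mathcomp Require Import all_classical all_reals all_analysis.
Set Implicit Arguments. Unset Strict Implicit. Unset Printing Implicit Defensive.
Import Order.TTheory GRing.Theory Num.Theory.
Import numFieldNormedType.Exports.
Local Open Scope classical_set_scope.
Local Open Scope ring_scope.

(* C^k and C^oo maps on an open subset [U] of a normed space. *)
Fixpoint Ck (R : realType) (V W : normedModType R) (k : nat)
    (U : set V) (f : V -> W) : Prop :=
  if k is k'.+1 then
    (forall x, U x -> differentiable f x) /\
    (forall v, Ck k' U (fun x => 'd f x v))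
  else forall x, U x -> {for x, continuous f}.

Definition smooth (R : realType) (V W : normedModType R)
    (U : set V) (f : V -> W) : Prop := forall k, Ck k U f.

(* Smooth n-manifolds. [chart i] and [chart_inv i] are total functions that are
   meaningful only on [dom i] and on [chart i @` dom i] respectively.
   [chart_at p] selects one chart around [p]. *)
Record manifold (R : realType) (n : nat) := Manifold {
  carrier :> topologicalType;
  carrier_hausdorff : hausdorff_space carrier;
  carrier_countable : @second_countable carrier;
  idx : Type;
  dom : idx -> set carrier;
  chart : idx -> carrier -> 'rV[R]_n;
  chart_inv : idx -> 'rV[R]_n -> carrier;
  chart_at : carrier -> idx;
  chart_atP : forall p, dom (chart_at p) p;
  dom_open : forall i, open (dom i);
  cod_open : forall i, open (chart i @` dom i);
  chartK : forall i p, dom i p -> chart_inv i (chart i p) = p;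
  chart_cts : forall i p, dom i p -> {for p, continuous (chart i)};
  chart_inv_cts : forall i x, (chart i @` dom i) x ->
    {for x, continuous (chart_inv i)};
  chart_smooth : forall i j,
    smooth (chart i @` (dom i `&` dom j)) (chart j \o chart_inv i)
}.

Section Tensors.
Variables (R : realType) (n : nat) (M : manifold R n).

Definition cod (i : idx M) : set 'rV[R]_n := chart i @` dom i.
Definition overlap (i j : idx M) : set 'rV[R]_n := chart i @` (dom i `&` dom j).
Definition trans (i j : idx M) : 'rV[R]_n -> 'rV[R]_n := chart j \o chart_inv i.

(* Functions on TM and tensor fields are families of components, indexed by
   the charts; points and tangent vectors are written in chart coordinates,
   as row vectors. *)
Definition tmfun := idx M -> 'rV[R]_n -> 'rV[R]_n -> R.

Record vfield := VField {
  vf :> idx M -> 'rV[R]_n -> 'rV[R]_n;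
  vf_smooth : forall i, smooth (cod i) (vf i);
  vf_tensor : forall i j x, overlap i j x ->
    vf j (trans i j x) = 'd (trans i j) x (vf i x)
}.

Definition quad (a : 'M[R]_n) (u v : 'rV[R]_n) : R := (u *m a *m v^T) 0 0.
Definition covec (b v : 'rV[R]_n) : R := (v *m b^T) 0 0.

Record riemannian := Riemannian {
  rm :> idx M -> 'rV[R]_n -> 'M[R]_n;
  rm_smooth : forall i, smooth (cod i) (rm i);
  rm_sym : forall i x, cod i x -> (rm i x)^T = rm i x;
  rm_pos : forall i x v, cod i x -> v != 0 -> 0 < quad (rm i x) v v;
  rm_tensor : forall i j x u v, overlap i j x ->
    quad (rm j (trans i j x)) ('d (trans i j) x u) ('d (trans i j) x v) =
    quad (rm i x) u v
}.

Record oneform := OneForm {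
  of_ :> idx M -> 'rV[R]_n -> 'rV[R]_n;
  of_smooth : forall i, smooth (cod i) (of_ i);
  of_tensor : forall i j x v, overlap i j x ->
    covec (of_ j (trans i j x)) ('d (trans i j) x v) = covec (of_ i x) v
}.

(* [randers_norm] is a^{ij} b_i b_j < 1 in coordinates. *)
Record randers := Randers {
  r_alpha : riemannian;
  r_beta : oneform;
  randers_norm : forall i x, cod i x ->
    Num.sqrt (quad (invmx (r_alpha i x)) (r_beta i x) (r_beta i x)) < 1
}.

Definition randers_fun (F : randers) : tmfun := fun i x y =>
  Num.sqrt (quad (r_alpha F i x) y y) + covec (r_beta F i x) y.

(* The indicatrix of [Ft] at each point is that of [F] translated by [W]. *)
Definition zermelo (F : tmfun) (W : vfield) (Ft : tmfun) : Prop :=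
  forall i x, cod i x ->
    [set y | Ft i x y = 1] = (fun y => y + W i x) @` [set y | F i x y = 1].

(* [phi], restricted to times in [J] and points of [U], is a smooth
   one-parameter group of transformations generated by [W]; both [J] and [U]
   are meant to be open.  The global flow of [W] is the case J = R, U = M. *)
Record flow_on (W : vfield) (J : set R) (U : set M) (phi : R -> M -> M) : Prop :=
  FlowOn {
  flow_cts : forall t p, J t -> U p ->
    {for (t, p), continuous (fun tp : R * M => phi tp.1 tp.2)};
  flow_smooth : forall i j,
    smooth [set tx : R * 'rV[R]_n | [/\ J tx.1, cod i tx.2,
                U (chart_inv i tx.2) & dom j (phi tx.1 (chart_inv i tx.2))]]
           (fun tx => chart j (phi tx.1 (chart_inv i tx.2)));
  flow0 : forall p, U p -> phi 0 p = p;
  flowD : forall s t p, J s -> J t -> J (s + t) -> U p -> U (phi s p) ->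
    phi (s + t) p = phi t (phi s p);
  flow_gen : forall i t p, J t -> U p -> dom i (phi t p) ->
    derive1 (fun s => chart i (phi s p)) t = W i (chart i (phi t p))
}.

Definition local_isometry (F : tmfun) (U : set M) (f : M -> M) : Prop :=
  forall i j p v, U p -> dom i p -> dom j (f p) ->
    F j (chart j (f p)) ('d (chart j \o f \o chart_inv i) (chart i p) v) =
    F i (chart i p) v.

Definition killing (F : tmfun) (W : vfield) : Prop :=
  forall (e : R) (U : set M) (phi : R -> M -> M), 0 < e -> open U ->
    flow_on W `]-e, e[ U phi ->
    forall t, t \in `]-e, e[ -> local_isometry F U (phi t).

End Tensors.

(* Coordinate expressions of Finsler geometry, for the components
   [f x y] of a Finsler metric in one chart. *)
Section Spray.
Variables (R : realType) (n : nat).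
Local Notation V := 'rV[R]_n.

Definition dx (k : 'I_n) (f : V -> V -> R) (x y : V) : R :=
  'D_(delta_mx 0 k) (fun z => f z y) x.
Definition dy (k : 'I_n) (f : V -> V -> R) (x y : V) : R :=
  'D_(delta_mx 0 k) (f x) y.

Definition sq (f : V -> V -> R) (x y : V) : R := f x y ^+ 2.

(* g_{jk} = 1/2 [F^2]_{y^j y^k} *)
Definition fund (f : V -> V -> R) (x y : V) : 'M[R]_n :=
  \matrix_(j, k) (2^-1 * dy k (dy j (sq f)) x y).

(* G^i = 1/4 g^{il} ([F^2]_{x^k y^l} y^k - [F^2]_{x^l}) *)
Definition spray (f : V -> V -> R) (i : 'I_n) (x y : V) : R :=
  4^-1 * \sum_l invmx (fund f x y) i l *
    (\sum_k dx k (dy l (sq f)) x y * y 0 k - dx l (sq f) x y).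

(* N^i_k = dG^i/dy^k *)
Definition nonlin (f : V -> V -> R) (i k : 'I_n) : V -> V -> R :=
  dy k (spray f i).

(* R^i_k = 2 dG^i/dx^k - y^j d^2G^i/dx^jdy^k + 2 G^j d^2G^i/dy^jdy^k
           - dG^i/dy^j dG^j/dy^k *)
Definition riem (f : V -> V -> R) (i k : 'I_n) (x y : V) : R :=
  2 * dx k (spray f i) x y
  - \sum_j y 0 j * dx j (nonlin f i k) x y
  + 2 * \sum_j spray f j x y * dy j (nonlin f i k) x y
  - \sum_j nonlin f i j x y * nonlin f j k x y.

End Spray.

Section Geodesics.
Variables (R : realType) (n : nat) (M : manifold R n) (F : tmfun M).
Implicit Types (g : R -> M) (J O : set R).

Definition loc (i : idx M) g : R -> 'rV[R]_n := fun t => chart i (g t).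
Definition vel (i : idx M) g : R -> 'rV[R]_n := derive1 (loc i g).

(* Vanishing of the Riemann curvature, that is, of all flag curvatures. *)
Definition flat : Prop :=
  forall i x y, cod i x -> y != 0 -> forall j k, riem (F i) j k x y = 0.

(* Unit speed geodesics on an open interval [O]: solutions of
   c'' + 2 G(c, c') = 0 with F(c, c') = 1. *)
Definition geodesic_open O g : Prop :=
  forall t, O t -> {for t, continuous g} /\
  forall i, dom i (g t) ->
    [/\ derivable (loc i g) t 1, derivable (vel i g) t 1,
        derive1 (vel i g) t =
          - \row_k (2 * spray (F i) k (loc i g t) (vel i g t))
      & F i (loc i g t) (vel i g t) = 1].

(* On an arbitrary interval [J]: restrictions to [J] of unit speed geodesics
   defined on a larger open interval. *)
Definition geodesic J g : Prop :=
  exists O h, [/\ open O, is_interval O, J `<=` O, geodesic_open O h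
                & forall t, J t -> g t = h t].

(* Vector fields along a curve [g], in chart components. *)
Definition along O g (X : idx M -> R -> 'rV[R]_n) : Prop :=
  forall i j t, O t -> dom i (g t) -> dom j (g t) ->
    X j t = 'd (trans i j) (loc i g t) (X i t).

(* Covariant derivative along [g] with reference vector g' :
   X'^k + N^k_j(g, g') X^j. *)
Definition cov g (X : idx M -> R -> 'rV[R]_n) : idx M -> R -> 'rV[R]_n :=
  fun i t => derive1 (X i) t +
    \row_k \sum_j nonlin (F i) k j (loc i g t) (vel i g t) * X i t 0 j.

(* D_{g'} D_{g'} X + R_{g'}(X) = 0 *)
Definition jacobi O g (X : idx M -> R -> 'rV[R]_n) : Prop :=
  along O g X /\
  forall t i, O t -> dom i (g t) ->
    [/\ derivable (X i) t 1, derivable (cov g X i) t 1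
      & cov g (cov g X) i t +
        \row_k \sum_j riem (F i) k j (loc i g t) (vel i g t) * X i t 0 j = 0].

(* [g l] is conjugate to [g 0] along the unit speed geodesic [g] on [0, l].
   The geodesic and the Jacobi field are those of an open interval around
   [0, l], so that only two-sided derivatives are involved. *)
Definition conjugate g (l : R) : Prop :=
  exists O h X,
    [/\ open O, is_interval O, `[0, l] `<=` O & geodesic_open O h] /\
    [/\ forall t, t \in `[0, l] -> g t = h t,
        jacobi O h X,
        forall i, dom i (h 0) -> X i 0 = 0,
        forall i, dom i (h l) -> X i l = 0
      & exists t i, [/\ t \in `[0, l], dom i (h t) & X i t != 0]].

Definition C1_open O g : Prop :=
  forall t, O t -> {for t, continuous g} /\
  forall i, dom i (g t) ->
    derivable (loc i g) t 1 /\ {for t, continuous (vel i g)}.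

Definition piecewise_C1 (a b : R) g : Prop :=
  exists (N : nat) (s : nat -> R),
    [/\ s 0%N = a, s N = b &
      forall k, (k < N)%N -> s k < s k.+1 /\
        exists O h, [/\ open O, `[s k, s k.+1] `<=` O, C1_open O h
                      & forall t, t \in `[s k, s k.+1] -> g t = h t]].

Definition speed g (t : R) : R :=
  F (chart_at (g t)) (loc (chart_at (g t)) g t) (vel (chart_at (g t)) g t).

(* The corners of a piecewise C^1 curve form a null set. *)
Definition len (a b : R) g : \bar R :=
  (\int[@lebesgue_measure R]_(t in `[a, b]) (speed g t)%:E)%E.

(* +oo when no curve joins [p] to [q]. *)
Definition dist (p q : M) : \bar R :=
  ereal_inf [set L | exists g,
    [/\ piecewise_C1 0 1 g, g 0 = p, g 1 = q & L = len 0 1 g]].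

Definition minimal_geodesic (l : R) g : Prop :=
  geodesic `[0, l] g /\ len 0 l g = dist (g 0) (g l).

Definition cut_point (q p : M) : Prop :=
  exists l g, [/\ 0 < l, minimal_geodesic l g, g 0 = q, g l = p &
    forall l' h, l < l' -> (forall t, t \in `[0, l] -> h t = g t) ->
      ~ minimal_geodesic l' h].

End Geodesics.

(* Main.v *)
(* Since W is F-Killing, psi_t preserves F, so psi_t sends a vector v with
   F(v) = s to one of F-length s, and by Zermelo's construction translating by
   s W gives a vector of Ft-length s.  Hence, whenever c has F-speed tau', the
   curve psi_tau(c) has Ft-speed tau'; the same holds for (Ft, F, psi_{-t}).
   Both directions of every statement follow from this symmetric property,
   called a twist below.

   Geodesics.  Along unit jets the Euler-Lagrange covector of F is a nonzero
   multiple of a surjective pullback of the one of Ft, and a spray equation is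
   the vanishing of the Euler-Lagrange covector of half the squared metric.

   Conjugate points.  A Jacobi field X is a solution of the linearised
   Euler-Lagrange equations.  The function F_y(X) is affine in t, so it vanishes
   if X vanishes at two points; X is then tangent to a family of unit jets, and
   the twist linearises to X |-> psi_t X.

   Cut points.  A chain of C^1 arcs of F-length L from q to p yields one of
   Ft-length L from q to psi_L(p), and the flow line of W from x to psi_d(x) has
   Ft-length < d because F(-W) < 1 is equivalent to Ft(W) < 1.  Hence
   d_F(q, p) < s implies d_Ft(q, psi_s(p)) < s. *)

(* The twist identity is imposed at every speed because homogeneity makes it an identity on an open
   set of velocities: it can then be differentiated in all directions of the velocity, and it covers
   arcs of variable or vanishing speed, with time running as arc length. The price is that a
   variation w of the velocity also changes the elapsed time, by F_y(w). Covectors therefore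
   correspond through the pair (F_y(w), w), fed to the differential of (t, x) |-> psi_t(x), and a
   factor 1 - Ft_y(W) appears, which must be shown nonzero. Only jets with F = 1 and F' = 0 run at
   rate one to second order, so the comparison of covectors is available on these jets alone and can
   be linearised only along variations that stay among them. This is the obstacle for Jacobi fields:
   a general one leaves the constraint F = 1, and vanishing at two points is what keeps it inside.
   As [cut_point] carries a length of its own, (iii) also requires that this length is the same on
   both sides. *)
Require Import Defs.
From HB Require Import structures.
From mathcomp Require Import all_boot all_order all_algebra.
From mathcomp Require Import all_classical all_reals all_analysis measurable_realfun.
From mathcomp Require Import ring lra.
Set Implicit Arguments. Unset Strict Implicit. Unset Printing Implicit Defensive.
Import Order.TTheory GRing.Theory Num.Theory.
Import numFieldNormedType.Exports.
Local Open Scope classical_set_scope.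
Local Open Scope ring_scope.

(** * Differentials along curves *)

Section Calculus.
Variable R : realType.
Implicit Types U V W : normedModType R.

Lemma is_derive1_comp V W (f : V -> W) (z : R -> V) (t : R) (dz : V) :
  differentiable f (z t) -> is_derive t 1 z dz ->
  is_derive t 1 (f \o z) ('d f (z t) dz).
Proof.
move=> df [zd zv].
have zdiff : differentiable z t by apply/derivable1_diffP.
have cd : differentiable (f \o z) t by apply: differentiable_comp.
apply: DeriveDef; first exact/derivable1_diffP.
by rewrite deriveE // diff_comp //= -zv deriveE.
Qed.

Lemma diff_eps V W (f : V -> W) (x : V) (e : R) : differentiable f x -> 0 < e ->
  \forall h \near (0 : V), `|f (h + x) - f x - 'd f x h| <= e * `|h|.
Proof.
move=> /diff_locallyP[_ /eqaddoP] /(_ e) H e0.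
have := H e0; apply: filterS => h /=.
by rewrite /GRing.add /= /GRing.opp /= opprD addrA.
Qed.

Lemma eps_differentiable V W (f : V -> W) (df : {linear V -> W}) (x : V) :
  continuous df ->
  (forall e, 0 < e ->
    \forall h \near (0 : V), `|f (h + x) - f x - df h| <= e * `|h|) ->
  differentiable f x /\ 'd f x = df :> (V -> W).
Proof.
move=> dc H.
have E : f \o shift x = cst (f x) + df +o_ 0 id.
  apply/eqaddoP => e e0; have := H e e0; apply: filterS => h /=.
  by rewrite /GRing.add /= /GRing.opp /= opprD addrA.
have dE : 'd f x = df :> (V -> W) by apply: diff_unique.
by split=> //; apply/diff_locallyP; rewrite dE.
Qed.

Lemma near_eq_diff V W (f g : V -> W) (x : V) :
  (\forall y \near x, f y = g y) -> differentiable f x ->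
  differentiable g x /\ 'd g x = 'd f x :> (V -> W).
Proof.
move=> fg df; apply: eps_differentiable; first exact: diff_continuous.
move=> e e0; have := diff_eps df e0.
have fg0 : \forall h \near (0 : V), f (h + x) = g (h + x).
  by move: fg; rewrite (near_shift 0 x) /=; apply: filterS => h; rewrite subr0.
by apply: filterS2 fg0 => h /= <-; rewrite (nbhs_singleton fg).
Qed.

(* Finite dimension, with continuous coordinates. *)
Definition framed V := exists (I : finType) (e : I -> V) (l : I -> {linear V -> R}),
  (forall i, continuous (l i)) /\ forall x, x = \sum_i l i x *: e i.

Lemma framed_real : framed R.
Proof.
exists 'I_1, (fun=> 1), (fun=> idfun); split; first by move=> i x.
by move=> x; rewrite big_ord1 /= /GRing.scale /= mulr1.
Qed.

Lemma framed_rV n : framed 'rV[R]_n.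
Proof.
exists 'I_n, (fun i => delta_mx 0 i).
have lin i : linear (fun v : 'rV[R]_n => v 0 i).
  by move=> k u v; rewrite !mxE.
pose l i : {linear 'rV[R]_n -> R} := HB.pack (fun v : 'rV[R]_n => v 0 i) (GRing.isLinear.Build _ _ _ _ _ (lin i)).
exists l; split; first by move=> i; exact: coord_continuous.
by move=> x; rewrite [LHS]row_sum_delta.
Qed.

Lemma framed_prod V W : framed V -> framed W -> framed (V * W)%type.
Proof.
move=> [I [e [l [lc le]]]] [J [e' [l' [lc' le']]]].
have lin1 i : linear (fun u : V * W => l i u.1).
  by move=> k u v /=; rewrite linearP.
have lin2 i : linear (fun u : V * W => l' i u.2).
  by move=> k u v /=; rewrite linearP.
pose L (i : (I + J)%type) : {linear (V * W)%type -> R} := match i with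
 | inl i => HB.pack (fun u : V * W => l i u.1) (GRing.isLinear.Build _ _ _ _ _ (lin1 i))
 | inr i => HB.pack (fun u : V * W => l' i u.2) (GRing.isLinear.Build _ _ _ _ _ (lin2 i)) end.
exists (I + J)%type, (fun i => match i with inl i => (e i, 0) | inr j => (0, e' j) end), L; split.
  case=> i x /=; apply: continuous_comp;
    [exact: cvg_fst|exact: lc | exact: cvg_snd|exact: lc'].
move=> [x y]; rewrite big_sumType /=.
rewrite {1}(le x) {1}(le' y).
rewrite (_ : \sum_i l i x *: (e i, 0) = (\sum_i l i x *: e i, 0 : W)); last first.
  elim/big_rec2 : _ => // i u v _ ->.
  by rewrite [LHS]surjective_pairing /= scaler0 addr0.
rewrite (_ : \sum_i l' i y *: (0, e' i) = (0 : V, \sum_i l' i y *: e' i)); last first.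
  elim/big_rec2 : _ => // i u v _ ->.
  by rewrite [LHS]surjective_pairing /= scaler0 addr0.
by rewrite [RHS]surjective_pairing /= addr0 add0r.
Qed.

Lemma is_derive1_sum V (I : finType) (h : I -> R -> V) (dh : I -> V) (t : R) :
  (forall i, is_derive t 1 (h i) (dh i)) ->
  is_derive t 1 (fun s => \sum_i h i s) (\sum_i dh i).
Proof.
move=> H; rewrite unlock; elim: (index_enum I) => [|i r IH] /=.
  exact: is_derive_cst.
exact: is_deriveD.
Qed.

Lemma is_derive1Z V (k : R -> R) (v : R -> V) (t dk : R) (dv : V) :
  is_derive t 1 k dk -> is_derive t 1 v dv ->
  is_derive t 1 (fun s => k s *: v s) (dk *: v t + k t *: dv).
Proof.
move=> [kd <-] [vd <-].
have vc : {for t, continuous v}.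
  by apply: differentiable_continuous; apply/derivable1_diffP.
have vs : v (h + t) @[h --> 0^'] --> v t.
  apply: (@cvg_within_filter _ _ (fun h : R => v (h + t)) (nbhs (0 : R))).
  have : (h + t) @[h --> (0 : R)] --> t.
    have := @cvgD _ _ _ (nbhs (0 : R)) _ id (cst t) 0 t cvg_id (cvg_cst _).
    by rewrite add0r; apply.
  by move=> H; exact: (cvg_comp _ _ H vc).
suff H : h^-1 *: (k (h *: 1 + t) *: v (h *: 1 + t) - k t *: v t) @[h --> 0^'] -->
   'D_1 k t *: v t + k t *: 'D_1 v t.
  by apply: DeriveDef; [apply/cvg_ex; eexists; exact: H|exact: cvg_lim H].
have -> : (fun h : R => h^-1 *: (k (h *: 1 + t) *: v (h *: 1 + t) - k t *: v t)) =
  (fun h => (h^-1 *: (k (h *: 1 + t) - k t)) *: v (h + t) + k t *: (h^-1 *: (v (h *: 1 + t) - v t))).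
  apply/funext => h; rewrite [h *: 1]mulr1 !scalerA (mulrC _ (h^-1)) -!scalerA -scalerDr.
  congr (_ *: _); rewrite scalerBl scalerBr addrA subrK //.
by apply: cvgD; [apply: cvgZ|apply: cvgZl_tmp].
Qed.

Lemma diff_frame V W (f : V -> W) (I : finType) (e : I -> V)
  (l : I -> {linear V -> R}) x v : v = \sum_i l i v *: e i ->
  'd f x v = \sum_i l i v *: 'd f x (e i).
Proof. by move=> {1}->; rewrite linear_sum; apply: eq_bigr => i _; rewrite linearZ. Qed.

(** The direction [a] moves, while ['d f _ v] is assumed differentiable for one fixed [v] at a time.
    Expanding [a] in the frame leaves finitely many fixed directions, to which the product rule
    applies. *)
Lemma is_derive1_diff V W (f : V -> W) (z a : R -> V) (t : R) (dz da : V) :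
  framed V ->
  (forall v, differentiable (fun y => 'd f y v) (z t)) ->
  is_derive t 1 z dz -> is_derive t 1 a da ->
  is_derive t 1 (fun s => 'd f (z s) (a s))
    ('d (fun y => 'd f y (a t)) (z t) dz + 'd f (z t) da).
Proof.
move=> [I [e [l [lc le]]]] df zd ad.
have -> : (fun s => 'd f (z s) (a s)) = (fun s => \sum_i l i (a s) *: 'd f (z s) (e i)).
  by apply/funext => s; apply: diff_frame.
have -> : 'd (fun y => 'd f y (a t)) (z t) dz + 'd f (z t) da =
   \sum_i (l i da *: 'd f (z t) (e i) + l i (a t) *: 'd (fun y => 'd f y (e i)) (z t) dz).
  rewrite big_split /= [LHS]addrC; congr (_ + _); first by apply: diff_frame (le _).
  (* The term with [a] frozen is identified by differentiating one curve in two ways, so that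
     linearity of the second differential in its inner direction need not be known yet. *)
  have A : is_derive t 1 (fun s => 'd f (z s) (a t)) ('d (fun y => 'd f y (a t)) (z t) dz).
    exact: (is_derive1_comp (f := fun y => 'd f y (a t))).
  have B : is_derive t 1 (fun s => 'd f (z s) (a t))
      (\sum_i l i (a t) *: 'd (fun y => 'd f y (e i)) (z t) dz).
    rewrite (_ : (fun _ => _) = (fun s => \sum_i l i (a t) *: 'd f (z s) (e i))); last first.
      by apply/funext => s; apply: diff_frame (le _).
    apply: is_derive1_sum => i.
    apply: is_derive_eq; first apply: is_derive1Z.
      by apply: (is_derive1_comp (f := fun y => 'd f y (e i))).
    by rewrite scale0r add0r.
  by rewrite -[LHS](@derive_val _ _ _ _ _ _ _ A) (@derive_val _ _ _ _ _ _ _ B).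
apply: is_derive1_sum => i.
apply: is_derive1Z.
  apply: is_derive_eq; first apply: (is_derive1_comp (f := l i)) => //.
    exact: linear_differentiable.
  by rewrite diff_lin.
by apply: (is_derive1_comp (f := fun y => 'd f y (e i))).
Qed.

Lemma is_derive1D V (f g : R -> V) (t : R) df dg :
  is_derive t 1 f df -> is_derive t 1 g dg ->
  is_derive t 1 (fun s => f s + g s) (df + dg).
Proof. by move=> *; exact: is_deriveD. Qed.

Lemma is_derive1N V (f : R -> V) (t : R) df :
  is_derive t 1 f df -> is_derive t 1 (fun s => - f s) (- df).
Proof. by move=> *; exact: is_deriveN. Qed.

Lemma is_derive1B V (f g : R -> V) (t : R) df dg :
  is_derive t 1 f df -> is_derive t 1 g dg ->
  is_derive t 1 (fun s => f s - g s) (df - dg).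
Proof. by move=> *; apply: is_derive1D => //; exact: is_derive1N. Qed.

Lemma is_derive1M (f g : R -> R) (t : R) df dg :
  is_derive t 1 f df -> is_derive t 1 g dg ->
  is_derive t 1 (fun s => f s * g s) (df * g t + f t * dg).
Proof. by move=> *; exact: (is_derive1Z (V := R)). Qed.

Lemma is_derive1_cst V (x : V) (t : R) : is_derive t 1 (fun _ : R => x) 0.
Proof. exact: is_derive_cst. Qed.

Lemma is_derive1_line V (x v : V) (t : R) : is_derive t 1 (fun s : R => x + s *: v) v.
Proof.
apply: is_derive_eq.
  apply: is_derive1D.
  by apply: is_derive1Z.
by rewrite /= add0r scaler0 addr0 scale1r.
Qed.

Lemma diff_line V W (f : V -> W) (x v : V) (t : R) : differentiable f (x + t *: v) ->
  is_derive t 1 (fun s => f (x + s *: v)) ('d f (x + t *: v) v).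
Proof. by move=> df; apply: (is_derive1_comp (f := f)) => //; exact: is_derive1_line. Qed.

(** By the mean value theorem along [a], the second difference is [h] times a difference of first
    differentials in the direction [a]; differentiability of these at the single point [q] controls
    it. *)
Lemma second_difference V (f : V -> R) (q a b : V) (e : R) :
  (\forall y \near q, differentiable f y) ->
  differentiable (fun y => 'd f y a) q -> 0 < e ->
  \forall h \near (0 : R)^'+,
    `|f (q + h *: b + h *: a) - f (q + h *: a) - (f (q + h *: b) - f q)
      - h ^+ 2 * 'd (fun y => 'd f y a) q b| <= e * h ^+ 2.
Proof.
move=> df dfa e0.
(* Each of the two displacements has norm at most [h * (|a| + |b|)], whence the 2; the 1 keeps [C]
   positive when both vectors vanish. *)
pose C := 2 * (`|a| + `|b|) + 1.
have a0 := normr_ge0 a; have b0 := normr_ge0 b.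
have C0 : 0 < C by rewrite /C; lra.
have eC : 0 < e / C by rewrite divr_gt0.
have [r r0 Hr] : exists2 r : R, 0 < r & forall v, `|v| < r ->
    differentiable f (q + v) /\
    `|'d f (q + v) a - 'd f q a - 'd (fun y => 'd f y a) q v| <= e / C * `|v|.
  have H1 := diff_eps dfa eC.
  have H2 : \forall v \near (0 : V), differentiable f (v + q).
    by move: df; rewrite (near_shift 0 q) /=; apply: filterS => h; rewrite subr0.
  have [r /= r0 Hr] := (nbhs_normP _ _).1 (filterI H2 H1).
  exists r => // v vr; rewrite (addrC q); apply: Hr.
  by rewrite /= sub0r normrN.
near=> h.
have h0 : 0 < h by near: h; exact: nbhs_right_gt.
have hr : h * (`|a| + `|b|) < r.
  rewrite (@le_lt_trans _ _ (h * C)) //; first by rewrite ler_pM2l // /C; lra.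
  by rewrite -ltr_pdivlMr //; near: h; apply: nbhs_right_lt; rewrite divr_gt0.
have small s k : 0 <= s <= h -> 0 <= k <= h ->
    `|k *: b + s *: a| <= h * (`|a| + `|b|).
  move=> /andP[s0 sh] /andP[k0 kh]; rewrite (le_trans (ler_normD _ _)) // !normrZ !ger0_norm //.
  by rewrite mulrDr addrC lerD // ler_wpM2r.
pose g (s : R) := f (q + h *: b + s *: a) - f (q + s *: a).
have dg (s : R) : 0 <= s <= h ->
    is_derive s 1 g ('d f (q + h *: b + s *: a) a - 'd f (q + s *: a) a).
  move=> sh; apply: is_derive1B; apply: diff_line.
    have := small s h sh; rewrite lexx (ltW h0) => /(_ isT) S.
    by rewrite -addrA; apply: (Hr _ _).1; exact: le_lt_trans S hr.
  have := small s 0 sh; rewrite lexx (ltW h0) => /(_ isT); rewrite scale0r add0r => S.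
  by apply: (Hr _ _).1; exact: le_lt_trans S hr.
have [||c] := @MVT R g (fun s => 'd f (q + h *: b + s *: a) a - 'd f (q + s *: a) a) 0 h h0.
- by move=> x; rewrite in_itv /= => /andP[x0 xh]; apply: dg; rewrite !ltW.
- apply: derivable_within_continuous => x; rewrite in_itv /= => xh.
  by have [] := dg _ xh.
rewrite in_itv /= => /andP[c0 ch]; rewrite /g scale0r !addr0 subr0 => ->.
have chh : 0 <= c <= h by rewrite !ltW.
have := small c h chh; rewrite lexx (ltW h0) => /(_ isT) S1.
have := small c 0 chh; rewrite lexx (ltW h0) => /(_ isT); rewrite scale0r add0r => S2.
have := (Hr _ (le_lt_trans S1 hr)).2; rewrite addrA.
have := (Hr _ (le_lt_trans S2 hr)).2.
rewrite linearD /= => E2 E1.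
have Dh : 'd (fun y => 'd f y a) q (h *: b) = h * 'd (fun y => 'd f y a) q b.
  by rewrite linearZ.
set D := 'd (fun y => 'd f y a) q in E1 E2 Dh *.
set A1 := 'd f (q + h *: b + c *: a) a in E1 *.
set A2 := 'd f (q + c *: a) a in E2 *.
have -> : (A1 - A2) * h - h ^+ 2 * D b =
  h * ((A1 - 'd f q a - (D (h *: b) + D (c *: a))) - (A2 - 'd f q a - D (c *: a))).
  by rewrite Dh; ring.
rewrite normrM (gtr0_norm h0) expr2 mulrCA ler_pM2l //.
rewrite (le_trans (ler_normB _ _)) // (le_trans (lerD E1 E2)) //.
rewrite -mulrDr mulrAC ler_pdivrMr // -mulrA ler_pM2l //.
rewrite (le_trans (lerD S1 S2)) // -mulrDr ler_pM2l // /C; lra.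
Unshelve. all: by end_near. Qed.

(** The second difference is symmetric in [a] and [b], so [second_difference] used both ways puts
    the two values within [e] of each other after division by [h ^+ 2]. *)
Lemma diff_sym_real V (f : V -> R) (q a b : V) :
  (\forall y \near q, differentiable f y) ->
  (forall v, differentiable (fun y => 'd f y v) q) ->
  'd (fun y => 'd f y a) q b = 'd (fun y => 'd f y b) q a.
Proof.
move=> df dfv; apply/eqP; rewrite -subr_eq0 -normr_le0.
apply/ler_addgt0Pr => e e0; rewrite add0r; have e20 : 0 < e / 2 by rewrite divr_gt0.
near (0 : R)^'+ => h.
have h0 : 0 < h by near: h; exact: nbhs_right_gt.
have h20 : 0 < h ^+ 2 by rewrite exprn_gt0.
have H1 : `|f (q + h *: b + h *: a) - f (q + h *: a) - (f (q + h *: b) - f q)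
      - h ^+ 2 * 'd (fun y => 'd f y a) q b| <= e / 2 * h ^+ 2.
  by near: h; apply: second_difference.
have H2 : `|f (q + h *: a + h *: b) - f (q + h *: b) - (f (q + h *: a) - f q)
      - h ^+ 2 * 'd (fun y => 'd f y b) q a| <= e / 2 * h ^+ 2.
  by near: h; apply: second_difference.
rewrite -(ler_pM2r h20) -{1}(gtr0_norm h20) -normrM.
set X := 'd _ q b in H1 *; set Y := 'd _ q a in H2 *.
rewrite (addrAC q) in H2.
set F := f (q + h *: b + h *: a) in H1 H2.
have -> : (X - Y) * h ^+ 2 = (F - f (q + h *: b) - (f (q + h *: a) - f q) - h ^+ 2 * Y) -
   (F - f (q + h *: a) - (f (q + h *: b) - f q) - h ^+ 2 * X) by ring.
rewrite (le_trans (ler_normB _ _)) // (le_trans (lerD H2 H1)) //.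
by rewrite -mulrDl -splitr.
Unshelve. all: by end_near. Qed.

End Calculus.

(* Locked, as unification otherwise unfolds the choice defining ['d]. *)
HB.lock Definition dd (R : realType) (V W : normedModType R) (f : V -> W) (q v : V) : W := 'd f q v.

Section DD.
Variable R : realType.
Implicit Types U V W : normedModType R.

Lemma ddE V W (f : V -> W) q v : dd f q v = 'd f q v.
Proof. by rewrite dd.unlock. Qed.

Lemma ddfE V W (f : V -> W) v : (fun q => dd f q v) = (fun q => 'd f q v).
Proof. by apply/funext => q; rewrite ddE. Qed.

Lemma ddD V W (f : V -> W) q u v : dd f q (u + v) = dd f q u + dd f q v.
Proof. by rewrite !ddE linearD. Qed.

Lemma ddZ V W (f : V -> W) q k v : dd f q (k *: v) = k *: dd f q v.
Proof. by rewrite !ddE linearZ. Qed.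

Lemma dd0 V W (f : V -> W) q : dd f q 0 = 0.
Proof. by rewrite !ddE linear0. Qed.

Lemma ddN V W (f : V -> W) q v : dd f q (- v) = - dd f q v.
Proof. by rewrite !ddE linearN. Qed.

Lemma ddB V W (f : V -> W) q u v : dd f q (u - v) = dd f q u - dd f q v.
Proof. by rewrite ddD ddN. Qed.

Lemma dd_frame V W (f : V -> W) (I : finType) (e : I -> V)
  (l : I -> {linear V -> R}) x v : v = \sum_i l i v *: e i ->
  dd f x v = \sum_i l i v *: dd f x (e i).
Proof. by move=> le; rewrite ddE (diff_frame f x le); apply: eq_bigr => i _; rewrite ddE. Qed.

Lemma dd_linear V W (f : {linear V -> W}) q v : continuous f -> dd f q v = f v.
Proof. by move=> fc; rewrite ddE diff_lin. Qed.

Lemma dd_comp U V W (f : U -> V) (g : V -> W) q v :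
  differentiable f q -> differentiable g (f q) ->
  dd (fun y => g (f y)) q v = dd g (f q) (dd f q v).
Proof. by move=> df dg; rewrite !ddE -[X in _ = X]/((_ \o _) v) -(diff_comp df dg). Qed.

Lemma near_eq_dd V W (f g : V -> W) (x : V) v :
  (\forall y \near x, f y = g y) -> differentiable f x -> dd f x v = dd g x v.
Proof. by move=> fg df; rewrite !ddE (near_eq_diff fg df).2. Qed.

Lemma is_derive1_fun V W (f : V -> W) (z : R -> V) (t : R) (dz : V) :
  differentiable f (z t) -> is_derive t 1 z dz ->
  is_derive t 1 (fun s => f (z s)) (dd f (z t) dz).
Proof. by rewrite ddE => *; exact: (is_derive1_comp (f := f)). Qed.

Lemma is_derive1_dd V W (f : V -> W) (z a : R -> V) (t : R) (dz da : V) :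
  framed V ->
  (forall v, differentiable (fun y => dd f y v) (z t)) ->
  is_derive t 1 z dz -> is_derive t 1 a da ->
  is_derive t 1 (fun s => dd f (z s) (a s))
    (dd (fun y => dd f y (a t)) (z t) dz + dd f (z t) da).
Proof. by rewrite dd.unlock => *; exact: is_derive1_diff. Qed.

Lemma dd_line V W (f : V -> W) (x v : V) : differentiable f x ->
  is_derive (0 : R) 1 (fun s => f (x + s *: v)) (dd f x v).
Proof. by move=> df; rewrite ddE; have := @diff_line R V W f x v 0; rewrite scale0r addr0; apply. Qed.

Lemma is_derive1_unique V (f : R -> V) (t : R) (a b : V) : is_derive t 1 f a -> is_derive t 1 f b -> a = b.
Proof. by move=> A B; rewrite -(@derive_val _ _ _ _ _ _ _ A) (@derive_val _ _ _ _ _ _ _ B). Qed.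

Lemma is_derive1_linear V W (L : {linear V -> W}) (f : R -> V) (t : R) df : continuous L ->
  is_derive t 1 f df -> is_derive t 1 (fun s => L (f s)) (L df).
Proof.
move=> Lc fd; rewrite -(dd_linear (f t) df Lc); apply: is_derive1_fun => //.
exact: linear_differentiable.
Qed.

(** Linearity of [dd] in its last argument is built in, but not in the inner direction; it is
    obtained by differentiating the frame expansion along a line. [dd3_frame] repeats this one order
    higher. *)
Lemma dd2_frame V W (f : V -> W) (I : finType) (e : I -> V)
  (l : I -> {linear V -> R}) q v w :
  (forall x, x = \sum_i l i x *: e i) ->
  (forall v, differentiable (fun y => dd f y v) q) ->
  dd (fun y => dd f y v) q w = \sum_i l i v *: dd (fun y => dd f y (e i)) q w.
Proof.
move=> le df; apply: (is_derive1_unique (dd_line w (df v))).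
rewrite (_ : (fun _ => _) = (fun s => \sum_i l i v *: dd f (q + s *: w) (e i))); last first.
  by apply/funext => s; apply: dd_frame (le _).
apply: is_derive1_sum => i.
have := is_derive1Z (is_derive1_cst (l i v : R) 0) (dd_line w (df (e i))).
by rewrite scale0r add0r.
Qed.

Lemma dd3_frame V W (f : V -> W) (I : finType) (e : I -> V)
  (l : I -> {linear V -> R}) q v w u :
  (forall x, x = \sum_i l i x *: e i) ->
  (\forall y \near q, forall v, differentiable (fun y => dd f y v) y) ->
  (forall u v, differentiable (fun y => dd (fun y => dd f y u) y v) q) ->
  dd (fun y => dd (fun y => dd f y v) y w) q u =
  \sum_i l i v *: dd (fun y => dd (fun y => dd f y (e i)) y w) q u.
Proof.
move=> le df ddf; apply: (is_derive1_unique (dd_line u (ddf v w))).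
have lc0 : {for (0 : R), continuous (fun s : R => q + s *: u)}.
  apply: differentiable_continuous; apply/derivable1_diffP.
  by have [] := is_derive1_line q u 0.
have H1 : \forall s \near (0 : R), forall v, differentiable (fun y => dd f y v) (q + s *: u).
  have df' : \forall y \near (q + 0 *: u), forall v, differentiable (fun y => dd f y v) y.
    by rewrite scale0r addr0.
  exact: lc0 _ df'.
have E1 : \forall s \near (0 : R), \sum_i l i v *: dd (fun y => dd f y (e i)) (q + s *: u) w =
    dd (fun y => dd f y v) (q + s *: u) w.
  by apply: filterS H1 => s H1; rewrite [RHS](dd2_frame _ _ le).
apply: near_eq_is_derive E1 _; apply: is_derive1_sum => i.
have := is_derive1Z (is_derive1_cst (l i v : R) 0) (dd_line u (ddf (e i) w)).
by rewrite scale0r add0r.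
Qed.

Lemma is_derive1_dd2 V W (f : V -> W) (z a b : R -> V) (t : R) (dz da db : V) :
  framed V ->
  (\forall y \near z t, forall v, differentiable (fun y => dd f y v) y) ->
  (forall u v, differentiable (fun y => dd (fun y => dd f y u) y v) (z t)) ->
  is_derive t 1 z dz -> is_derive t 1 a da -> is_derive t 1 b db ->
  is_derive t 1 (fun s => dd (fun y => dd f y (a s)) (z s) (b s))
    (dd (fun y => dd (fun y => dd f y (a t)) y (b t)) (z t) dz +
     dd (fun y => dd f y da) (z t) (b t) + dd (fun y => dd f y (a t)) (z t) db).
Proof.
move=> Vf; have [I [e [l [lc le]]]] := Vf.
move=> df ddf zd ad bd.
have dft := nbhs_singleton df.
have zc : {for t, continuous z}.
  by apply: differentiable_continuous; apply/derivable1_diffP; case: zd.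
have E : \forall s \near t, \sum_i l i (a s) *: dd (fun y => dd f y (e i)) (z s) (b s) =
   dd (fun y => dd f y (a s)) (z s) (b s).
  have H : \forall s \near t, forall v, differentiable (fun y => dd f y v) (z s) := zc _ df.
  by apply: filterS H => s H; rewrite [RHS](dd2_frame _ _ le).
apply: near_eq_is_derive E _.
have H i : is_derive t 1 (fun s => l i (a s) *: dd (fun y => dd f y (e i)) (z s) (b s))
  (l i da *: dd (fun y => dd f y (e i)) (z t) (b t) +
   l i (a t) *: (dd (fun y => dd (fun y => dd f y (e i)) y (b t)) (z t) dz +
     dd (fun y => dd f y (e i)) (z t) db)).
  apply: is_derive1Z; first exact: is_derive1_linear.
  by apply: (is_derive1_dd (f := fun y => dd f y (e i))).
apply: is_derive_eq; first exact: is_derive1_sum.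
rewrite (dd3_frame _ _ _ le) // (dd2_frame da _ le) // (dd2_frame (a t) db le) //.
by rewrite -!big_split /=; apply: eq_bigr => i _; rewrite scalerDr addrA (addrC (_ *: dd _ _ (b t))).
Qed.

(** The coordinates of [f] in the frame of [W] are real valued, so [diff_sym_real] applies to each
    of them. *)
Lemma dd_sym V W (f : V -> W) (q a b : V) : framed W ->
  (\forall y \near q, differentiable f y) ->
  (forall v, differentiable (fun y => dd f y v) q) ->
  dd (fun y => dd f y a) q b = dd (fun y => dd f y b) q a.
Proof.
move=> [I [e [l [lc le]]]] df dfv.
have ld i x : differentiable (l i) x by exact: linear_differentiable.
have H1 i : \forall y \near q, differentiable (fun y => l i (f y)) y.
  by apply: filterS df => y dfy; apply: differentiable_comp.
have H2 i v : \forall y \near q, l i (dd f y v) = dd (fun y => l i (f y)) y v.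
  apply: filterS df => y dfy.
  by rewrite (dd_comp (g := l i)) // dd_linear.
have H3 i v : differentiable (fun y => l i (dd f y v)) q.
  by apply: differentiable_comp.
have H4 i v w : dd (fun y => dd (fun y => l i (f y)) y v) q w = l i (dd (fun y => dd f y v) q w).
  rewrite -(near_eq_dd w (H2 i v) (H3 i v)).
  by rewrite (dd_comp (g := l i)) // dd_linear.
rewrite (le (dd _ q b)) [RHS]le; apply: eq_bigr => i _; congr (_ *: _).
rewrite -!H4.
have H5 v : differentiable (fun y => dd (fun y => l i (f y)) y v) q.
  exact: (near_eq_diff (H2 i v) (H3 i v)).1.
by move: H5; rewrite dd.unlock => H5; exact: diff_sym_real.
Qed.

End DD.

(** * Stability of C^k maps *)

Section CkTheory.
Variable R : realType.
Implicit Types U V W : normedModType R.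

Lemma Ck_sub V W k (A B : set V) (f : V -> W) : B `<=` A -> Ck k A f -> Ck k B f.
Proof.
move=> BA; elim: k f => [|k IH] f /=; first by move=> H x /BA; exact: H.
by move=> [H1 H2]; split=> [x /BA|v]; [exact: H1|exact: IH].
Qed.

Lemma Ck_eq V W k (A : set V) (f g : V -> W) : open A -> {in A, f =1 g} ->
  Ck k A f -> Ck k A g.
Proof.
move=> oA; elim: k f g => [|k IH] f g fg /=.
  move=> H x Ax; have E : \forall y \near x, f y = g y.
    by apply: filterS (open_nbhs_nbhs (conj oA Ax)) => y Ay; apply: fg; rewrite inE.
  apply: cvg_trans (near_eq_cvg E) _; rewrite -(nbhs_singleton E); exact: H.
move=> [H1 H2].
have E x : A x -> \forall y \near x, f y = g y.
  by move=> Ax; apply: filterS (open_nbhs_nbhs (conj oA Ax)) => y Ay; apply: fg; rewrite inE.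
split=> [x Ax|v]; first exact: (near_eq_diff (E x Ax) (H1 x Ax)).1.
apply: IH (H2 v) => x; rewrite inE => Ax.
by rewrite (near_eq_diff (E x Ax) (H1 x Ax)).2.
Qed.

Lemma CkS V W k (A : set V) (f : V -> W) : Ck k.+1 A f -> Ck k A f.
Proof.
elim: k f => [|k IH] f /=.
  by move=> [H _] x Ax; apply: differentiable_continuous; exact: H.
by move=> [H1 H2]; split=> // v; apply: IH; exact: H2.
Qed.

Lemma Ck_cst V W k (A : set V) (c : W) : Ck k A (fun=> c).
Proof.
elim: k c => [|k IH] c /=; first by move=> x Ax; exact: cvg_cst.
split=> [x _|v]; first exact: differentiable_cst.
rewrite (_ : (fun _ => _) = fun=> 0); first exact: IH.
by apply/funext => x; rewrite diff_cst.
Qed.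

Lemma Ck_linear V W k (A : set V) (f : {linear V -> W}) : continuous f -> Ck k A f.
Proof.
move=> fc; case: k => [|k] /=; first by move=> x Ax; exact: fc.
split=> [x _|v]; first exact: linear_differentiable.
rewrite (_ : (fun _ => _) = fun=> f v); first exact: Ck_cst.
by apply/funext => x; rewrite diff_lin.
Qed.

Lemma CkD V W k (A : set V) (f g : V -> W) : open A ->
  Ck k A f -> Ck k A g -> Ck k A (fun x => f x + g x).
Proof.
move=> oA; elim: k f g => [|k IH] f g /=.
  by move=> H1 H2 x Ax; apply: cvgD; [exact: H1|exact: H2].
move=> [f1 f2] [g1 g2]; split=> [x Ax|v].
  by apply: differentiableD; [exact: f1|exact: g1].
apply: Ck_eq (IH _ _ (f2 v) (g2 v)) => // x; rewrite inE => Ax.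
exact: (congr1 (@^~ v) (esym (diffD (f1 _ Ax) (g1 _ Ax)))).
Qed.

Lemma Ck_lin_comp U V W k (A : set V) (f : V -> U) (L : {linear U -> W}) : open A ->
  continuous L -> Ck k A f -> Ck k A (fun x => L (f x)).
Proof.
move=> oA Lc; elim: k f => [|k IH] f /=.
  by move=> H1 x Ax; apply: (cvg_comp _ _ (H1 x Ax)); exact: Lc.
have Ld x : differentiable L x by exact: linear_differentiable.
move=> [f1 f2]; split=> [x Ax|v].
  by apply: (differentiable_comp (f := f) (g := L)) => //; exact: f1.
apply: Ck_eq (IH _ (f2 v)) => // x; rewrite inE => Ax.
by rewrite (diff_comp (f1 _ Ax)) //= diff_lin.
Qed.

Lemma Ck_comp_lin U V W k (A : set V) (f : V -> W) (L : {linear U -> V}) : open A ->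
  continuous L -> Ck k A f -> Ck k (L @^-1` A) (f \o L).
Proof.
move=> oA Lc; elim: k f => [|k IH] f /=.
  move=> H1 x Ax; apply: continuous_comp; [exact: Lc|exact: H1].
have Ld x : differentiable L x by exact: linear_differentiable.
have oLA : open (L @^-1` A) by apply: open_comp => // x _; exact: Lc.
move=> [f1 f2]; split=> [x Ax|v].
  by apply: differentiable_comp => //; exact: f1.
apply: Ck_eq (IH _ (f2 (L v))) => // x; rewrite inE => Ax.
by rewrite (diff_comp (Ld _)) //= ?diff_lin //; exact: f1.
Qed.

Lemma CkM V k (A : set V) (f g : V -> R) : open A ->
  Ck k A f -> Ck k A g -> Ck k A (fun x => f x * g x).
Proof.
move=> oA; elim: k f g => [|k IH] f g.
  by move=> H1 H2 x Ax; apply: cvgM; [exact: H1|exact: H2].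
move=> fk gk; have f0 := CkS fk; have g0 := CkS gk.
case: fk gk => [f1 f2] [g1 g2]; split=> [x Ax|v].
  by apply: differentiableM; [exact: f1|exact: g1].
apply: Ck_eq (CkD oA (IH _ _ f0 (g2 v)) (IH _ _ g0 (f2 v))) => // x; rewrite inE => Ax.
exact: (congr1 (@^~ v) (esym (diffM (f1 _ Ax) (g1 _ Ax)))).
Qed.

Lemma Ck_sum V W (I : Type) (r : seq I) (P : pred I) k (A : set V) (f : I -> V -> W) : open A ->
  (forall i, Ck k A (f i)) -> Ck k A (fun x => \sum_(i <- r | P i) f i x).
Proof.
move=> oA H; elim: r => [|i r IH].
  by apply: Ck_eq (Ck_cst k A (0 : W)) => // x _; rewrite big_nil.
case Pi : (P i).
  by apply: Ck_eq (CkD oA (H i) IH) => // x _; rewrite big_cons Pi.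
by apply: Ck_eq IH => // x _; rewrite big_cons Pi.
Qed.

Lemma Ck_prod V (I : Type) (r : seq I) (P : pred I) k (A : set V) (f : I -> V -> R) : open A ->
  (forall i, Ck k A (f i)) -> Ck k A (fun x => \prod_(i <- r | P i) f i x).
Proof.
move=> oA H; elim: r => [|i r IH].
  by apply: Ck_eq (Ck_cst k A (1 : R)) => // x _; rewrite big_nil.
case Pi : (P i).
  by apply: Ck_eq (CkM oA (H i) IH) => // x _; rewrite big_cons Pi.
by apply: Ck_eq IH => // x _; rewrite big_cons Pi.
Qed.

Lemma CkN V W k (A : set V) (f : V -> W) : open A -> Ck k A f -> Ck k A (fun x => - f x).
Proof.
move=> oA; elim: k f => [|k IH] f /=.
  by move=> H1 x Ax; apply: cvgN; exact: H1.
move=> [f1 f2]; split=> [x Ax|v].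
  by apply: differentiableN; exact: f1.
apply: Ck_eq (IH _ (f2 v)) => // x; rewrite inE => Ax.
exact: (congr1 (@^~ v) (esym (diffN (f1 _ Ax)))).
Qed.

Lemma CkV V k (A : set V) (f : V -> R) : open A -> (forall x, A x -> f x != 0) ->
  Ck k A f -> Ck k A (fun x => (f x)^-1).
Proof.
move=> oA fn0; elim: k => [|k IH].
  by move=> H1 x Ax; apply: cvgV; [exact: fn0|exact: H1].
move=> fk; have f0 := IH (CkS fk); case: fk => [f1 f2]; split=> [x Ax|v].
  by apply: differentiableV; [exact: f1|exact: fn0].
apply: Ck_eq (CkM oA (CkN oA (CkM oA f0 f0)) (f2 v)) => // x; rewrite inE => Ax.
rewrite -invfM -expr2.
exact: (congr1 (@^~ v) (esym (diffV (f1 _ Ax) (fn0 _ Ax)))).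
Qed.

(** The derivative is df / (2 sqrt f), which contains sqrt f again, so the induction on [k] closes
    through [CkV] and [CkM]. *)
Lemma Ck_sqrt V k (A : set V) (f : V -> R) : open A -> (forall x, A x -> 0 < f x) ->
  Ck k A f -> Ck k A (fun x => Num.sqrt (f x)).
Proof.
move=> oA f0; elim: k => [|k IH].
  by move=> H1 x Ax; apply: (continuous_comp (f := f)); [exact: H1|exact: sqrt_continuous].
move=> fk; have s0 := IH (CkS fk); case: fk => [f1 f2].
have sd x : A x -> is_derive (f x) 1 (Num.sqrt : R -> R) (2 * Num.sqrt (f x))^-1.
  by move=> Ax; apply: is_derive1_sqrt; exact: f0.
have sdd x : A x -> differentiable (Num.sqrt : R -> R) (f x).
  by move=> Ax; apply/derivable1_diffP; case: (sd _ Ax).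
split=> [x Ax|v]; first by apply: differentiable_comp; [exact: f1|exact: sdd].
have n0 x : A x -> 2 * Num.sqrt (f x) != 0.
  by move=> Ax; rewrite mulf_neq0 // gt_eqF // sqrtr_gt0 f0.
apply: Ck_eq (CkM oA (CkV oA n0 (CkM oA (Ck_cst k A (2 : R)) s0)) (f2 v)) => // x; rewrite inE => Ax.
rewrite -[RHS]ddE dd_comp; [|exact: f1|exact: sdd].
have -> : dd (Num.sqrt : R -> R) (f x) (dd f x v) = dd f x v * dd (Num.sqrt : R -> R) (f x) 1.
  rewrite -[in LHS](mulr1 (dd f x v)).
  exact: ddZ.
rewrite !ddE -(deriveE _ (sdd _ Ax)).
by rewrite (@derive_val _ _ _ _ _ _ _ (sd _ Ax)) mulrC.
Qed.

Lemma smooth_dd V W (A : set V) (f : V -> W) : smooth A f ->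
  (forall x, A x -> differentiable f x) /\ forall v, smooth A (fun y => dd f y v).
Proof.
move=> H; split=> [x Ax|v k]; first by have [+ _] := H 1%N; apply.
by rewrite ddfE; have [_ +] := H k.+1; apply.
Qed.

End CkTheory.

(** * Euler-Lagrange equations under a twist *)

Section EulerLagrange.
Variable R : realType.
Implicit Types V W : normedModType R.

Lemma is_derive1_pair V W (f : R -> V) (g : R -> W) (t : R) df dg :
  is_derive t 1 f df -> is_derive t 1 g dg ->
  is_derive t 1 (fun s => (f s, g s)) (df, dg).
Proof.
move=> [fd <-] [gd <-].
have fd' : differentiable f t by apply/derivable1_diffP.
have gd' : differentiable g t by apply/derivable1_diffP.
have pd : differentiable (fun s => (f s, g s)) t by apply: differentiable_pair.
apply: DeriveDef; first exact/derivable1_diffP.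
by rewrite !deriveE // diff_pair.
Qed.

Lemma is_derive1_continuous V (f : R -> V) (t : R) df :
  is_derive t 1 f df -> {for t, continuous f}.
Proof. by move=> [fd _]; apply: differentiable_continuous; apply/derivable1_diffP. Qed.

Lemma near_continuous V (f : R -> V) (t : R) df (P : V -> Prop) :
  is_derive t 1 f df -> (\forall y \near f t, P y) -> \forall s \near t, P (f s).
Proof. by move=> /is_derive1_continuous fc; exact: fc. Qed.

(** In this variant and the next ones the base point is tied to the curve by an equation, because
    the curves used as tests take their prescribed values at 0 only up to a propositional
    equality. *)
Lemma is_derive1_fun_at V W (f : V -> W) (z : R -> V) (t : R) (q dz : V) :
  z t = q -> differentiable f q -> is_derive t 1 z dz ->
  is_derive t 1 (fun s => f (z s)) (dd f q dz).
Proof. by move=> <-; exact: is_derive1_fun. Qed.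

Lemma is_derive1_dd_at V W (f : V -> W) (z a : R -> V) (t : R) (q u dz da : V) :
  framed V -> z t = q -> a t = u ->
  (forall v, differentiable (fun y => dd f y v) q) ->
  is_derive t 1 z dz -> is_derive t 1 a da ->
  is_derive t 1 (fun s => dd f (z s) (a s))
    (dd (fun y => dd f y u) q dz + dd f q da).
Proof. by move=> Vf <- <-; exact: is_derive1_dd. Qed.

Lemma near_at V (z : R -> V) (t : R) (q dz : V) (P : V -> Prop) :
  z t = q -> is_derive t 1 z dz -> (\forall y \near q, P y) -> \forall s \near t, P (z s).
Proof. by move=> <-; exact: near_continuous. Qed.

Lemma smooth_at V W (A : set V) (f : V -> W) (q : V) : open A -> smooth A f -> A q ->
  [/\ \forall y \near q, A y,
      \forall y \near q, differentiable f y,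
      \forall y \near q, forall v, differentiable (fun y => dd f y v) y &
      forall u v, differentiable (fun y => dd (fun y => dd f y u) y v) q].
Proof.
move=> oA fs Aq; have nA := open_nbhs_nbhs (conj oA Aq).
have [f1 f2] := smooth_dd fs.
split => //; first by apply: filterS nA => y Ay; exact: f1.
  by apply: filterS nA => y Ay v; have [+ _] := smooth_dd (f2 v); apply.
move=> u v; have [_ f3] := smooth_dd (f2 u).
by have [+ _] := smooth_dd (f3 v); apply.
Qed.

Lemma scaleRM (a b : R) : a *: (b : (R : normedModType R)) = a * b :> R.
Proof. by []. Qed.

(* The Euler-Lagrange covector of [g] at the 2-jet [(x, y, z)]. *)
Definition EL V (g : V * V -> R) (x y z w : V) : R :=
  dd (fun q => dd g q (0, w)) (x, y) (y, z) - dd g (x, y) (w, 0).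

(* Its linearisation at [(x, y, z)] along the jet [(X, Y, Z)]. *)
Definition linEL V (g : V * V -> R) (x y z X Y Z w : V) : R :=
  dd (fun q => dd (fun q => dd g q (0, w)) q (y, z)) (x, y) (X, Y)
  + dd (fun q => dd g q (0, w)) (x, y) (Y, Z)
  - dd (fun q => dd g q (w, 0)) (x, y) (X, Y).

(** Test curves: an identity valid near a point is differentiated along them, and
    [is_derive1_unique] then compares the two sides. *)
Lemma ex_curve V (x v : V) : exists c : R -> V, c 0 = x /\ is_derive (0 : R) 1 c v.
Proof.
exists (fun s => x + s *: v); split; first by rewrite scale0r addr0.
exact: is_derive1_line.
Qed.

Section Jets.
Variables (V : normedModType R) (Vf : framed V).
Let V2f := framed_prod Vf Vf.
Let RVf := framed_prod (@framed_real R) Vf.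

Lemma ELD (A : set (V * V)) (g : V * V -> R) (x y z u w : V) : open A -> smooth A g -> A (x, y) ->
  EL g x y z (u + w) = EL g x y z u + EL g x y z w.
Proof.
move=> oA gs Aq; have [_ _ g2 _] := smooth_at oA gs Aq.
have dg v := nbhs_singleton g2 v.
rewrite /EL; have -> : (fun q => dd g q (0, u + w)) = (fun q => dd g q (0, u) + dd g q (0, w)).
  by apply/funext => q; rewrite -ddD; congr (dd g q (_, _)); rewrite ?addr0.
have -> : (u + w, 0) = (u, 0) + (w, 0) :> V * V by congr (_, _); rewrite ?addr0.
have -> : dd (fun q => dd g q (0, u) + dd g q (0, w)) (x, y) (y, z) =
   dd (fun q => dd g q (0, u)) (x, y) (y, z) + dd (fun q => dd g q (0, w)) (x, y) (y, z).
  by rewrite !ddE -[RHS]/((_ \+ _) _) -(diffD (dg (0, u)) (dg (0, w))).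
by rewrite ddD; ring.
Qed.

Lemma dd_scale (h : V * V -> R) (k : R) q v : differentiable h q ->
  dd (fun q => k * h q) q v = k * dd h q v.
Proof.
move=> hd; have kd : differentiable (fun q => k * h q) q by exact: differentiableZ.
have := is_derive1Z (is_derive1_cst k 0) (dd_line v hd); rewrite scale0r add0r scaleRM.
exact: is_derive1_unique (dd_line v kd).
Qed.

Lemma ELZ (A : set (V * V)) (g : V * V -> R) (x y z w : V) (k : R) : open A -> smooth A g -> A (x, y) ->
  EL g x y z (k *: w) = k * EL g x y z w.
Proof.
move=> oA gs Aq; have [_ _ g2 _] := smooth_at oA gs Aq.
rewrite /EL; have -> : (fun q => dd g q (0, k *: w)) = (fun q => k * dd g q (0, w)).
  by apply/funext => q; rewrite -scaleRM -ddZ; congr (dd g q (_, _)); rewrite /= ?scaler0.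
have -> : (k *: w, 0) = k *: (w, 0) :> V * V by congr (_, _); rewrite /= ?scaler0.
rewrite dd_scale; last exact: nbhs_singleton g2 _.
by rewrite ddZ scaleRM mulrBr.
Qed.

Lemma is_derive1_EL (A : set (V * V)) (g : V * V -> R) (xs ys zs ws : R -> V) (t : R) (X Y Z U : V) :
  open A -> smooth A g -> A (xs t, ys t) ->
  is_derive t 1 xs X -> is_derive t 1 ys Y -> is_derive t 1 zs Z -> is_derive t 1 ws U ->
  is_derive t 1 (fun s => EL g (xs s) (ys s) (zs s) (ws s))
    (linEL g (xs t) (ys t) (zs t) X Y Z (ws t) + EL g (xs t) (ys t) (zs t) U).
Proof.
move=> oA gs Aq dx dy dz dw; have [_ _ g2 g3] := smooth_at oA gs Aq.
have c0 := is_derive1_cst (0 : V) t.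
have H1 := is_derive1_dd2 V2f g2 g3 (is_derive1_pair dx dy) (is_derive1_pair c0 dw) (is_derive1_pair dy dz).
have H2 := is_derive1_dd V2f (nbhs_singleton g2) (is_derive1_pair dx dy) (is_derive1_pair dw c0).
suff -> : linEL g (xs t) (ys t) (zs t) X Y Z (ws t) + EL g (xs t) (ys t) (zs t) U =
  dd (fun y => dd (fun y => dd g y (0, ws t)) y (ys t, zs t)) (xs t, ys t) (X, Y) +
  dd (fun y => dd g y (0, U)) (xs t, ys t) (ys t, zs t) +
  dd (fun y => dd g y (0, ws t)) (xs t, ys t) (Y, Z) -
  (dd (fun y => dd g y (ws t, 0)) (xs t, ys t) (X, Y) + dd g (xs t, ys t) (U, 0)).
  exact: is_derive1B H1 H2.
by rewrite /linEL /EL; ring.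
Qed.

(** The elimination that closes [EL_twist], as linear algebra. There [t1] and [e] are the images of
    (1, 0) and (0, w) under d(phi), [S1] and [S2] are the second derivatives of [phi] with (1, y) in
    the same two directions, [fx] is f_x(w), [p] is f_y(w), [p'] is its derivative along the jet,
    and [M] is the derivative of g_y. *)
Lemma twist_algebra (g : V * V -> R) q (t1 e S1 S2 : V) (M fx p p' : R) :
  dd g q (t1, S1) = 0 -> dd g q (e, S2 + fx *: t1) = fx ->
  M + dd g q (0, p *: S1 + S2 + p' *: t1) = p' ->
  (1 - dd g q (0, t1)) * (p' - fx) = M - dd g q (p *: t1 + e, 0).
Proof.
have gE a b : dd g q (a, b) = dd g q (a, 0) + dd g q (0, b).
  by rewrite -ddD; congr (dd _ _ (_, _)); rewrite /= ?addr0 ?add0r.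
have gD1 a b : dd g q (a + b, 0) = dd g q (a, 0) + dd g q (b, 0).
  by rewrite -ddD; congr (dd _ _ (_, _)); rewrite /= ?addr0.
have gD2 a b : dd g q (0, a + b) = dd g q (0, a) + dd g q (0, b).
  by rewrite -ddD; congr (dd _ _ (_, _)); rewrite /= ?addr0.
have gZ1 (k : R) a : dd g q (k *: a, 0) = k * dd g q (a, 0).
  by rewrite -scaleRM -ddZ; congr (dd _ _ (_, _)); rewrite /= ?scaler0.
have gZ2 (k : R) a : dd g q (0, k *: a) = k * dd g q (0, a).
  by rewrite -scaleRM -ddZ; congr (dd _ _ (_, _)); rewrite /= ?scaler0.
rewrite (gE t1) (gE e) !gD2 (gZ2 fx) (gZ2 p) (gZ2 p') gD1 gZ1 => Ht Hx HE.
have {}Ht : p * (dd g q (t1, 0) + dd g q (0, S1)) = 0 by rewrite Ht mulr0.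
by lra.
Qed.

Section Twist.
Variables (A B : set (V * V)) (D : set (R * V)) (f g : V * V -> R) (phi : R * V -> V).
Hypotheses (oA : open A) (oB : open B) (oD : open D).
Hypotheses (fs : smooth A f) (gs : smooth B g) (phis : smooth D phi).
(* If [c] has [f]-speed 1, then [phi (t, c t)] has [g]-speed 1; more generally
   time may run at any rate, as long as it equals the speed of [c]. *)
Hypothesis Z : forall t x v, D (t, x) -> A (x, v) ->
  B (phi (t, x), dd phi (t, x) (f (x, v), v)) /\
  g (phi (t, x), dd phi (t, x) (f (x, v), v)) = f (x, v).

(** [Z] holds at all nearby points of the open domains, so it may be differentiated along a free
    curve in (t, x, v). The next three lemmas are the partial derivatives. *)
Lemma twist_derive (ts : R -> R) (xs vs : R -> V) (s dt : R) (dx dv : V) :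
  D (ts s, xs s) -> A (xs s, vs s) ->
  is_derive s 1 ts dt -> is_derive s 1 xs dx -> is_derive s 1 vs dv ->
  dd g (phi (ts s, xs s), dd phi (ts s, xs s) (f (xs s, vs s), vs s))
    (dd phi (ts s, xs s) (dt, dx), dd (fun q => dd phi q (f (xs s, vs s), vs s)) (ts s, xs s) (dt, dx) +
      dd phi (ts s, xs s) (dd f (xs s, vs s) (dx, dv), dv)) = dd f (xs s, vs s) (dx, dv).
Proof.
move=> Dq Aq dts dxs dvs.
have [nD p1 p2 p3] := smooth_at oD phis Dq.
have [nA f1 f2 f3] := smooth_at oA fs Aq.
have [Bq gE] := Z Dq Aq.
have [nB g1 g2 g3] := smooth_at oB gs Bq.
have dq := is_derive1_pair dts dxs.
have df := is_derive1_fun (nbhs_singleton f1) (is_derive1_pair dxs dvs).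
have dphi := is_derive1_fun (nbhs_singleton p1) dq.
have dp := is_derive1_dd RVf (nbhs_singleton p2) dq (is_derive1_pair df dvs).
have dg := is_derive1_fun (nbhs_singleton g1) (is_derive1_pair dphi dp).
apply: (is_derive1_unique dg); apply: near_eq_is_derive df.
have N1 := near_continuous dq nD.
have N2 := near_continuous (is_derive1_pair dxs dvs) nA.
by apply: filterS2 N1 N2 => r Dr Ar; have [_ ->] := Z Dr Ar.
Qed.

Lemma twist_dv t x v w : D (t, x) -> A (x, v) ->
  dd g (phi (t, x), dd phi (t, x) (f (x, v), v)) (0, dd phi (t, x) (dd f (x, v) (0, w), w)) =
  dd f (x, v) (0, w).
Proof.
move=> Dq Aq; have [vs [vs0 dvs]] := ex_curve v w.
have := @twist_derive (fun _ => t) (fun _ => x) vs 0 0 0 w.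
rewrite vs0 => /(_ Dq Aq (is_derive1_cst t _) (is_derive1_cst x _) dvs).
by rewrite !dd0 add0r.
Qed.

Lemma twist_dx t x v w : D (t, x) -> A (x, v) ->
  dd g (phi (t, x), dd phi (t, x) (f (x, v), v))
    (dd phi (t, x) (0, w), dd (fun q => dd phi q (f (x, v), v)) (t, x) (0, w) +
       dd phi (t, x) (dd f (x, v) (w, 0), 0)) =
  dd f (x, v) (w, 0).
Proof.
move=> Dq Aq; have [xs [xs0 dxs]] := ex_curve x w.
have := @twist_derive (fun _ => t) xs (fun _ => v) 0 0 w 0.
by rewrite xs0 => /(_ Dq Aq (is_derive1_cst t _) dxs (is_derive1_cst v _)).
Qed.

(** The right-hand side is 0 because [f] does not depend on time. *)
Lemma twist_dt t x v : D (t, x) -> A (x, v) ->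
  dd g (phi (t, x), dd phi (t, x) (f (x, v), v))
    (dd phi (t, x) (1, 0), dd (fun q => dd phi q (f (x, v), v)) (t, x) (1, 0)) = 0.
Proof.
move=> Dq Aq.
have [ts [ts0 dts]] := @ex_curve R t 1.
have := @twist_derive ts (fun _ => x) (fun _ => v) 0 1 0 0.
rewrite ts0 => /(_ Dq Aq dts (is_derive1_cst x _) (is_derive1_cst v _)).
by rewrite !dd0 addr0.
Qed.

Section Jet.
Variables (t : R) (x y z : V).
Hypotheses (Dq : D (t, x)) (Aq : A (x, y)) (f1 : f (x, y) = 1) (df0 : dd f (x, y) (y, z) = 0).
Let x1 := phi (t, x).
Let y1 := dd phi (t, x) (1, y).
Let z1 := dd (fun q => dd phi q (1, y)) (t, x) (1, y) + dd phi (t, x) (0, z).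

(** Differentiate [Z] along the jet itself with time at rate 1. By [df0] the rate [f (x, v)] has
    zero derivative, so the velocity of the image changes exactly by [z1]. *)
Lemma twist_unit : [/\ B (x1, y1), g (x1, y1) = 1 & dd g (x1, y1) (y1, z1) = 0].
Proof.
have [Bq gE] := Z Dq Aq; rewrite f1 in Bq gE; split => //.
have [xs [xs0 dxs]] := ex_curve x y.
have [ys [ys0 dys]] := ex_curve y z.
have [ts [ts0 dts]] := @ex_curve R t 1.
have := @twist_derive ts xs ys 0 1 y z.
by rewrite ts0 xs0 ys0 => /(_ Dq Aq dts dxs dys); rewrite df0 f1.
Qed.

(* Differentiate along the jet the identity [twist_dv], and eliminate the
   derivatives of [phi] by means of [twist_dx] and [twist_dt]. *)
Lemma EL_twist w :
  (1 - dd g (x1, y1) (0, dd phi (t, x) (1, 0))) * EL f x y z w =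
  EL g x1 y1 z1 (dd phi (t, x) (dd f (x, y) (0, w), w)).
Proof.
have [Bq _ _] := twist_unit.
have [xs [xs0 dxs]] := ex_curve x y.
have [ys [ys0 dys]] := ex_curve y z.
have [ts [ts0 dts]] := @ex_curve R t 1.
have [nD p1 p2 p3] := smooth_at oD phis Dq.
have [nA fd1 fd2 fd3] := smooth_at oA fs Aq.
have [nB gd1 gd2 gd3] := smooth_at oB gs Bq.
have dq := is_derive1_pair dts dxs; have dxy := is_derive1_pair dxs dys.
have Dq0 : (ts 0, xs 0) = (t, x) by rewrite ts0 xs0.
have Aq0 : (xs 0, ys 0) = (x, y) by rewrite xs0 ys0.
have dfs : is_derive (0 : R) 1 (fun s => f (xs s, ys s)) 0.
  have := is_derive1_fun_at Aq0 (nbhs_singleton fd1) dxy.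
  by rewrite df0.
have fy0 : (f (xs 0, ys 0), ys 0) = (1, y) by rewrite Aq0 f1 ys0.
have dphi : is_derive (0 : R) 1 (fun s => phi (ts s, xs s)) y1.
  by apply: is_derive1_fun_at Dq0 _ dq; exact: nbhs_singleton p1.
have dphi2 : is_derive (0 : R) 1 (fun s => dd phi (ts s, xs s) (f (xs s, ys s), ys s)) z1.
  apply: is_derive1_dd_at RVf Dq0 fy0 _ dq (is_derive1_pair dfs dys).
  exact: nbhs_singleton p2.
pose p' := dd (fun q => dd f q (0, w)) (x, y) (y, z).
have dp : is_derive (0 : R) 1 (fun s => dd f (xs s, ys s) (0, w)) p'.
  exact: (is_derive1_fun_at Aq0 (nbhs_singleton fd2 (0, w)) dxy).
have fp0 : (dd f (xs 0, ys 0) (0, w), w) = (dd f (x, y) (0, w), w) by rewrite Aq0.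
have dphi3 : is_derive (0 : R) 1 (fun s => dd phi (ts s, xs s) (dd f (xs s, ys s) (0, w), w))
    (dd (fun q => dd phi q (dd f (x, y) (0, w), w)) (t, x) (1, y) + dd phi (t, x) (p', 0)).
  apply: is_derive1_dd_at RVf Dq0 fp0 _ dq (is_derive1_pair dp (is_derive1_cst w _)).
  exact: nbhs_singleton p2.
have gq0 : (phi (ts 0, xs 0), dd phi (ts 0, xs 0) (f (xs 0, ys 0), ys 0)) = (x1, y1).
  by rewrite Dq0 fy0.
have gp0 : ((0 : V), dd phi (ts 0, xs 0) (dd f (xs 0, ys 0) (0, w), w)) =
   (0, dd phi (t, x) (dd f (x, y) (0, w), w)) by rewrite Dq0 Aq0.
have dL := is_derive1_dd_at V2f gq0 gp0 (nbhs_singleton gd2) (is_derive1_pair dphi dphi2)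
   (is_derive1_pair (is_derive1_cst (0 : V) _) dphi3).
set p := dd f (x, y) (0, w) in dL *.
have N1 := near_at Dq0 dq nD; have N2 := near_at Aq0 dxy nA.
have {N1 N2} E : \forall s \near (0 : R), dd f (xs s, ys s) (0, w) =
    dd g (phi (ts s, xs s), dd phi (ts s, xs s) (f (xs s, ys s), ys s))
         (0, dd phi (ts s, xs s) (dd f (xs s, ys s) (0, w), w)).
  by apply: filterS2 N1 N2 => r Dr Ar; rewrite twist_dv.
have {E} := is_derive1_unique dL (near_eq_is_derive E dp).
have Ew : (p, w) = p *: (1, 0) + (0, w) :> R * V.
  by congr (_, _); rewrite /= ?scaler0 ?add0r // addr0 [_ *: _]mulr1.
have := twist_dx w Dq Aq; have := twist_dt Dq Aq.
rewrite f1 -/x1 -/y1.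
(* Symmetry of the second differential of [phi] trades the derivative along the jet for derivatives
   in the time direction and in the direction [w], the ones that [twist_dt] and [twist_dx]
   control. *)
have -> : dd (fun q => dd phi q (p, w)) (t, x) (1, y) =
    p *: dd (fun q => dd phi q (1, y)) (t, x) (1, 0) + dd (fun q => dd phi q (1, y)) (t, x) (0, w).
  by rewrite (dd_sym _ _ Vf p1 (nbhs_singleton p2)) Ew ddD ddZ.
have -> : dd phi (t, x) (p, w) = p *: dd phi (t, x) (1, 0) + dd phi (t, x) (0, w).
  by rewrite Ew ddD ddZ.
have E1 (k : R) : dd phi (t, x) (k, 0) = k *: dd phi (t, x) (1, 0).
  by rewrite -ddZ; congr (dd _ _ (_, _)); rewrite /= ?scaler0 // [_ *: _]mulr1.
have ELf : EL f x y z w = p' - dd f (x, y) (w, 0) by [].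
rewrite ELf (E1 p') (E1 (dd f (x, y) (w, 0))) /EL {ELf E1}.
move=> Ht Hx HE; exact: twist_algebra Ht Hx HE.
Qed.

Hypothesis phi_onto : forall b, exists w, dd phi (t, x) (0, w) = b.
Hypothesis g_euler : dd g (x1, y1) (0, y1) = g (x1, y1).

Lemma twist_dv_split w : dd g (x1, y1) (0, dd phi (t, x) (0, w)) =
  (1 - dd g (x1, y1) (0, dd phi (t, x) (1, 0))) * dd f (x, y) (0, w).
Proof.
have := twist_dv w Dq Aq; rewrite f1 -/x1 -/y1.
set p := dd f _ _.
have -> : (0, dd phi (t, x) (p, w)) = p *: (0, dd phi (t, x) (1, 0)) + (0, dd phi (t, x) (0, w)) :> V * V.
  congr (_, _); rewrite /= ?scaler0 ?addr0 // -ddZ -ddD; congr (dd _ _ (_, _)).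
    by rewrite /= addr0 [RHS]mulr1.
  by rewrite /= scaler0 add0r.
rewrite ddD ddZ scaleRM => E; lra.
Qed.

(* Were it 0, [twist_dv_split] would make [g_y] vanish, against Euler's identity. *)
Lemma kappa_neq0 : 1 - dd g (x1, y1) (0, dd phi (t, x) (1, 0)) != 0.
Proof.
apply/eqP => k0; have [w wE] := phi_onto y1.
have [_ g1 _] := twist_unit.
have := twist_dv_split w; rewrite k0 mul0r wE g_euler g1 => /eqP.
by rewrite oner_eq0.
Qed.

Lemma twist_onto b : exists w, dd phi (t, x) (dd f (x, y) (0, w), w) = b.
Proof.
(* By [twist_dv] every solution has f_y(w) = g_y(b), which dictates [c]; conversely, once [w] solves
   the equation with that time component, [twist_dv_split] and [kappa_neq0] force f_y(w) = c. *)
pose c := dd g (x1, y1) (0, b).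
have [w wE] := phi_onto (b - c *: dd phi (t, x) (1, 0)).
have := twist_dv_split w; rewrite wE.
have -> : (0, b - c *: dd phi (t, x) (1, 0)) = (0, b) - c *: (0, dd phi (t, x) (1, 0)) :> V * V.
  by congr (_, _); rewrite /= ?scaler0 ?subr0.
rewrite ddB ddZ -/c scaleRM => E; exists w.
have pc : dd f (x, y) (0, w) = c.
  apply: (mulfI kappa_neq0); rewrite -E; ring.
have -> : (dd f (x, y) (0, w), w) = c *: (1, 0) + (0, w) :> R * V.
  by rewrite pc; congr (_, _); rewrite /= ?scaler0 ?add0r // addr0 [RHS]mulr1.
by rewrite ddD ddZ wE addrC subrK.
Qed.

Lemma EL_twist0 : (forall w, EL f x y z w = 0) -> forall b, EL g x1 y1 z1 b = 0.
Proof. by move=> E b; have [w <-] := twist_onto b; rewrite -EL_twist E mulr0. Qed.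

End Jet.
End Twist.
End Jets.
End EulerLagrange.

(** * Homogeneous Lagrangians, unit families and the squared metric *)

Section Family.
Variables (R : realType) (V : normedModType R) (Vf : framed V).
Let V2f := framed_prod Vf Vf.
Let RVf := framed_prod (@framed_real R) Vf.
Implicit Types (A B : set (V * V)) (f g : V * V -> R).

Definition homogeneous A f := forall (c : R) x v, 0 < c -> A (x, v) ->
  A (x, c *: v) /\ f (x, c *: v) = c * f (x, v).

Lemma is_derive1V (h : R -> R) (t dh : R) : h t != 0 -> is_derive t 1 h dh ->
  is_derive t 1 (fun s => (h s)^-1) (- (h t) ^- 2 * dh).
Proof.
move=> h0 [hd <-]; apply: DeriveDef; first exact: derivableV.
by rewrite deriveV.
Qed.

Lemma euler A f x v : open A -> smooth A f -> homogeneous A f -> A (x, v) ->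
  dd f (x, v) (0, v) = f (x, v).
Proof.
move=> oA fs fh Aq; have [nA f1 _ _] := smooth_at oA fs Aq.
have H := dd_line (0, v) (nbhs_singleton f1).
have E : \forall s \near (0 : R), (1 + s) * f (x, v) = f ((x, v) + s *: (0, v)).
  have N : \forall s \near (0 : R), -1 < s by apply: (open_nbhs_nbhs (conj (@open_gt _ _) _)); rewrite /= ltrN10.
  apply: filterS N => s s1.
  have -> : (x, v) + s *: (0, v) = (x, (1 + s) *: v).
    by congr (_, _); rewrite /= ?scaler0 ?addr0 // scalerDl scale1r.
  by rewrite (fh (1 + s) x v _ Aq).2 // -ltrBlDl sub0r.
apply: (is_derive1_unique H); apply: near_eq_is_derive E _.
have [c [c0 dc]] := @ex_curve R R 1 1.
have := is_derive1M (is_derive1D (is_derive1_cst (1 : R) 0) (is_derive_id (0 : R) 1))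
   (is_derive1_cst (f (x, v)) 0).
by rewrite mulr0 addr0 add0r mul1r.
Qed.

(* First-order variations [X, Y, Z] of a 2-jet realised inside the constraints
   [f = 1] and [f' = 0], the only jets to which [EL_twist] applies. *)
Definition unit_family A f (x y z X Y Z : V) (xs ys zs : R -> V) :=
 [/\ [/\ xs 0 = x, ys 0 = y & zs 0 = z],
  [/\ is_derive (0 : R) 1 xs X, is_derive (0 : R) 1 ys Y & is_derive (0 : R) 1 zs Z] &
  \forall s \near (0 : R), [/\ A (xs s, ys s), f (xs s, ys s) = 1 & dd f (xs s, ys s) (ys s, zs s) = 0]].

(** Straight lines are corrected twice: [y0] is divided by its speed, and [r s *: ys s] is
    subtracted from [z0], which lowers the derivative of the speed by exactly [r s] since f_y(y) = f
    = 1. The two linear hypotheses make both corrections vanish to first order, so the velocities at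
    0 are still [X], [Y], [Z]. *)
Lemma ex_unit_family A f x y z X Y Z : open A -> smooth A f -> homogeneous A f ->
  A (x, y) -> f (x, y) = 1 -> dd f (x, y) (y, z) = 0 ->
  dd f (x, y) (X, Y) = 0 ->
  dd (fun q => dd f q (y, z)) (x, y) (X, Y) + dd f (x, y) (Y, Z) = 0 ->
  exists xs ys zs, unit_family A f x y z X Y Z xs ys zs.
Proof.
move=> oA fs fh Aq fE df0 dX dXX; have [nA f1 f2 _] := smooth_at oA fs Aq.
have [xs [xs0 dxs]] := ex_curve x X.
have [y0 [y00 dy0]] := ex_curve y Y.
have [z0 [z00 dz0]] := ex_curve z Z.
have q0 : (xs 0, y0 0) = (x, y) by rewrite xs0 y00.
have dxy := is_derive1_pair dxs dy0.
have dF := is_derive1_fun_at q0 (nbhs_singleton f1) dxy; rewrite dX in dF.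
pose c (s : R) := (f (xs s, y0 s))^-1.
have c0 : c 0 = 1 by rewrite /c q0 fE invr1.
have dc : is_derive (0 : R) 1 c 0.
  have F0 : f (xs 0, y0 0) != 0 by rewrite q0 fE oner_eq0.
  by have := is_derive1V F0 dF; rewrite mulr0.
pose ys (s : R) := c s *: y0 s.
have ys0 : ys 0 = y by rewrite /ys c0 y00 scale1r.
have dys : is_derive (0 : R) 1 ys Y.
  by have := is_derive1Z dc dy0; rewrite scale0r add0r c0 scale1r.
have q1 : (xs 0, ys 0) = (x, y) by rewrite xs0 ys0.
have a1 : (ys 0, z0 0) = (y, z) by rewrite ys0 z00.
pose r (s : R) := dd f (xs s, ys s) (ys s, z0 s).
have r0 : r 0 = 0 by rewrite /r q1 a1.
have dr : is_derive (0 : R) 1 r 0.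
  have := is_derive1_dd_at V2f q1 a1 (nbhs_singleton f2) (is_derive1_pair dxs dys) (is_derive1_pair dys dz0).
  by rewrite dXX.
pose zs (s : R) := z0 s - r s *: ys s.
exists xs, ys, zs; split.
- by split => //; rewrite /zs r0 scale0r subr0.
- split=> //; have := is_derive1B dz0 (is_derive1Z dr dys).
  by rewrite r0 !scale0r addr0 subr0.
have N1 := near_at q0 dxy nA.
have N2 : \forall s \near (0 : R), 0 < f (xs s, y0 s).
  have F1 : f (xs 0, y0 0) = 1 by rewrite q0.
  apply: (near_at (P := fun u : R => 0 < u) F1 dF).
  by apply: (open_nbhs_nbhs (conj (@open_gt _ _) _)); rewrite /= ltr01.
apply: filterS2 N1 N2 => s As Fs.
have cs : 0 < c s by rewrite invr_gt0.
have [As' fs'] := fh (c s) _ _ cs As.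
have fs1 : f (xs s, ys s) = 1 by rewrite fs' mulVf // gt_eqF.
split => //.
have -> : (ys s, zs s) = (ys s, z0 s) - r s *: (0, ys s).
  by congr (_, _); rewrite /= ?scaler0 ?subr0.
by rewrite ddB ddZ (euler oA fs fh As') fs1 scaleRM mulr1 subrr.
Qed.

(** A proportionality known only on constrained jets can still be differentiated along a family that
    consists of such jets. *)
Lemma unit_family_EL A f g x y z X Y Z xs ys zs w (k : R) : open A -> smooth A f -> smooth A g ->
  A (x, y) -> unit_family A f x y z X Y Z xs ys zs ->
  (forall x y z w, A (x, y) -> f (x, y) = 1 -> dd f (x, y) (y, z) = 0 -> EL g x y z w = k * EL f x y z w) ->
  linEL g x y z X Y Z w = k * linEL f x y z X Y Z w.
Proof.
move=> oA fs gs Aq [[xs0 ys0 zs0] [dx dy dz] N] E.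
have A0 : A (xs 0, ys 0) by rewrite xs0 ys0.
have H1 := is_derive1_EL Vf oA fs A0 dx dy dz (is_derive1_cst w 0).
have H2 := is_derive1_EL Vf oA gs A0 dx dy dz (is_derive1_cst w 0).
have EL0 h a b c : EL h a b c (0 : V) = 0.
  rewrite /EL (_ : (fun q => _) = cst 0); last by apply/funext => q; rewrite dd0.
  by rewrite dd0 subr0 ddE diff_cst.
rewrite !EL0 !addr0 xs0 ys0 zs0 in H1 H2.
have H3 := is_derive1M (is_derive1_cst k 0) H1; rewrite mul0r add0r in H3.
apply: (is_derive1_unique H2); apply: near_eq_is_derive H3.
by apply: filterS N => s [As fs1 df1]; rewrite E.
Qed.

Definition sqf f (q : V * V) : R := f q ^+ 2.

Lemma sqf_smooth A f : open A -> smooth A f -> smooth A (sqf f).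
Proof.
by move=> oA fs k; apply: Ck_eq (CkM oA (fs k) (fs k)) => // q _; rewrite /sqf expr2.
Qed.

Lemma dd_sqf f q a : differentiable f q -> dd (sqf f) q a = 2 * f q * dd f q a.
Proof.
move=> fd.
have H := dd_line a fd.
have : is_derive (0 : R) 1 (fun s => sqf f (q + s *: a)) (2 * f q * dd f q a).
  have := is_derive1M H H; rewrite scale0r addr0 => M.
  rewrite (_ : (fun s : R => sqf f (q + s *: a)) = (fun s : R => f (q + s *: a) * f (q + s *: a))); last first.
    by apply/funext => s; rewrite /sqf expr2.
  by move: M; congr (is_derive _ _ _ _); ring.
have H2 : differentiable (sqf f) q.
  by rewrite (_ : sqf f = f * f); [exact: differentiableM|apply/funext => x; rewrite /sqf expr2].
by move=> H3; apply: is_derive1_unique (dd_line a H2) H3.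
Qed.

Lemma dd2_sqf A f q a b : open A -> smooth A f -> A q ->
  dd (fun q => dd (sqf f) q a) q b =
  2 * (dd f q b * dd f q a + f q * dd (fun q => dd f q a) q b).
Proof.
move=> oA fs Aq; have [nA f1 f2 _] := smooth_at oA fs Aq.
have [_ _ s2 _] := smooth_at oA (sqf_smooth oA fs) Aq.
have H := dd_line b (nbhs_singleton f1).
have H2 := dd_line b (nbhs_singleton f2 a).
have H3 := dd_line b (nbhs_singleton s2 a).
have E : \forall s \near (0 : R), 2 * (f (q + s *: b) * dd f (q + s *: b) a) = dd (sqf f) (q + s *: b) a.
  have q0 : q + (0 : R) *: b = q by rewrite scale0r addr0.
  by apply: filterS (near_at q0 (is_derive1_line q b 0) f1) => s ds; rewrite dd_sqf // mulrA.
apply: (is_derive1_unique H3); apply: near_eq_is_derive E _.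
have := is_derive1M (is_derive1_cst (2 : R) 0) (is_derive1M H H2).
by rewrite mul0r add0r scale0r addr0.
Qed.

Lemma EL_sqf A f x y z w : open A -> smooth A f -> A (x, y) ->
  EL (sqf f) x y z w = 2 * (f (x, y) * EL f x y z w + dd f (x, y) (y, z) * dd f (x, y) (0, w)).
Proof.
move=> oA fs Aq; have [nA f1 f2 _] := smooth_at oA fs Aq.
rewrite /EL (dd2_sqf _ _ oA fs Aq) dd_sqf; last exact: nbhs_singleton f1.
by ring.
Qed.

Lemma sqf_EL0 A f x y z : open A -> smooth A f -> A (x, y) -> f (x, y) = 1 ->
  dd f (x, y) (y, z) = 0 ->
  (forall w, EL (sqf f) x y z w = 0) <-> (forall w, EL f x y z w = 0).
Proof.
move=> oA fs Aq f1 df0; split=> E w.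
  have /eqP := E w; rewrite (EL_sqf _ _ oA fs Aq) f1 df0 mul0r addr0 mul1r.
  by rewrite mulf_eq0 pnatr_eq0 /= => /eqP.
by rewrite (EL_sqf _ _ oA fs Aq) f1 df0 mul0r addr0 mul1r E mulr0.
Qed.

(** Differentiating Euler's identity f_y(y) = f along the jet shows that the covector of [f] itself
    vanishes on [y]; squaring adds 2 f f', the rate of change of the energy. *)
Lemma energy A f x y z : open A -> smooth A f -> homogeneous A f -> A (x, y) ->
  EL (sqf f) x y z y = dd (sqf f) (x, y) (y, z).
Proof.
move=> oA fs fh Aq; have [nA f1 f2 _] := smooth_at oA fs Aq.
have f1' := nbhs_singleton f1.
have [xs [xs0 dxs]] := ex_curve x y.
have [ys [ys0 dys]] := ex_curve y z.
have q0 : (xs 0, ys 0) = (x, y) by rewrite xs0 ys0.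
have a0 : ((0 : V), ys 0) = (0, y) by rewrite ys0.
have dxy := is_derive1_pair dxs dys.
have H1 := is_derive1_dd_at V2f q0 a0 (nbhs_singleton f2) dxy (is_derive1_pair (is_derive1_cst (0 : V) _) dys).
have H2 := is_derive1_fun_at q0 f1' dxy.
have E : \forall s \near (0 : R), dd f (xs s, ys s) (0, ys s) = f (xs s, ys s).
  by apply: filterS (near_at q0 dxy nA) => s As; rewrite (euler oA fs fh).
have := is_derive1_unique (near_eq_is_derive E H1) H2.
rewrite (EL_sqf _ _ oA fs Aq) dd_sqf // (euler oA fs fh Aq) /EL.
have -> : (y, z) = (y, 0) + (0, z) :> V * V by congr (_, _); rewrite /= ?addr0 ?add0r.
rewrite [dd f _ (_ + _)]ddD.
set a := dd _ _ (_ + _); set b := dd f _ (0, z); set c := dd f _ (y, 0).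
move=> H; have -> : a = c by lra.
by ring.
Qed.

(** The linearisation of [energy]: with both covectors zero the variation of f f' vanishes, and f =
    1, f' = 0 leave the variation of f'. It supplies the second constraint of [ex_unit_family]. *)
Lemma linear_energy A f x y z X Y Z : open A -> smooth A f -> homogeneous A f ->
  A (x, y) -> f (x, y) = 1 -> dd f (x, y) (y, z) = 0 ->
  (forall w, EL (sqf f) x y z w = 0) -> (forall w, linEL (sqf f) x y z X Y Z w = 0) ->
  dd (fun q => dd f q (y, z)) (x, y) (X, Y) + dd f (x, y) (Y, Z) = 0.
Proof.
move=> oA fs fh Aq fE df0 E L; have [nA f1 f2 _] := smooth_at oA fs Aq.
have f1' := nbhs_singleton f1.
have [xs [xs0 dxs]] := ex_curve x X.
have [ys [ys0 dys]] := ex_curve y Y.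
have [zs [zs0 dzs]] := ex_curve z Z.
have q0 : (xs 0, ys 0) = (x, y) by rewrite xs0 ys0.
have a0 : (ys 0, zs 0) = (y, z) by rewrite ys0 zs0.
have A0 : A (xs 0, ys 0) by rewrite q0.
have dxy := is_derive1_pair dxs dys.
have H1 := is_derive1_EL Vf oA (sqf_smooth oA fs) A0 dxs dys dzs dys.
rewrite xs0 ys0 zs0 E L addr0 in H1.
have H2 := is_derive1M (is_derive1_cst (2 : R) 0) (is_derive1M (is_derive1_fun_at q0 f1' dxy)
   (is_derive1_dd_at V2f q0 a0 (nbhs_singleton f2) dxy (is_derive1_pair dys dzs))).
rewrite q0 a0 fE df0 mul0r mulr0 !add0r mul1r in H2.
have N : \forall s \near (0 : R), EL (sqf f) (xs s) (ys s) (zs s) (ys s) =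
    2 * (f (xs s, ys s) * dd f (xs s, ys s) (ys s, zs s)).
  apply: filterS2 (near_at q0 dxy nA) (near_at q0 dxy f1) => s As ds.
  by rewrite (energy _ oA fs fh As) dd_sqf // mulrA.
have := is_derive1_unique (near_eq_is_derive N H1) H2.
by move=> /esym/eqP; rewrite mulf_eq0 pnatr_eq0 /= => /eqP.
Qed.

End Family.

(** * Linearisation of the twist *)

Section TwistFamily.
Variables (R : realType) (V : normedModType R) (Vf : framed V).
Let V2f := framed_prod Vf Vf.
Let RVf := framed_prod (@framed_real R) Vf.
Variables (A B : set (V * V)) (D : set (R * V)) (f g : V * V -> R) (phi : R * V -> V).
Hypotheses (oA : open A) (oB : open B) (oD : open D).
Hypotheses (fs : smooth A f) (gs : smooth B g) (phis : smooth D phi).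
Hypotheses (fh : homogeneous A f) (gh : homogeneous B g).
Hypothesis twistZ : forall t x v, D (t, x) -> A (x, v) ->
  B (phi (t, x), dd phi (t, x) (f (x, v), v)) /\
  g (phi (t, x), dd phi (t, x) (f (x, v), v)) = f (x, v).

(* Jets of [phi (t, c t)] up to order 2, and their variations. *)
Definition push1 t x y := dd phi (t, x) (1, y).
Definition push2 t x y z :=
  dd (fun q => dd phi q (1, y)) (t, x) (1, y) + dd phi (t, x) (0, z).
Definition dpush0 t x X := dd phi (t, x) (0, X).
Definition dpush1 t x y X Y :=
  dd (fun q => dd phi q (1, y)) (t, x) (0, X) + dd phi (t, x) (0, Y).
Definition dpush2 t x y z X Y Z :=
  dd (fun q => dd (fun q => dd phi q (1, y)) q (1, y)) (t, x) (0, X) +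
  dd (fun q => dd phi q (0, Y)) (t, x) (1, y) + dd (fun q => dd phi q (1, y)) (t, x) (0, Y) +
  (dd (fun q => dd phi q (0, z)) (t, x) (0, X) + dd phi (t, x) (0, Z)).

Variables (t : R) (x y z : V).
Hypotheses (Dq : D (t, x)) (Aq : A (x, y)) (f1 : f (x, y) = 1) (df0 : dd f (x, y) (y, z) = 0).
Hypothesis phi_onto : forall b, exists w, dd phi (t, x) (0, w) = b.

Let Bq : B (phi (t, x), push1 t x y).
Proof. by have [] := twist_unit Vf oA oB oD fs gs phis twistZ Dq Aq f1 df0. Qed.

Let g1 : g (phi (t, x), push1 t x y) = 1.
Proof. by have [] := twist_unit Vf oA oB oD fs gs phis twistZ Dq Aq f1 df0. Qed.

Let dg0 : dd g (phi (t, x), push1 t x y) (push1 t x y, push2 t x y z) = 0.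
Proof. by have [] := twist_unit Vf oA oB oD fs gs phis twistZ Dq Aq f1 df0. Qed.

Let EL0 := EL_twist0 Vf oA oB oD fs gs phis twistZ Dq Aq f1 df0 phi_onto (euler oB gs gh Bq).

Lemma twist_spray : (forall w, EL (sqf f) x y z w = 0) ->
  forall w, EL (sqf g) (phi (t, x)) (push1 t x y) (push2 t x y z) w = 0.
Proof.
move=> /(sqf_EL0 oA fs Aq f1 df0) E.
by apply/(sqf_EL0 oB gs Bq g1 dg0); apply: EL0.
Qed.

Section Variation.
Variables (X Y Z : V) (xs ys zs : R -> V).
Hypothesis fam : unit_family A f x y z X Y Z xs ys zs.

Lemma twist_family : unit_family B g (phi (t, x)) (push1 t x y) (push2 t x y z)
  (dpush0 t x X) (dpush1 t x y X Y) (dpush2 t x y z X Y Z)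
  (fun s => phi (t, xs s)) (fun s => push1 t (xs s) (ys s)) (fun s => push2 t (xs s) (ys s) (zs s)).
Proof.
have [[xs0 ys0 zs0] [dx dy dz] N] := fam.
have [nD p1 p2 p3] := smooth_at oD phis Dq.
have ct := is_derive1_cst (t : R) 0; have c1 := is_derive1_cst (1 : R) 0.
have c0 := is_derive1_cst (0 : R) 0.
have dq := is_derive1_pair ct dx.
have q0 : (t, xs 0) = (t, x) by rewrite xs0.
have y1 : ((1 : R), ys 0) = (1, y) by rewrite ys0.
have z1 : ((0 : R), zs 0) = (0, z) by rewrite zs0.
split.
- by rewrite xs0 ys0 zs0.
- split.
  + exact: (is_derive1_fun_at q0 (nbhs_singleton p1) dq).
  + exact: (is_derive1_dd_at RVf q0 y1 (nbhs_singleton p2) dq (is_derive1_pair c1 dy)).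
  + have p2' := p2; rewrite -q0 in p2'.
    have p3' := p3; rewrite -q0 in p3'.
    have H1 := is_derive1_dd2 RVf p2' p3' dq (is_derive1_pair c1 dy) (is_derive1_pair c1 dy).
    have H2 := is_derive1_dd_at RVf q0 z1 (nbhs_singleton p2) dq (is_derive1_pair c0 dz).
    have := is_derive1D H1 H2; rewrite xs0 ys0; exact.
apply: filterS2 N (near_at q0 dq nD) => s [As fs1 dfs1] Ds.
exact: (twist_unit Vf oA oB oD fs gs phis twistZ Ds As fs1 dfs1).
Qed.

(** [EL_twist] is differentiated along the family. The derivatives of the factor and of the
    transported direction are multiplied by Euler-Lagrange covectors that vanish at the base jet,
    and surjectivity of the transport reaches every [b]. *)
Lemma twist_linEL0 : (forall w, EL f x y z w = 0) -> (forall w, linEL f x y z X Y Z w = 0) ->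
  forall b, linEL g (phi (t, x)) (push1 t x y) (push2 t x y z)
    (dpush0 t x X) (dpush1 t x y X Y) (dpush2 t x y z X Y Z) b = 0.
Proof.
move=> E L b.
have [[xs0 ys0 zs0] [dx dy dz] N] := fam.
have [w <-] := twist_onto Vf oA oB oD fs gs phis twistZ Dq Aq f1 df0 phi_onto (euler oB gs gh Bq) b.
have [_ [dx1 dy1 dz1] N1] := twist_family.
have [nD p1 p2 p3] := smooth_at oD phis Dq.
have [nA fd1 fd2 _] := smooth_at oA fs Aq.
have [_ gd1 gd2 _] := smooth_at oB gs Bq.
have ct := is_derive1_cst (t : R) 0; have c1 := is_derive1_cst ((1 : R), (0 : V)) 0.
have c0 := is_derive1_cst (0 : V) 0.
have dq := is_derive1_pair ct dx.
have q0 : (t, xs 0) = (t, x) by rewrite xs0.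
have a0 : (xs 0, ys 0) = (x, y) by rewrite xs0 ys0.
have b0 : (phi (t, xs 0), push1 t (xs 0) (ys 0)) = (phi (t, x), push1 t x y) by rewrite xs0 ys0.
have A0 : A (xs 0, ys 0) by rewrite a0.
have B0 : B (phi (t, xs 0), push1 t (xs 0) (ys 0)) by rewrite b0.
have dth := is_derive1_dd_at RVf q0 erefl (nbhs_singleton p2) dq c1.
have th0 : ((0 : V), dd phi (t, xs 0) (1, 0)) = (0, dd phi (t, x) (1, 0)) by rewrite q0.
have dk := is_derive1B (is_derive1_cst (1 : R) 0)
  (is_derive1_dd_at V2f b0 th0 (nbhs_singleton gd2) (is_derive1_pair dx1 dy1) (is_derive1_pair c0 dth)).
have dE := is_derive1_EL Vf oA fs A0 dx dy dz (is_derive1_cst w 0).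
have dp := is_derive1_fun_at a0 (nbhs_singleton fd2 (0, w)) (is_derive1_pair dx dy).
have pw0 : (dd f (xs 0, ys 0) (0, w), w) = (dd f (x, y) (0, w), w) by rewrite a0.
have db := is_derive1_dd_at RVf q0 pw0 (nbhs_singleton p2) dq (is_derive1_pair dp (is_derive1_cst w 0)).
have dG := is_derive1_EL Vf oB gs B0 dx1 dy1 dz1 db.
have N2 : \forall s \near (0 : R), (1 - dd g (phi (t, xs s), push1 t (xs s) (ys s)) (0, dd phi (t, xs s) (1, 0))) *
    EL f (xs s) (ys s) (zs s) w = EL g (phi (t, xs s)) (push1 t (xs s) (ys s)) (push2 t (xs s) (ys s) (zs s))
      (dd phi (t, xs s) (dd f (xs s, ys s) (0, w), w)).
  apply: filterS2 N (near_at q0 dq nD) => s [As fs1 dfs1] Ds.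
  exact: (EL_twist Vf oA oB oD fs gs phis twistZ Ds As fs1 dfs1).
have U := is_derive1_unique (near_eq_is_derive N2 (is_derive1M dk dE)) dG.
move: U; rewrite b0 a0 q0 xs0 ys0 zs0 L E mulr0 add0r.
have EG := EL0 E.
have -> : EL f x y z 0 = 0 by exact: E.
by rewrite EG [RHS]addr0 => <-; rewrite ?addr0 ?mulr0.
Qed.

End Variation.

(** The hypothesis on [(X, Y)] is the constraint f = 1 to first order, and [linear_energy] gives the
    one on f'. On the resulting family the covectors of [f] and of its square differ by the constant
    2, the derivative of s^2 at s = 1, so the passage to and from the square is harmless. *)
Lemma twist_jacobi X Y Z : (forall w, EL (sqf f) x y z w = 0) ->
  (forall w, linEL (sqf f) x y z X Y Z w = 0) -> dd f (x, y) (X, Y) = 0 ->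
  forall b, linEL (sqf g) (phi (t, x)) (push1 t x y) (push2 t x y z)
    (dpush0 t x X) (dpush1 t x y X Y) (dpush2 t x y z X Y Z) b = 0.
Proof.
move=> E L dX b.
have dXX := linear_energy Vf oA fs fh Aq f1 df0 E L.
have [xs [ys [zs fam]]] := ex_unit_family Vf oA fs fh Aq f1 df0 dX dXX.
have S (h : V * V -> R) (C : set (V * V)) : open C -> smooth C h -> forall x y z w, C (x, y) -> h (x, y) = 1 -> dd h (x, y) (y, z) = 0 ->
    EL (sqf h) x y z w = 2 * EL h x y z w.
  move=> oC hs x' y' z' w Cq h1 dh0.
  by rewrite (EL_sqf _ _ oC hs Cq) h1 dh0 mul1r mul0r addr0.
have LS w := unit_family_EL Vf w oA fs (sqf_smooth oA fs) Aq fam (S _ _ oA fs).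
have LG w := unit_family_EL Vf w oB gs (sqf_smooth oB gs) Bq (twist_family fam) (S _ _ oB gs).
have E' := (sqf_EL0 oA fs Aq f1 df0).1 E.
have L' w : linEL f x y z X Y Z w = 0.
  by have := LS w; rewrite L => /esym/eqP; rewrite mulf_eq0 pnatr_eq0 /= => /eqP.
by rewrite LG (twist_linEL0 fam E' L') mulr0.
Qed.

End TwistFamily.

(** * Randers metrics in a chart *)

Section Quad.
Variables (R : realType) (n : nat).
Local Notation V := 'rV[R]_n.
Implicit Types (a : 'M[R]_n) (u v w b : V).

Lemma quadDl a u v w : quad a (u + v) w = quad a u w + quad a v w.
Proof. by rewrite /quad !mulmxDl mxE. Qed.

Lemma quadZl a (k : R) u w : quad a (k *: u) w = k * quad a u w.
Proof. by rewrite /quad -!scalemxAl mxE. Qed.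

Lemma quadDr a u v w : quad a u (v + w) = quad a u v + quad a u w.
Proof. by rewrite /quad linearD /= mulmxDr mxE. Qed.

Lemma quadZr a (k : R) u w : quad a u (k *: w) = k * quad a u w.
Proof. by rewrite /quad linearZ /= -scalemxAr mxE. Qed.

Lemma quadC a u v : a^T = a -> quad a u v = quad a v u.
Proof.
move=> aT; rewrite /quad -[LHS]/((u *m a *m v^T) 0 0) -[u *m a *m v^T]trmxK mxE.
by rewrite !trmx_mul trmxK aT mulmxA.
Qed.

Lemma covecD b u v : covec b (u + v) = covec b u + covec b v.
Proof. by rewrite /covec mulmxDl mxE. Qed.

Lemma covecZ b (k : R) v : covec b (k *: v) = k * covec b v.
Proof. by rewrite /covec -scalemxAl mxE. Qed.

Section Pos.
Variables (a : 'M[R]_n).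
Hypotheses (aT : a^T = a) (apos : forall v, v != 0 -> 0 < quad a v v).

Lemma quad0 v : quad a 0 v = 0.
Proof. by rewrite -(scale0r v) quadZl mul0r. Qed.

Lemma quad_ge0 v : 0 <= quad a v v.
Proof. by have [->|v0] := eqVneq v 0; [rewrite quad0|exact/ltW/apos]. Qed.

Lemma quad_CS u v : quad a u v ^+ 2 <= quad a u u * quad a v v.
Proof.
have [->|v0] := eqVneq v 0.
  by rewrite (quadC _ _ aT) !quad0 expr0n mulr0.
have pv := apos v0; pose c := - (quad a u v / quad a v v).
have := quad_ge0 (u + c *: v).
rewrite !(quadDl, quadDr, quadZl, quadZr) (quadC v u aT).
have -> : quad a u u + c * quad a u v + (c * quad a u v + c * (c * quad a v v)) =
  quad a u u - quad a u v ^+ 2 / quad a v v.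
  by rewrite /c; field; rewrite gt_eqF.
by rewrite subr_ge0 ler_pdivrMr.
Qed.

Lemma quad_CS_eq u v : v != 0 -> quad a u v ^+ 2 = quad a u u * quad a v v ->
  u = (quad a u v / quad a v v) *: v.
Proof.
move=> v0 E; have pv := apos v0; pose c := - (quad a u v / quad a v v).
apply/eqP; rewrite -subr_eq0 -scaleNr -/c; apply: contraT => /apos.
rewrite !(quadDl, quadDr, quadZl, quadZr) (quadC v u aT).
have -> : quad a u u + c * quad a u v + (c * quad a u v + c * (c * quad a v v)) =
  quad a u u - quad a u v ^+ 2 / quad a v v.
  by rewrite /c; field; rewrite gt_eqF.
by rewrite E mulfK ?gt_eqF // subrr ltxx.
Qed.

Lemma quad_unit : a \in unitmx.
Proof.
rewrite -row_free_unit -kermx_eq0; apply/rowV0P => v /sub_kermxP va.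
by apply: contraTeq (lexx (0 : R)) => /apos; rewrite /quad va mul0mx mxE ltxx.
Qed.

Let nrm v := Num.sqrt (quad a v v).

(** The form [b] is represented by the vector [b *m invmx a], whose norm is the dual norm of [b];
    the rest is Cauchy-Schwarz. *)
Lemma covec_bound b v : `|covec b v| <= Num.sqrt (quad (invmx a) b b) * nrm v.
Proof.
have ua := quad_unit.
pose u := b *m invmx a.
have E1 : covec b v = quad a v u.
  by rewrite /covec /quad /u trmx_mul trmx_inv aT -mulmxA mulKVmx.
have E2 : quad (invmx a) b b = quad a u u.
  by rewrite /quad /u trmx_mul trmx_inv aT mulmxKV // mulmxA.
rewrite E1 E2 (quadC _ _ aT) /nrm -sqrtrM ?quad_ge0 // -sqrtr_sqr.
by rewrite ler_wsqrtr // quad_CS.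
Qed.

End Pos.
End Quad.

Section Randers.
Variables (R : realType) (n : nat) (M : manifold R n) (F : randers M) (i : idx M).
Local Notation V := 'rV[R]_n.

(* The slit tangent bundle over the domain of the chart [i]. *)
Definition slit : set (V * V) := [set q | cod i q.1 /\ q.2 != 0].

Definition rfun (q : V * V) : R := randers_fun F i q.1 q.2.

Lemma cod_open_i : open (cod i).
Proof. exact: cod_open. Qed.

Lemma slit_open : open slit.
Proof.
have -> : slit = (fst @^-1` cod i) `&` (snd @^-1` [set v : V | v != 0]).
  by apply/seteqP; split.
apply: openI.
  by apply: open_comp; [move=> ? _; exact: cvg_fst|exact: cod_open_i].
apply: open_comp; [move=> ? _; exact: cvg_snd|].
have -> : [set v : V | v != 0] = ~` [set 0].
  by apply/seteqP; split => v /= /eqP.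
by rewrite openC; apply: accessible_closed_set1; apply: hausdorff_accessible; exact: norm_hausdorff.
Qed.

Let aT x : cod i x -> (r_alpha F i x)^T = r_alpha F i x.
Proof. exact: rm_sym. Qed.
Let apos x : cod i x -> forall v, v != 0 -> 0 < quad (r_alpha F i x) v v.
Proof. by move=> cx v; exact: rm_pos. Qed.

Lemma rfun_gt0 x v : slit (x, v) -> 0 < rfun (x, v).
Proof.
move=> [/= cx v0]; have := covec_bound (aT cx) (apos cx) (r_beta F i x) v.
have := randers_norm F cx; set c := Num.sqrt _ => c1.
have n0 : 0 < Num.sqrt (quad (r_alpha F i x) v v) by rewrite sqrtr_gt0 apos.
have : c * Num.sqrt (quad (r_alpha F i x) v v) < Num.sqrt (quad (r_alpha F i x) v v).
  by rewrite gtr_pMl.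
rewrite /rfun /randers_fun /= ler_norml => lt1 /andP[lb _].
by lra.
Qed.

Lemma rfun0 x : rfun (x, 0) = 0.
Proof.
rewrite /rfun /randers_fun /= /quad mul0mx mul0mx mxE sqrtr0 add0r.
by rewrite /covec mul0mx mxE.
Qed.

Lemma rfun_ge0 x v : cod i x -> 0 <= rfun (x, v).
Proof.
by move=> cx; have [->|v0] := eqVneq v 0; [rewrite rfun0|apply/ltW/rfun_gt0].
Qed.

Lemma rfunZ (c : R) x v : 0 <= c -> rfun (x, c *: v) = c * rfun (x, v).
Proof.
move=> c0; rewrite /rfun /randers_fun /= quadZl quadZr covecZ mulrA -expr2 sqrtrM ?sqr_ge0 //.
by rewrite sqrtr_sqr ger0_norm // mulrDr.
Qed.

Lemma rfun_homogeneous : homogeneous slit rfun.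
Proof.
move=> c x v c0 [cx v0]; split; last by rewrite rfunZ // ltW.
by split => //=; rewrite scaler_eq0 negb_or gt_eqF.
Qed.

Lemma smooth_entry k l : smooth (cod i) (fun x => r_alpha F i x k l).
Proof.
move=> m.
have lin : linear (fun A : 'M[R]_n => A k l) by move=> c A B; rewrite !mxE.
pose L : {linear 'M[R]_n -> R} := HB.pack (fun A : 'M[R]_n => A k l) (GRing.isLinear.Build _ _ _ _ _ lin).
apply: (@Ck_lin_comp _ _ _ _ m (cod i) (r_alpha F i) L) => //; first exact: cod_open_i.
  by move=> A; exact: coord_continuous.
exact: rm_smooth.
Qed.

Lemma smooth_covec k : smooth (cod i) (fun x => r_beta F i x 0 k).
Proof.
move=> m.
have lin : linear (fun A : V => A 0 k) by move=> c A B; rewrite !mxE.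
pose L : {linear V -> R} := HB.pack (fun A : V => A 0 k) (GRing.isLinear.Build _ _ _ _ _ lin).
apply: (@Ck_lin_comp _ _ _ _ m (cod i) (r_beta F i) L) => //; first exact: cod_open_i.
  by move=> A; exact: coord_continuous.
exact: of_smooth.
Qed.

Lemma smooth_fst (h : V -> R) : smooth (cod i) h -> smooth slit (fun q => h q.1).
Proof.
move=> hs m.
have lin : linear (fun q : V * V => q.1) by move=> c A B.
pose L : {linear (V * V)%type -> V} := HB.pack (fun q : V * V => q.1) (GRing.isLinear.Build _ _ _ _ _ lin).
have := @Ck_comp_lin _ _ _ _ m (cod i) h L cod_open_i _ (hs m).
move=> H; apply: Ck_sub (H _); first by move=> q [].
by move=> q; exact: cvg_fst.
Qed.

Lemma smooth_snd k : smooth slit (fun q : V * V => q.2 0 k).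
Proof.
move=> m.
have lin : linear (fun q : V * V => q.2 0 k) by move=> c A B /=; rewrite !mxE.
pose L : {linear (V * V)%type -> R} := HB.pack (fun q : V * V => q.2 0 k) (GRing.isLinear.Build _ _ _ _ _ lin).
apply: (@Ck_linear _ _ _ m slit L) => q.
by apply: (@continuous_comp _ _ _ (fun q : V * V => q.2) (fun v : V => v 0 k));
  [exact: cvg_snd|exact: coord_continuous].
Qed.

Lemma rfun_smooth : smooth slit rfun.
Proof.
move=> m; have oS := slit_open.
apply: CkD => //.
  apply: Ck_sqrt => //; first by move=> q [cq vq]; exact: apos.
  apply: (Ck_eq (f := fun q : V * V => \sum_l (\sum_k q.2 0 k * r_alpha F i q.1 k l) * q.2 0 l)) => //.
    by move=> q _; rewrite /quad mxE; apply: eq_bigr => l _; rewrite !mxE.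
  apply: Ck_sum => // l; apply: CkM => //; last exact: smooth_snd.
  apply: Ck_sum => // k; apply: CkM => //; first exact: smooth_snd.
  by apply: (smooth_fst (h := fun x => r_alpha F i x k l)); exact: smooth_entry.
apply: (Ck_eq (f := fun q : V * V => \sum_l q.2 0 l * r_beta F i q.1 0 l)) => //.
  by move=> q _; rewrite /covec mxE; apply: eq_bigr => l _; rewrite !mxE.
apply: Ck_sum => // l; apply: CkM => //; first exact: smooth_snd.
by apply: (smooth_fst (h := fun x => r_beta F i x 0 l)); exact: smooth_covec.
Qed.

End Randers.
Arguments slit_open {R n M} i.

(** * Partial derivatives, the fundamental tensor and the spray *)

Section Partial.
Variables (R : realType) (n : nat).
Local Notation V := 'rV[R]_n.
Local Notation e k := (delta_mx 0 k : V).
Implicit Types (h : V -> V -> R) (hh : V * V -> R).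

(** Converts the directional derivatives of the coordinate formulas into differentials on the
    product: [j] inserts the moving variable. Agreement is asked only near [j x], since the formulas
    are identified only on the slit bundle. *)
Lemma derive_dd (W : normedModType R) (g : W -> R) (hh : V * V -> R) (j : W -> V * V) (x v : W) (u : V * V) :
  (forall s : R, j (x + s *: v) = j x + s *: u) ->
  (\forall q \near j x, forall w, j w = q -> g w = hh q) -> differentiable hh (j x) ->
  'D_v g x = dd hh (j x) u.
Proof.
move=> jE gE hd; have H := dd_line u hd.
have N : \forall s \near (0 : R), hh (j x + s *: u) = g (s *: v + x).
  have q0 : j x + (0 : R) *: u = j x by rewrite scale0r addr0.
  have := near_at q0 (is_derive1_line (j x) u 0) gE.
  by apply: filterS => s gs; rewrite (addrC (s *: v)) (gs _ (jE s)).
have [D1 D2] := near_eq_is_derive N H.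
rewrite -D2 /derive; set g1 := fun h : R => _; set g2 := fun h : R => _.
suff -> : g1 = g2 by [].
apply/funext => s; rewrite /g1 /g2 /=.
by rewrite addr0 scale0r add0r [s *: 1]mulr1.
Qed.

Lemma dyE h hh k x y : (\forall q \near (x, y), h q.1 q.2 = hh q) ->
  differentiable hh (x, y) -> dy k h x y = dd hh (x, y) (0, e k).
Proof.
move=> hE hd; apply: (derive_dd (j := fun w => (x, w))) => //.
  by move=> s; congr (_, _); rewrite /= ?scaler0 ?addr0.
by apply: filterS hE => q hq w wq; rewrite -hq -wq.
Qed.

Lemma dxE h hh k x y : (\forall q \near (x, y), h q.1 q.2 = hh q) ->
  differentiable hh (x, y) -> dx k h x y = dd hh (x, y) (e k, 0).
Proof.
move=> hE hd; apply: (derive_dd (j := fun w => (w, y))) => //.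
  by move=> s; congr (_, _); rewrite /= ?scaler0 ?addr0.
by apply: filterS hE => q hq w wq; rewrite -hq -wq.
Qed.

Lemma dd_pair_sum hh q (u v : V) : dd hh q (u, v) =
  \sum_k u 0 k * dd hh q (e k, 0) + \sum_k v 0 k * dd hh q (0, e k).
Proof.
have -> : (u, v) = (u, 0) + (0, v) :> V * V by congr (_, _); rewrite /= ?addr0 ?add0r.
rewrite ddD; congr (_ + _).
  rewrite {1}(row_sum_delta u).
  have -> : (\sum_k u 0 k *: e k, 0 : V) = \sum_k u 0 k *: (e k, 0 : V).
    elim/big_rec2 : _ => // k a b _ <-.
    by rewrite [RHS]surjective_pairing /= scaler0 addr0.
  by elim/big_rec2 : _ => [|k a b _ <-]; rewrite ?dd0 // ddD ddZ.
rewrite {1}(row_sum_delta v).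
have -> : (0 : V, \sum_k v 0 k *: e k) = \sum_k v 0 k *: (0 : V, e k).
  elim/big_rec2 : _ => // k a b _ <-.
  by rewrite [RHS]surjective_pairing /= scaler0 addr0.
by elim/big_rec2 : _ => [|k a b _ <-]; rewrite ?dd0 // ddD ddZ.
Qed.

End Partial.

Section Matrix.
Variables (R : realType) (V : normedModType R) (A : set V) (oA : open A) (m : nat).

Lemma smooth_det k (f : V -> 'M[R]_k) : (forall i j, Ck m A (fun x => f x i j)) ->
  Ck m A (fun x => \det (f x)).
Proof.
move=> H; apply: Ck_sum => // s; apply: CkM => //; first exact: Ck_cst.
by apply: Ck_prod.
Qed.

Lemma smooth_invmx k (f : V -> 'M[R]_k) i j : (forall i j, Ck m A (fun x => f x i j)) ->
  (forall x, A x -> f x \in unitmx) -> Ck m A (fun x => invmx (f x) i j).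
Proof.
(* Cramer's rule: the inverse is a polynomial in the entries divided by a nonvanishing
   determinant. *)
move=> H fu; apply: (Ck_eq (f := fun x => (\det (f x))^-1 * ((-1) ^+ (j + i) * \det (row' j (col' i (f x)))))) => //.
  move=> x; rewrite inE => Ax; rewrite /invmx fu // !mxE.
  by rewrite /cofactor.
apply: CkM => //.
  apply: CkV => //; last exact: smooth_det.
  by move=> x Ax; have := fu x Ax; rewrite unitmxE unitfE.
apply: CkM => //; first exact: Ck_cst.
by apply: smooth_det => a b; apply: Ck_eq (H (lift j a) (lift i b)) => // x _; rewrite !mxE.
Qed.

End Matrix.

Section Frame.
Variables (R : realType) (n : nat).
Local Notation V := 'rV[R]_n.
Local Notation e k := (delta_mx 0 k : V).
Variables (A : set (V * V)) (g : V * V -> R).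
Hypotheses (oA : open A) (gs : smooth A g).

Lemma EL_frame (x y z w : V) : A (x, y) -> EL g x y z w = \sum_l w 0 l * EL g x y z (e l).
Proof.
move=> Aq.
have EL0 : EL g x y z 0 = 0.
  by rewrite -(scale0r (0 : V)) (ELZ _ _ _ oA gs Aq) mul0r.
rewrite {1}[w]row_sum_delta; elim/big_rec2 : _ => // k u v _ <-.
by rewrite (ELD _ _ _ oA gs Aq) (ELZ _ _ _ oA gs Aq).
Qed.

Lemma linEL_derive (x y z X Y Z w : V) (xs ys zs : R -> V) : A (x, y) ->
  xs 0 = x -> ys 0 = y -> zs 0 = z ->
  is_derive (0 : R) 1 xs X -> is_derive (0 : R) 1 ys Y -> is_derive (0 : R) 1 zs Z ->
  is_derive (0 : R) 1 (fun s => EL g (xs s) (ys s) (zs s) w) (linEL g x y z X Y Z w).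
Proof.
move=> Aq xs0 ys0 zs0 dx dy dz.
have A0 : A (xs 0, ys 0) by rewrite xs0 ys0.
have := is_derive1_EL (framed_rV R n) oA gs A0 dx dy dz (is_derive1_cst w 0).
rewrite xs0 ys0 zs0 -(scale0r (0 : V)) (ELZ _ _ _ oA gs Aq) mul0r addr0; exact.
Qed.

Lemma linEL_frame (x y z X Y Z w : V) : A (x, y) ->
  linEL g x y z X Y Z w = \sum_l w 0 l * linEL g x y z X Y Z (e l).
Proof.
move=> Aq.
have [nA _ _ _] := smooth_at oA gs Aq.
have [xs [xs0 dxs]] := ex_curve x X.
have [ys [ys0 dys]] := ex_curve y Y.
have [zs [zs0 dzs]] := ex_curve z Z.
have q0 : (xs 0, ys 0) = (x, y) by rewrite xs0 ys0.
have H w' := linEL_derive w' Aq xs0 ys0 zs0 dxs dys dzs.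
apply: (is_derive1_unique (H w)).
have N : \forall s \near (0 : R), \sum_l w 0 l * EL g (xs s) (ys s) (zs s) (e l) = EL g (xs s) (ys s) (zs s) w.
  by apply: filterS (near_at q0 (is_derive1_pair dxs dys) nA) => s As; rewrite -EL_frame.
apply: near_eq_is_derive N _; apply: is_derive1_sum => l.
Qed.

End Frame.

Section Spray.
Variables (R : realType) (n : nat) (M : manifold R n) (F : randers M) (i : idx M).
Local Notation V := 'rV[R]_n.
Local Notation e k := (delta_mx 0 k : V).
Local Notation f := (rfun F i).
Local Notation A := (slit i).
Local Notation fc := (randers_fun F i).
Let oA := slit_open i.
Let fs : smooth A f := rfun_smooth F i.
Let ss : smooth A (sqf f) := sqf_smooth oA fs.

Let dys l q : A q -> dy l (sq fc) q.1 q.2 = dd (sqf f) q (0, e l).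
Proof.
case: q => x y Aq; have [_ s1 _ _] := smooth_at oA ss Aq.
by apply: dyE (nbhs_singleton s1); apply: filterS s1 => -[].
Qed.

Let dxs l q : A q -> dx l (sq fc) q.1 q.2 = dd (sqf f) q (e l, 0).
Proof.
case: q => x y Aq; have [_ s1 _ _] := smooth_at oA ss Aq.
by apply: dxE (nbhs_singleton s1); apply: filterS s1 => -[].
Qed.

Let dydys k l q : A q -> dy k (dy l (sq fc)) q.1 q.2 = dd (fun q => dd (sqf f) q (0, e l)) q (0, e k).
Proof.
case: q => x y Aq; have [nA _ s2 _] := smooth_at oA ss Aq.
apply: dyE (nbhs_singleton s2 _).
by apply: filterS nA => q; exact: dys.
Qed.

Let dxdys k l q : A q -> dx k (dy l (sq fc)) q.1 q.2 = dd (fun q => dd (sqf f) q (0, e l)) q (e k, 0).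
Proof.
case: q => x y Aq; have [nA _ s2 _] := smooth_at oA ss Aq.
apply: dxE (nbhs_singleton s2 _).
by apply: filterS nA => q; exact: dys.
Qed.

Lemma smooth_fund k l : smooth A (fun q => fund fc q.1 q.2 k l).
Proof.
move=> m; apply: (Ck_eq (f := fun q => 2^-1 * dd (fun q => dd (sqf f) q (0, e k)) q (0, e l))) => //.
  by move=> q; rewrite inE => Aq; rewrite mxE dydys.
apply: CkM => //; first exact: Ck_cst.
by have [_ H] := smooth_dd ss; have [_ H2] := smooth_dd (H (0, e k)); exact: H2.
Qed.

Lemma is_derive_alpha (a : 'M[R]_n) (y w : V) : a^T = a -> 0 < quad a y y ->
  is_derive (0 : R) 1 (fun s => Num.sqrt (quad a (y + s *: w) (y + s *: w)))
    (quad a y w / Num.sqrt (quad a y y)).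
Proof.
move=> aT q0.
have ids := is_derive_id (0 : R) 1.
pose qf (s : R) := quad a y y + s * (2 * quad a y w) + s * (s * quad a w w).
have -> : (fun s => Num.sqrt (quad a (y + s *: w) (y + s *: w))) = (fun s => Num.sqrt (qf s)).
  apply/funext => s; congr Num.sqrt.
  rewrite /qf !(quadDl, quadDr, quadZl, quadZr) (quadC w y aT); ring.
have dq : is_derive (0 : R) 1 qf (2 * quad a y w).
  have := is_derive1D (is_derive1D (is_derive1_cst (quad a y y) 0) (is_derive1M ids (is_derive1_cst (2 * quad a y w) 0)))
    (is_derive1M ids (is_derive1M ids (is_derive1_cst (quad a w w) 0))).
  by rewrite !mul0r !mulr0 !mul1r !addr0 add0r.
have q00 : qf 0 = quad a y y by rewrite /qf !mul0r !addr0.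
have ds : is_derive (qf 0) 1 (Num.sqrt : R -> R) (2 * Num.sqrt (qf 0))^-1.
  by apply: is_derive1_sqrt; rewrite q00.
have sd : differentiable (Num.sqrt : R -> R) (qf 0) by apply/derivable1_diffP; case: ds.
have H1 := is_derive1_fun sd dq.
have E : dd (Num.sqrt : R -> R) (qf 0) (2 * quad a y w) = quad a y w / Num.sqrt (quad a y y).
  have -> : 2 * quad a y w = (2 * quad a y w) *: (1 : R) by rewrite scaleRM mulr1.
  rewrite ddZ scaleRM ddE -(deriveE _ sd) (@derive_val _ _ _ _ _ _ _ ds) q00.
  by field; rewrite gt_eqF // sqrtr_gt0.
by rewrite -E; exact: H1.
Qed.

Lemma dd_rfun_vert x y w : A (x, y) ->
  dd f (x, y) (0, w) = quad (r_alpha F i x) y w / Num.sqrt (quad (r_alpha F i x) y y) + covec (r_beta F i x) w.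
Proof.
move=> Aq; have [_ f1 _ _] := smooth_at oA fs Aq; have [cx y0] := Aq.
set a := r_alpha F i x; set b := r_beta F i x.
have q0 : 0 < quad a y y by exact: rm_pos.
have aT : a^T = a by exact: rm_sym.
have sE : (fun s : R => f ((x, y) + s *: (0, w))) =
   (fun s => Num.sqrt (quad a (y + s *: w) (y + s *: w)) + (covec b y + s * covec b w)).
  apply/funext => s; rewrite /rfun /randers_fun /= scaler0 addr0.
  by rewrite covecD covecZ.
have H := dd_line (0, w) (nbhs_singleton f1); rewrite sE in H.
apply: (is_derive1_unique H).
have ids := is_derive_id (0 : R) 1.
have H2 := is_derive1D (is_derive_alpha w aT q0) (is_derive1D (is_derive1_cst (covec b y) 0) (is_derive1M ids (is_derive1_cst (covec b w) 0))).
by rewrite mul0r addr0 add0r mul1r in H2.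
Qed.

(** The one-form is linear in [y] and drops out, so only the Hessian of alpha remains; its numerator
    is the Cauchy-Schwarz defect of [y] and [v]. *)
Lemma dd2_rfun_vert x y v : A (x, y) -> let a := r_alpha F i x in
  dd (fun q => dd f q (0, v)) (x, y) (0, v) =
  (quad a v v * quad a y y - quad a y v ^+ 2) / (quad a y y * Num.sqrt (quad a y y)).
Proof.
move=> Aq a; pose b := r_beta F i x.
have [nA f1 f2 _] := smooth_at oA fs Aq; have [cx y0] := Aq.
have q0 : 0 < quad a y y by exact: rm_pos.
have aT : a^T = a by exact: rm_sym.
have H := dd_line (0, v) (nbhs_singleton f2 (0, v)).
have N : \forall s \near (0 : R), (quad a y v + s * quad a v v) *
    (Num.sqrt (quad a (y + s *: v) (y + s *: v)))^-1 + covec b v = dd f ((x, y) + s *: (0, v)) (0, v).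
  have p0 : (x, y) + (0 : R) *: (0, v) = (x, y) by rewrite scale0r addr0.
  apply: filterS (near_at p0 (is_derive1_line (x, y) (0, v) 0) nA) => s.
  have -> : (x, y) + s *: (0, v) = (x, y + s *: v).
    by congr (_, _); rewrite /= scaler0 addr0.
  by move=> As; rewrite (dd_rfun_vert v As) -/a (quadDl a y _ v) (quadZl a s v v).
apply: (is_derive1_unique H); apply: near_eq_is_derive N _.
have ids := is_derive_id (0 : R) 1.
have dal := is_derive_alpha v aT q0.
pose al (s : R) := Num.sqrt (quad a (y + s *: v) (y + s *: v)).
have al0 : al 0 != 0 by rewrite /al scale0r addr0 gt_eqF // sqrtr_gt0.
have H1 := is_derive1D (is_derive1_cst (quad a y v) 0) (is_derive1M ids (is_derive1_cst (quad a v v) 0)).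
have := is_derive1D (is_derive1M H1 (is_derive1V (h := al) al0 dal)) (is_derive1_cst (covec b v) 0).
have y00 : y + (0 : R) *: v = y by rewrite scale0r addr0.
rewrite /al y00; congr (is_derive _ _ _ _).
have s2 : Num.sqrt (quad a y y) ^+ 2 = quad a y y by rewrite sqr_sqrtr // ltW.
have s0 : Num.sqrt (quad a y y) != 0 by rewrite gt_eqF // sqrtr_gt0.
move: (Num.sqrt _) s2 s0 => sq <- s0.
by field.
Qed.

Lemma fundE x y k l : A (x, y) ->
  fund fc x y k l = 2^-1 * dd (fun q => dd (sqf f) q (0, e k)) (x, y) (0, e l).
Proof. by move=> Aq; rewrite mxE (dydys l k Aq). Qed.

(** For [v] in the kernel the vertical Hessian of F^2 vanishes on (v, v). It equals 2 (F_y(v)^2 + F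
    F_yy(v, v)), a sum of nonnegative terms, so both vanish. Equality in Cauchy-Schwarz makes [v] a
    multiple of [y], and F_y(v) = 0 against F_y(y) = F > 0 makes the multiple zero. *)
Lemma fund_unit x y : A (x, y) -> fund fc x y \in unitmx.
Proof.
move=> Aq; rewrite -row_free_unit -kermx_eq0; apply/rowV0P => v /sub_kermxP va.
have [nA f1 f2 _] := smooth_at oA fs Aq; have [cx y0] := Aq.
have [_ s1 s2 _] := smooth_at oA ss Aq.
have sym := fun a b => dd_sym a b (@framed_real R) s1 (nbhs_singleton s2).
have S0 : dd (fun q => dd (sqf f) q (0, v)) (x, y) (0, v) = 0.
  rewrite dd_pair_sum big1 ?add0r; last by move=> k _; rewrite mxE mul0r.
  apply: big1 => l _; rewrite sym dd_pair_sum big1 ?add0r; last by move=> k _; rewrite mxE mul0r.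
  have : (v *m fund fc x y) 0 l = 0 by rewrite va mxE.
  rewrite mxE => E; apply/eqP; rewrite mulf_eq0; apply/orP; right; apply/eqP.
  transitivity (2 * \sum_k v 0 k * fund fc x y k l); last by rewrite E mulr0.
  rewrite mulr_sumr; apply: eq_bigr => k _.
  by rewrite fundE // (sym (0, e k)); field.
have fp := rfun_gt0 F Aq.
set a := r_alpha F i x.
have q0 : 0 < quad a y y by exact: rm_pos.
have aT : a^T = a by exact: rm_sym.
have apos w : w != 0 -> 0 < quad a w w by exact: rm_pos.
have den : 0 < quad a y y * Num.sqrt (quad a y y) by rewrite mulr_gt0 // sqrtr_gt0.
have CS : 0 <= quad a v v * quad a y y - quad a y v ^+ 2.
  by rewrite subr_ge0 mulrC quad_CS.
have D2ge : 0 <= dd (fun q => dd f q (0, v)) (x, y) (0, v).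
  by rewrite dd2_rfun_vert // divr_ge0 // ltW.
move/eqP: S0; rewrite (dd2_sqf _ _ oA fs Aq) mulf_eq0 pnatr_eq0 /= -expr2.
rewrite paddr_eq0 ?sqr_ge0 ?mulr_ge0 // ?ltW // sqrf_eq0 mulf_eq0 (gt_eqF fp) /=.
move=> /andP[/eqP d0 /eqP]; rewrite dd2_rfun_vert // -/a => /eqP.
rewrite mulf_eq0 invr_eq0 (gt_eqF den) orbF subr_eq0 => /eqP E.
have vE : v = (quad a v y / quad a y y) *: y.
  by apply: quad_CS_eq => //; rewrite E (quadC _ _ aT).
move: d0; rewrite vE; set c := _ / _.
have -> : (0, c *: y) = c *: (0, y) :> V * V by congr (_, _); rewrite /= scaler0.
rewrite ddZ (euler oA fs (@rfun_homogeneous _ _ _ F i) Aq) scaleRM => /eqP.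
by rewrite mulf_eq0 (gt_eqF fp) orbF => /eqP ->; rewrite scale0r.
Qed.

(** Contracting with [fund] cancels the inverse matrix inside [spray]; the constants match because
    the vertical Hessian of F^2 is twice [fund] and [spray] carries 1/4. *)
Lemma spray_EL x y z l : A (x, y) -> EL (sqf f) x y z (e l) =
  2 * \sum_k fund fc x y l k * (z 0 k + 2 * spray fc k x y).
Proof.
move=> Aq; rewrite /EL dd_pair_sum -(dxs l Aq).
pose S : 'cV[R]_n := \col_l (\sum_k dx k (dy l (sq fc)) x y * y 0 k - dx l (sq fc) x y).
have E1 : \sum_k y 0 k * dd (fun q => dd (sqf f) q (0, e l)) (x, y) (e k, 0) - dx l (sq fc) x y = S l 0.
  rewrite mxE; congr (_ - _); apply: eq_bigr => k _.
  by rewrite mulrC -(dxdys k l Aq).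
have E2 : \sum_k z 0 k * dd (fun q => dd (sqf f) q (0, e l)) (x, y) (0, e k) =
    2 * \sum_k fund fc x y l k * z 0 k.
  rewrite mulr_sumr; apply: eq_bigr => k _.
  by rewrite fundE // mulrC !mulrA mulfV ?pnatr_eq0 // mul1r.
have E3 : \sum_k fund fc x y l k * spray fc k x y = 4^-1 * S l 0.
  transitivity (4^-1 * (fund fc x y *m (invmx (fund fc x y) *m S)) l 0); last first.
    by rewrite mulKVmx // fund_unit.
  rewrite mxE mulr_sumr; apply: eq_bigr => k _.
  rewrite /spray !mxE mulrCA; congr (_ * (_ * _)).
  by apply: eq_bigr => l' _; rewrite !mxE.
rewrite addrAC E1 E2.
have -> : \sum_k fund fc x y l k * (z 0 k + 2 * spray fc k x y) =
   \sum_k fund fc x y l k * z 0 k + 2 * \sum_k fund fc x y l k * spray fc k x y.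
  rewrite mulr_sumr -big_split; apply: eq_bigr => k _ /=; ring.
by rewrite E3; field.
Qed.

Lemma smooth_spray k : smooth A (fun q => spray fc k q.1 q.2).
Proof.
move=> m; have [sx sd] := smooth_dd ss.
apply: (Ck_eq (f := fun q => 4^-1 * \sum_l invmx (fund fc q.1 q.2) k l *
   (\sum_j dd (fun q => dd (sqf f) q (0, e l)) q (e j, 0) * q.2 0 j - dd (sqf f) q (e l, 0)))) => //.
  move=> q; rewrite inE => Aq; rewrite /spray; congr (_ * _); apply: eq_bigr => l _.
  rewrite (dxs l Aq); congr (_ * (_ - _)); apply: eq_bigr => j _.
  by rewrite (dxdys j l Aq).
apply: CkM => //; first exact: Ck_cst.
apply: Ck_sum => // l; apply: CkM => //.
  apply: smooth_invmx => // [a b|[x y] Aq]; [exact: smooth_fund|exact: fund_unit].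
apply: CkD => //; last by apply: CkN => //; exact: sd.
apply: Ck_sum => // j; apply: CkM => //; last exact: smooth_snd.
by have [_ H] := smooth_dd (sd (0, e l)); exact: H.
Qed.

Definition gspray k (q : V * V) := spray fc k q.1 q.2.

Lemma spray_eq_EL x y z : A (x, y) ->
  z = - \row_k (2 * spray fc k x y) <-> forall w, EL (sqf f) x y z w = 0.
Proof.
move=> Aq; split=> [zE w|E].
  have E l : EL (sqf f) x y z (e l) = 0.
    rewrite spray_EL // big1 ?mulr0 // => k _.
    by rewrite zE !mxE addNr mulr0.
  by rewrite (EL_frame oA ss z w Aq) big1 // => l _; rewrite E mulr0.
have fz : fund fc x y *m (\col_k (z 0 k + 2 * spray fc k x y)) = 0.
  apply/matrixP => l j; rewrite !mxE.
  have := E (e l); rewrite spray_EL // => /eqP; rewrite mulf_eq0 pnatr_eq0 /= => /eqP H.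
  by rewrite -[RHS]H; apply: eq_bigr => k _; rewrite !mxE.
have : invmx (fund fc x y) *m (fund fc x y *m (\col_k (z 0 k + 2 * spray fc k x y))) = 0.
  by rewrite fz mulmx0.
rewrite mulKmx ?fund_unit // => /matrixP H.
apply/rowP => k; have := H k 0; rewrite !mxE => /eqP.
by rewrite addr_eq0 => /eqP.
Qed.

(** Linearise [spray_EL]: the bracket z + 2 G is zero at the base jet, so the variation of [fund]
    does not contribute, and [fund] is then inverted. *)
Lemma spray_linEL (x y z X Y Z : V) : A (x, y) -> z = - \row_k (2 * spray fc k x y) ->
  (forall k, Z 0 k + 2 * dd (gspray k) (x, y) (X, Y) = 0) <->
  forall w, linEL (sqf f) x y z X Y Z w = 0.
Proof.
move=> Aq zE; have [nA _ _ _] := smooth_at oA fs Aq.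
have gd k : differentiable (gspray k) (x, y).
  by have [+ _] := smooth_dd (smooth_spray k); apply.
have fd l k : differentiable (fun q => fund fc q.1 q.2 l k) (x, y).
  by have [+ _] := smooth_dd (smooth_fund l k); apply.
have lE w l : w = e l -> linEL (sqf f) x y z X Y Z w =
    2 * \sum_k fund fc x y l k * (Z 0 k + 2 * dd (gspray k) (x, y) (X, Y)).
  move=> ->.
  have [xs [xs0 dxs']] := ex_curve x X.
  have [ys [ys0 dys0]] := ex_curve y Y.
  have [zs [zs0 dzs]] := ex_curve z Z.
  have q0 : (xs 0, ys 0) = (x, y) by rewrite xs0 ys0.
  have dxy := is_derive1_pair dxs' dys0.
  apply: (is_derive1_unique (linEL_derive oA ss (e l) Aq xs0 ys0 zs0 dxs' dys0 dzs)).
  have N : \forall s \near (0 : R), 2 * \sum_k fund fc (xs s) (ys s) l k * (zs s 0 k + 2 * gspray k (xs s, ys s)) =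
     EL (sqf f) (xs s) (ys s) (zs s) (e l).
    by apply: filterS (near_at q0 dxy nA) => s As; rewrite spray_EL.
  apply: near_eq_is_derive N _.
  have H2 k : is_derive (0 : R) 1 (fun s => fund fc (xs s) (ys s) l k * (zs s 0 k + 2 * gspray k (xs s, ys s)))
     (fund fc x y l k * (Z 0 k + 2 * dd (gspray k) (x, y) (X, Y))).
    have dz0 : is_derive (0 : R) 1 (fun s => zs s 0 k) (Z 0 k).
      have lin : linear (fun A : V => A 0 k) by move=> c A B; rewrite !mxE.
      pose L : {linear V -> R} := HB.pack (fun A : V => A 0 k) (GRing.isLinear.Build _ _ _ _ _ lin).
      by apply: (is_derive1_linear (L := L) _ dzs) => q; exact: coord_continuous.
    have := is_derive1M (is_derive1_fun_at q0 (fd l k) dxy)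
      (is_derive1D dz0 (is_derive1M (is_derive1_cst (2 : R) 0) (is_derive1_fun_at q0 (gd k) dxy))).
    have z0 : zs 0 0 k + 2 * gspray k (xs 0, ys 0) = 0.
      by rewrite zs0 q0 zE !mxE /gspray addNr.
    by rewrite z0 mulr0 mul0r !add0r /= xs0 ys0.
  have := is_derive1M (is_derive1_cst (2 : R) 0) (is_derive1_sum H2).
  by rewrite mul0r add0r.
split=> [Z0 w|E].
  rewrite (linEL_frame oA ss z X Y Z w Aq) big1 // => l _.
  by rewrite (lE _ l) // big1 ?mulr0 // => k _; rewrite Z0 mulr0.
have fz : fund fc x y *m (\col_k (Z 0 k + 2 * dd (gspray k) (x, y) (X, Y))) = 0.
  apply/matrixP => l j; rewrite !mxE.
  have := E (e l); rewrite (lE _ l) // => /eqP; rewrite mulf_eq0 pnatr_eq0 /= => /eqP H.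
  by rewrite -[RHS]H; apply: eq_bigr => k _; rewrite !mxE.
have : invmx (fund fc x y) *m (fund fc x y *m (\col_k (Z 0 k + 2 * dd (gspray k) (x, y) (X, Y)))) = 0.
  by rewrite fz mulmx0.
by rewrite mulKmx ?fund_unit // => /matrixP H k; have := H k 0; rewrite !mxE.
Qed.
End Spray.

Lemma is_derive1_derive1 (R : realType) (V : normedModType R) (f : R -> V) (t : R) :
  derivable f t 1 -> is_derive t 1 f (derive1 f t).
Proof. by move=> H; rewrite derive1E; exact: derivableP. Qed.

Lemma derive1_is_derive (R : realType) (V : normedModType R) (f : R -> V) (t : R) (df : V) :
  is_derive t 1 f df -> derive1 f t = df.
Proof. by move=> H; rewrite derive1E; exact: (@derive_val _ _ _ _ _ _ _ H). Qed.

Section RowDerive.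
Variables (R : realType) (n : nat).
Local Notation V := 'rV[R]_n.

Lemma is_derive1_row (h : 'I_n -> R -> R) (dh : 'I_n -> R) (t : R) :
  (forall k, is_derive t 1 (h k) (dh k)) ->
  is_derive t 1 (fun s => \row_k h k s : V) (\row_k dh k).
Proof.
move=> H.
have D : derivable (fun s => \row_k h k s : V) t 1.
  apply/derivable_mxP => i j.
  rewrite (_ : (fun _ => _) = h j); last by apply/funext => s; rewrite mxE.
  by case: (H j).
apply: DeriveDef => //; rewrite derive_mx //; apply/matrixP => i j; rewrite !mxE.
rewrite (_ : (fun _ => _) = h j); last by apply/funext => s; rewrite mxE.
exact: derive_val.
Qed.

End RowDerive.

(** * The Jacobi equation in a chart *)

Section JacobiCoord.
Variables (R : realType) (n : nat) (M : manifold R n) (F : randers M) (i : idx M).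
Local Notation V := 'rV[R]_n.
Local Notation e k := (delta_mx 0 k : V).
Local Notation A := (slit i).
Local Notation fc := (randers_fun F i).
Local Notation G k := (gspray F i k).
Let oA := slit_open i.
Let Gs k : smooth A (G k) := smooth_spray F i k.
Let V2f := framed_prod (framed_rV R n) (framed_rV R n).

Lemma nonlinE k j q : A q -> nonlin fc k j q.1 q.2 = dd (G k) q (0, e j).
Proof.
case: q => x y Aq; have [_ s1 _ _] := smooth_at oA (@Gs k) Aq.
by apply: dyE (nbhs_singleton s1); apply: filterS s1 => -[].
Qed.

Lemma riemE k j x y : A (x, y) -> riem fc k j x y =
  2 * dd (G k) (x, y) (e j, 0)
  - \sum_l y 0 l * dd (fun q => dd (G k) q (0, e j)) (x, y) (e l, 0)
  + 2 * \sum_l spray fc l x y * dd (fun q => dd (G k) q (0, e j)) (x, y) (0, e l)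
  - \sum_l dd (G k) (x, y) (0, e l) * dd (G l) (x, y) (0, e j).
Proof.
move=> Aq; have [nA s1 s2 _] := smooth_at oA (@Gs k) Aq.
have nE : \forall q \near (x, y), nonlin fc k j q.1 q.2 = dd (G k) q (0, e j).
  by apply: filterS nA => q; exact: nonlinE.
rewrite /riem; congr (_ * _ - _ + _ * _ - _).
- by apply: dxE (nbhs_singleton s1); apply: filterS s1 => -[].
- by apply: eq_bigr => l _; rewrite (dxE _ nE) //; exact: nbhs_singleton s2 _.
- by apply: eq_bigr => l _; rewrite (dyE _ nE) //; exact: nbhs_singleton s2 _.
- by apply: eq_bigr => l _; rewrite (nonlinE k l Aq) (nonlinE l j Aq).
Qed.

Lemma nonlin_sum k (x y w : V) : A (x, y) ->
  \sum_j nonlin fc k j x y * w 0 j = dd (G k) (x, y) (0, w).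
Proof.
move=> Aq; rewrite dd_pair_sum [X in _ = X + _]big1 ?add0r; last by move=> j _; rewrite mxE mul0r.
by apply: eq_bigr => j _; rewrite (nonlinE k j Aq) mulrC.
Qed.

Section Curve.
Variables (c v X X1 : R -> V) (t : R).
Hypothesis Ac : A (c t, v t).
Hypothesis dc : is_derive t 1 c (v t).
Hypothesis dv : is_derive t 1 v (- \row_k (2 * spray fc k (c t) (v t))).
Hypothesis dX : is_derive t 1 X (X1 t).

Definition covd (Y Y1 : R -> V) (s : R) : V :=
  Y1 s + \row_k \sum_j nonlin fc k j (c s) (v s) * Y s 0 j.

Lemma nonlin_derive : is_derive t 1 (fun s => \row_k \sum_j nonlin fc k j (c s) (v s) * X s 0 j : V)
  (\row_k (dd (fun q => dd (G k) q (0, X t)) (c t, v t) (v t, - \row_k (2 * spray fc k (c t) (v t)))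
     + dd (G k) (c t, v t) (0, X1 t))).
Proof.
have [nA _ _ _] := smooth_at oA (rfun_smooth F i) Ac.
have N := near_continuous (is_derive1_pair dc dv) nA.
have E : \forall s \near t, (\row_k dd (G k) (c s, v s) (0, X s) : V) =
   \row_k \sum_j nonlin fc k j (c s) (v s) * X s 0 j.
  by apply: filterS N => s As; apply/rowP => k; rewrite !mxE nonlin_sum.
apply: near_eq_is_derive E _; apply: is_derive1_row => k.
have [_ _ s2 _] := smooth_at oA (@Gs k) Ac.
exact: is_derive1_dd V2f (nbhs_singleton s2) (is_derive1_pair dc dv)
  (is_derive1_pair (is_derive1_cst (0 : V) t) dX).
Qed.

(** The definition of [jacobi] asks for derivability of the covariant derivative, whereas the
    linearised equation needs a second derivative of the field; the connection term that separates
    them is differentiable. *)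
Lemma covd_derivable : derivable (covd X X1) t 1 <-> derivable X1 t 1.
Proof.
split=> H.
  have [] := is_derive1B (derivableP H) nonlin_derive.
  have -> // : (fun s => covd X X1 s - (\row_k \sum_j nonlin fc k j (c s) (v s) * X s 0 j)) = X1.
  by apply/funext => s; rewrite /covd addrK.
by have [] := is_derive1D (derivableP H) nonlin_derive.
Qed.

(* The terms of the curvature are those needed to cancel all derivatives of the
   nonlinear connection. *)
Lemma covd_covd (Z : V) : is_derive t 1 X1 Z ->
  'D_1 (covd X X1) t + \row_k \sum_j nonlin fc k j (c t) (v t) * covd X X1 t 0 j
    + \row_k \sum_j riem fc k j (c t) (v t) * X t 0 j =
  \row_k (Z 0 k + 2 * dd (G k) (c t, v t) (X t, X1 t)).
Proof.
move=> dX1.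
have := is_derive1D dX1 nonlin_derive => D.
have -> : 'D_1 (covd X X1) t = Z + \row_k (dd (fun q => dd (G k) q (0, X t)) (c t, v t) (v t, - \row_k (2 * spray fc k (c t) (v t)))
     + dd (G k) (c t, v t) (0, X1 t)) by exact: derive_val.
apply/rowP => k; rewrite !mxE nonlin_sum // /covd.
have [_ s1 s2 _] := smooth_at oA (@Gs k) Ac.
have -> : dd (G k) (c t, v t) (0, X1 t + \row_k \sum_j nonlin fc k j (c t) (v t) * X t 0 j) =
   dd (G k) (c t, v t) (0, X1 t) + \sum_l dd (G k) (c t, v t) (0, e l) * dd (G l) (c t, v t) (0, X t).
  have -> : ((0 : V), X1 t + \row_k \sum_j nonlin fc k j (c t) (v t) * X t 0 j) =
     (0, X1 t) + (0, \row_k \sum_j nonlin fc k j (c t) (v t) * X t 0 j).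
    by congr (_, _); rewrite /= ?addr0.
  rewrite ddD; congr (_ + _).
  rewrite dd_pair_sum big1 ?add0r; last by move=> j _; rewrite mxE mul0r.
  by apply: eq_bigr => l _; rewrite mxE nonlin_sum // mulrC.
have -> : \sum_j riem fc k j (c t) (v t) * X t 0 j =
  2 * dd (G k) (c t, v t) (X t, 0)
  - \sum_l v t 0 l * dd (fun q => dd (G k) q (0, X t)) (c t, v t) (e l, 0)
  + 2 * \sum_l spray fc l (c t) (v t) * dd (fun q => dd (G k) q (0, X t)) (c t, v t) (0, e l)
  - \sum_l dd (G k) (c t, v t) (0, e l) * dd (G l) (c t, v t) (0, X t).
  have S2 w : dd (fun q => dd (G k) q (0, X t)) (c t, v t) w =
     \sum_j X t 0 j * dd (fun q => dd (G k) q (0, e j)) (c t, v t) w.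
    rewrite (dd_sym _ _ (@framed_real R) s1 (nbhs_singleton s2)) dd_pair_sum big1 ?add0r; last first.
      by move=> j _; rewrite mxE mul0r.
    by apply: eq_bigr => j _; rewrite (dd_sym _ _ (@framed_real R) s1 (nbhs_singleton s2)).
  have S1 l w : dd (G l) (c t, v t) (0, w) = \sum_j w 0 j * dd (G l) (c t, v t) (0, e j).
    by rewrite dd_pair_sum big1 ?add0r // => j _; rewrite mxE mul0r.
  transitivity (\sum_j 2 * dd (G k) (c t, v t) (e j, 0) * X t 0 j -
    \sum_j (\sum_l v t 0 l * dd (fun q => dd (G k) q (0, e j)) (c t, v t) (e l, 0)) * X t 0 j +
    \sum_j 2 * (\sum_l spray fc l (c t) (v t) * dd (fun q => dd (G k) q (0, e j)) (c t, v t) (0, e l)) * X t 0 j -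
    \sum_j (\sum_l dd (G k) (c t, v t) (0, e l) * dd (G l) (c t, v t) (0, e j)) * X t 0 j).
    rewrite -sumrB -big_split -sumrB; apply: eq_bigr => j _ /=; rewrite riemE //; ring.
  congr (_ - _ + _ - _).
  - rewrite dd_pair_sum [X in _ + X]big1 ?addr0; last by move=> j _; rewrite mxE mul0r.
    by rewrite mulr_sumr; apply: eq_bigr => j _; rewrite mulrAC mulrA.
  - under eq_bigr do rewrite mulr_suml.
    rewrite exchange_big; apply: eq_bigr => l _ /=; rewrite S2 mulr_sumr.
    by apply: eq_bigr => j _; ring.
  - under eq_bigr do rewrite mulr_sumr mulr_suml.
    rewrite exchange_big mulr_sumr; apply: eq_bigr => l _ /=; rewrite S2 [RHS]mulrA mulr_sumr.
    by apply: eq_bigr => j _; ring.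
  - under eq_bigr do rewrite mulr_suml.
    rewrite exchange_big; apply: eq_bigr => l _ /=; rewrite (S1 l (X t)) mulr_sumr.
    by apply: eq_bigr => j _; ring.
(* Along a geodesic v' = -2 G, so the derivative of the connection splits into a horizontal and a
   vertical sum, which cancel the second and the third curvature terms. *)
rewrite (dd_pair_sum _ _ (v t)).
have -> : \sum_l (- \row_k (2 * spray fc k (c t) (v t))) 0 l *
    dd (fun q => dd (G k) q (0, X t)) (c t, v t) (0, e l) =
    - (2 * \sum_l spray fc l (c t) (v t) * dd (fun q => dd (G k) q (0, X t)) (c t, v t) (0, e l)).
  by rewrite mulr_sumr -sumrN; apply: eq_bigr => l _; rewrite !mxE; ring.
have -> : dd (G k) (c t, v t) (X t, X1 t) = dd (G k) (c t, v t) (X t, 0) + dd (G k) (c t, v t) (0, X1 t).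
  by rewrite -ddD; congr (dd _ _ (_, _)); rewrite /= ?addr0 ?add0r.
by ring.
Qed.

End Curve.
End JacobiCoord.

Lemma continuous_pair (T U W : topologicalType) (f : T -> U) (g : T -> W) (x : T) :
  {for x, continuous f} -> {for x, continuous g} -> {for x, continuous (fun y => (f y, g y))}.
Proof. by move=> fc gc; exact: (cvg_pair fc gc). Qed.

(** * Twists between Randers manifolds *)

Section Charts.
Variables (R : realType) (n : nat) (M : manifold R n).
Local Notation V := 'rV[R]_n.

Lemma cod_chart i (p : M) : dom i p -> cod i (chart i p).
Proof. by move=> ?; exists p. Qed.

Lemma dom_chart_inv i (x : V) : cod i x -> dom i (chart_inv i x : M).
Proof. by move=> [p dp <-]; rewrite chartK. Qed.

Lemma chart_invK i (x : V) : cod i x -> chart i (chart_inv i x : M) = x.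
Proof. by move=> [p dp <-]; rewrite chartK. Qed.

Lemma near_dom (T : topologicalType) (g : T -> M) (t : T) i : {for t, continuous g} ->
  dom i (g t) -> \forall s \near t, dom i (g s).
Proof. by move=> gc dt; apply: gc; apply: open_nbhs_nbhs; split => //; exact: dom_open. Qed.

Lemma near_cod i (x : V) : cod i x -> \forall y \near x, cod (M := M) i y.
Proof. by move=> cx; apply: open_nbhs_nbhs; split => //; exact: cod_open. Qed.

Lemma overlapP i j (x : V) : overlap (M := M) i j x <-> cod i x /\ dom j (chart_inv i x : M).
Proof.
split; first by move=> [p [di dj] <-]; split; [exact: cod_chart|rewrite chartK].
by move=> [[p di <-]]; rewrite chartK // => dj; exists p.
Qed.

Lemma overlap_open i j : open (overlap (M := M) i j).
Proof.
rewrite openE => x /overlapP[cx dj].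
have N := near_dom (chart_inv_cts cx) dj.
by apply: filterS2 (near_cod cx) N => y cy dy; apply/overlapP.
Qed.

Lemma trans_smooth i j : smooth (overlap i j) (trans (M := M) i j).
Proof. exact: chart_smooth. Qed.

Lemma trans_differentiable i j (x : V) : overlap (M := M) i j x -> differentiable (trans i j) x.
Proof. by move=> ov; have [+ _] := smooth_dd (trans_smooth i j); apply. Qed.

Lemma rfun_tensor (F : randers M) i j x v : overlap i j x ->
  rfun F j (trans i j x, dd (trans i j) x v) = rfun F i (x, v).
Proof.
move=> ov; rewrite ddE /rfun /randers_fun /=; congr (Num.sqrt _ + _).
  exact: rm_tensor.
exact: of_tensor.
Qed.

Definition cexp (chi : R -> M -> M) i j : R * V -> V :=
  fun tx => chart j (chi tx.1 (chart_inv i tx.2)).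

Definition cdom (chi : R -> M -> M) i j : set (R * V) :=
  [set tx | cod i tx.2 /\ dom j (chi tx.1 (chart_inv i tx.2))].

Lemma continuous_cdom_open (chi : R -> M -> M) i j :
  (forall t p, {for (t, p), continuous (fun tp : R * M => chi tp.1 tp.2)}) -> open (cdom chi i j).
Proof.
move=> chi_cts; rewrite openE => -[t x] [/= cx dj].
have c1 : {for (t, x), continuous (fun tx : R * V => (tx.1, chart_inv i tx.2) : R * M)}.
  apply: continuous_pair; first exact: cvg_fst.
  apply: (@continuous_comp _ _ _ snd (chart_inv i)); first exact: cvg_snd.
  exact: chart_inv_cts.
have c2 : {for (t, x), continuous (fun tx : R * V => chi tx.1 (chart_inv i tx.2))}.
  by apply: (@continuous_comp _ _ _ _ (fun tp : R * M => chi tp.1 tp.2) _ c1); exact: chi_cts.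
have N : \forall tx \near (t, x), cod (M := M) i tx.2.
  by have := @cvg_snd R V (nbhs t) (nbhs x); apply; exact: near_cod.
by apply: filterS2 N (near_dom c2 dj) => -[].
Qed.

(* [twist_speed]: if [c] has F1-speed [s], the curve [chi (tau t) (c t)] with
   [tau' = s] has F2-speed [s].  The triples (F, Ft, psi_t) and (Ft, F, psi_{-t})
   of the navigation problem are both twists. *)
Record twist (F1 F2 : randers M) (chi : R -> M -> M) : Prop := Twist {
  twist_cts : forall t p, {for (t, p), continuous (fun tp : R * M => chi tp.1 tp.2)};
  twist_smooth : forall i j, smooth (cdom chi i j) (cexp chi i j);
  twist0 : forall p, chi 0 p = p;
  twistD : forall s t p, chi (s + t) p = chi t (chi s p);
  twist_speed : forall i j t x v, cdom chi i j (t, x) ->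
    rfun F2 j (cexp chi i j (t, x), dd (cexp chi i j) (t, x) (rfun F1 i (x, v), v)) = rfun F1 i (x, v);
  twist_small : forall i j t x, cdom chi i j (t, x) ->
    rfun F2 j (cexp chi i j (t, x), dd (cexp chi i j) (t, x) (1, 0)) < 1
}.

Section TwistCharts.
Variables (F1 F2 : randers M) (chi : R -> M -> M).
Hypothesis tw : twist F1 F2 chi.

Lemma twistK t p : chi t (chi (- t) p) = p.
Proof. by rewrite -(twistD tw) addNr (twist0 tw). Qed.

Lemma twistNK t p : chi (- t) (chi t p) = p.
Proof. by rewrite -(twistD tw) subrr (twist0 tw). Qed.

Lemma cdom_open i j : open (cdom chi i j).
Proof. exact: continuous_cdom_open (twist_cts tw). Qed.

Lemma cexp_cod i j q : cdom chi i j q -> cod (M := M) j (cexp chi i j q).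
Proof. by move=> [_ dj]; exact: cod_chart. Qed.

(** A zero image would have F2-length 0, whereas its length is the F1-length of [v], which is
    positive. *)
Lemma cexp_slit i j t x v : cdom chi i j (t, x) -> slit i (x, v) ->
  slit j (cexp chi i j (t, x), dd (cexp chi i j) (t, x) (rfun F1 i (x, v), v)).
Proof.
move=> dq sv; split; first exact: cexp_cod.
apply/eqP => /= E; have := rfun_gt0 F1 sv.
by rewrite -(twist_speed tw v dq) E rfun0 ltxx.
Qed.

Lemma twistZ i j t x v : cdom chi i j (t, x) -> slit i (x, v) ->
  slit j (cexp chi i j (t, x), dd (cexp chi i j) (t, x) (rfun F1 i (x, v), v)) /\
  rfun F2 j (cexp chi i j (t, x), dd (cexp chi i j) (t, x) (rfun F1 i (x, v), v)) = rfun F1 i (x, v).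
Proof. by move=> dq sv; split; [exact: cexp_slit|exact: twist_speed]. Qed.

Lemma cdom_inv i j t x : cdom chi i j (t, x) -> cdom chi j i (- t, cexp chi i j (t, x)).
Proof.
move=> [/= cx dj]; split => /=; first exact: cod_chart.
by rewrite /cexp /= chartK // twistNK; exact: dom_chart_inv.
Qed.

Lemma cexp_inv i j t x : cdom chi i j (t, x) -> cexp chi j i (- t, cexp chi i j (t, x)) = x.
Proof.
by move=> [/= cx dj]; rewrite /cexp /= chartK // twistNK chart_invK.
Qed.

Lemma dd_slice (W : normedModType R) (h : R * V -> W) t x w : differentiable h (t, x) ->
  dd (fun y => h (t, y)) x w = dd h (t, x) (0, w) /\ differentiable (fun y => h (t, y)) x.
Proof.
move=> hd.
have pd : differentiable (fun y : V => (t, y)) x by apply: differentiable_pair.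
have cd : differentiable (fun y => h (t, y)) x.
  by apply: (differentiable_comp (f := fun y : V => (t, y)) (g := h)).
split => //.
have := dd_line (0, w) hd.
rewrite (_ : (fun s : R => h ((t, x) + s *: (0, w))) = (fun s => h (t, x + s *: w))); last first.
  by apply/funext => s; congr (h (_, _)); rewrite /= scaler0 addr0.
exact: is_derive1_unique (dd_line w cd).
Qed.

Lemma cexp_diff i j q : cdom chi i j q -> differentiable (cexp chi i j) q.
Proof. by move=> dq; have [+ _] := smooth_dd (twist_smooth tw i j); apply. Qed.

Lemma near_cdom_slice i j t x : cdom chi i j (t, x) -> \forall y \near x, cdom chi i j (t, y).
Proof.
move=> dq; have N := open_nbhs_nbhs (conj (@cdom_open i j) dq).
have c : {for x, continuous (fun y : V => (t, y))}.
  by apply: (continuous_pair (f := fun=> t) (g := id)); [exact: cst_continuous|exact: cvg_id].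
exact: c _ N.
Qed.

(** Differentiate in space, at fixed time, the identity that [chi (- t)] undoes [chi t]. Applied to
    the inverse expression it also yields [cexp_onto]. *)
Lemma cexp_injK i j t x w : cdom chi i j (t, x) ->
  dd (cexp chi j i) (- t, cexp chi i j (t, x)) (0, dd (cexp chi i j) (t, x) (0, w)) = w.
Proof.
move=> dq; have dq' := cdom_inv dq.
have [<- d1] := dd_slice w (cexp_diff dq).
have [<- d2] := dd_slice (dd (fun y => cexp chi i j (t, y)) x w) (cexp_diff dq').
rewrite -(dd_comp (f := fun y => cexp chi i j (t, y)) (g := fun y => cexp chi j i (- t, y))) //.
have N : \forall y \near x, cexp chi j i (- t, cexp chi i j (t, y)) = y.
  by apply: filterS (near_cdom_slice dq) => y; exact: cexp_inv.
rewrite (near_eq_dd w N); last by apply: (differentiable_comp (f := fun y => cexp chi i j (t, y)) (g := fun y => cexp chi j i (- t, y))).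
by rewrite (dd_linear (f := idfun)) // => y.
Qed.

Lemma cexp_onto i j t x : cdom chi i j (t, x) ->
  forall b, exists w, dd (cexp chi i j) (t, x) (0, w) = b.
Proof.
move=> dq b; have dq' := cdom_inv dq.
exists (dd (cexp chi j i) (- t, cexp chi i j (t, x)) (0, b)).
by have := cexp_injK b dq'; rewrite opprK cexp_inv.
Qed.

End TwistCharts.
End Charts.
Arguments cdom_open {R n M F1 F2 chi} tw i j.

(** * Geodesics and Jacobi fields *)

Section GeodesicCurve.
Variables (R : realType) (n : nat) (M : manifold R n).
Local Notation V := 'rV[R]_n.
Variables (F : randers M) (O : set R) (g : R -> M).
Hypotheses (oO : open O) (gg : geodesic_open (randers_fun F) O g).

Definition acc i t : V := - \row_k (2 * spray (randers_fun F i) k (loc i g t) (vel i g t)).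

Lemma geodesic_near t i : O t -> dom i (g t) -> \forall s \near t, O s /\ dom i (g s).
Proof.
move=> Ot dt; have [gc _] := gg Ot.
by apply: filterI (near_dom gc dt); apply: open_nbhs_nbhs.
Qed.

Lemma geodesic_curve t i : O t -> dom i (g t) ->
  [/\ is_derive t 1 (loc i g) (vel i g t), is_derive t 1 (vel i g) (acc i t),
      slit i (loc i g t, vel i g t), rfun F i (loc i g t, vel i g t) = 1 &
      dd (rfun F i) (loc i g t, vel i g t) (vel i g t, acc i t) = 0].
Proof.
move=> Ot dt; have [gc /(_ i dt)[d1 d2 vE f1]] := gg Ot.
have D1 : is_derive t 1 (loc i g) (vel i g t).
  exact: is_derive1_derive1 d1.
have D2 : is_derive t 1 (vel i g) (acc i t).
  by rewrite /acc -vE; exact: is_derive1_derive1 d2.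
have S : slit i (loc i g t, vel i g t).
  split; first exact: cod_chart.
  apply/eqP => /= v0; have : rfun F i (loc i g t, vel i g t) = 1 by [].
  by rewrite v0 rfun0 => /esym/eqP; rewrite oner_eq0.
split => //.
have [_ fd _ _] := smooth_at (slit_open i) (rfun_smooth F i) S.
have H := is_derive1_fun (nbhs_singleton fd) (is_derive1_pair D1 D2).
apply: (is_derive1_unique H).
have N : \forall s \near t, 1 = rfun F i (loc i g s, vel i g s).
  apply: filterS (geodesic_near Ot dt) => s [Os ds].
  by have [_ /(_ i ds)[]] := gg Os.
exact: near_eq_is_derive N (is_derive1_cst (1 : R) t).
Qed.

Lemma geodesic_EL t i : O t -> dom i (g t) ->
  forall w, EL (sqf (rfun F i)) (loc i g t) (vel i g t) (acc i t) w = 0.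
Proof. by move=> Ot dt; have [_ _ S _ _] := geodesic_curve Ot dt; apply/(spray_eq_EL F _ S). Qed.

End GeodesicCurve.

Section Push.
Variables (R : realType) (n : nat) (M : manifold R n).
Local Notation V := 'rV[R]_n.
Variables (F1 F2 : randers M) (chi : R -> M -> M).
Hypothesis tw : twist F1 F2 chi.
Variables (O : set R) (g : R -> M).
Hypotheses (oO : open O) (gg : geodesic_open (randers_fun F1) O g).
Let h t := chi t (g t).
Let Vf := framed_rV R n.
Let RVf := framed_prod (@framed_real R) Vf.

Lemma push_continuous t : {for t, continuous g} -> {for t, continuous (fun t => chi t (g t))}.
Proof.
move=> gc.
have c : {for t, continuous (fun t => (t, g t))}.
  by apply: (continuous_pair (f := id)) => //; exact: cvg_id.
by apply: (@continuous_comp _ _ _ _ (fun tp : R * M => chi tp.1 tp.2) _ c); exact: (twist_cts tw).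
Qed.

Lemma push_near t i k : O t -> dom k (g t) -> dom i (h t) ->
  \forall s \near t, [/\ O s, dom k (g s) & dom i (h s)].
Proof.
move=> Ot dk di; have [gc _] := gg Ot.
apply: filterS2 (geodesic_near oO gg Ot dk) (near_dom (push_continuous gc) di) => s [Os ds] dis.
by split.
Qed.

Lemma push_cdom t i k : dom k (g t) -> dom i (h t) -> cdom chi k i (t, loc k g t).
Proof. by move=> dk di; split; [exact: cod_chart|rewrite /loc /= chartK]. Qed.

Lemma push_loc t i k : dom k (g t) -> cexp chi k i (t, loc k g t) = loc i h t.
Proof. by move=> dk; rewrite /cexp /loc /= chartK. Qed.

Lemma push_derive t i k : O t -> dom k (g t) -> dom i (h t) ->
  is_derive t 1 (loc i h) (push1 (cexp chi k i) t (loc k g t) (vel k g t)).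
Proof.
move=> Ot dk di; have [dc _ _ _ _] := geodesic_curve oO gg Ot dk.
have E : \forall s \near t, cexp chi k i (s, loc k g s) = loc i h s.
  by apply: filterS (push_near Ot dk di) => s [_ + _]; exact: push_loc.
apply: near_eq_is_derive E _.
apply: is_derive1_fun (is_derive1_pair (is_derive_id t 1) dc).
by apply: (cexp_diff tw); exact: push_cdom.
Qed.

Lemma push_vel t i k : O t -> dom k (g t) -> dom i (h t) ->
  push1 (cexp chi k i) t (loc k g t) (vel k g t) = vel i h t.
Proof. by move=> Ot dk di; have [_ <-] := push_derive Ot dk di; rewrite /vel derive1E. Qed.

Lemma push_derive2 t i k : O t -> dom k (g t) -> dom i (h t) ->
  is_derive t 1 (vel i h) (push2 (cexp chi k i) t (loc k g t) (vel k g t) (acc F1 g k t)).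
Proof.
move=> Ot dk di; have [dc dv _ _ _] := geodesic_curve oO gg Ot dk.
have E : \forall s \near t, push1 (cexp chi k i) s (loc k g s) (vel k g s) = vel i h s.
  by apply: filterS (push_near Ot dk di) => s [Os ds dis]; exact: push_vel.
apply: near_eq_is_derive E _.
have [_ _ p2 _] := smooth_at (cdom_open tw k i) (twist_smooth tw k i) (push_cdom dk di).
exact: is_derive1_dd RVf (nbhs_singleton p2) (is_derive1_pair (is_derive_id t 1) dc)
  (is_derive1_pair (is_derive1_cst (1 : R) t) dv).
Qed.

Lemma push_geodesic : geodesic_open (randers_fun F2) O h.
Proof.
move=> t Ot; have [gc _] := gg Ot.
split; first exact: push_continuous.
move=> i di; pose k := chart_at (g t); have dk : dom k (g t) by exact: chart_atP.
have [dc dv Sq f1 df0] := geodesic_curve oO gg Ot dk.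
have Dq := push_cdom dk di.
have [D1 _] := push_derive Ot dk di.
have [D2 _] := push_derive2 Ot dk di.
have [Bq B1 _] := twist_unit Vf (slit_open k) (slit_open i) (cdom_open tw k i)
  (rfun_smooth F1 k) (rfun_smooth F2 i) (twist_smooth tw k i) (twistZ tw (i := k) (j := i)) Dq Sq f1 df0.
have qE : (cexp chi k i (t, loc k g t), dd (cexp chi k i) (t, loc k g t) (1, vel k g t)) =
    (loc i h t, vel i h t).
  by congr (_, _); [exact: push_loc|exact: push_vel].
have Bq' : slit i (loc i h t, vel i h t) by rewrite -qE.
have B1' : rfun F2 i (loc i h t, vel i h t) = 1 by rewrite -qE.
split; [exact: D1|exact: D2| |exact: B1'].
rewrite (derive1_is_derive (push_derive2 Ot dk di)); apply/(spray_eq_EL F2 _ Bq').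
have [xE vE] := (congr1 fst qE, congr1 snd qE); rewrite /= in xE vE.
rewrite -xE -vE.
apply: (twist_spray Vf (slit_open k) (slit_open i) (cdom_open tw k i)
  (rfun_smooth F1 k) (rfun_smooth F2 i) (twist_smooth tw k i) (@rfun_homogeneous _ _ _ F2 i)
  (twistZ tw (i := k) (j := i)) Dq Sq f1 df0 (cexp_onto tw Dq)).
exact: (geodesic_EL oO gg Ot dk).
Qed.

End Push.

Section JacobiCurve.
Variables (R : realType) (n : nat) (M : manifold R n).
Local Notation V := 'rV[R]_n.
Variables (F : randers M) (O : set R) (g : R -> M).
Hypotheses (oO : open O) (gg : geodesic_open (randers_fun F) O g).
Let Vf := framed_rV R n.
Let V2f := framed_prod Vf Vf.

(** Both equations say Z + 2 dG(X, X') = 0: the covariant one by [covd_covd], the Euler-Lagrange one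
    by [spray_linEL]. *)
Lemma jacobi_linear (X : idx M -> R -> V) t i (Z : V) : O t -> dom i (g t) ->
  is_derive t 1 (X i) (derive1 (X i) t) -> is_derive t 1 (derive1 (X i)) Z ->
  derivable (cov (randers_fun F) g X i) t 1 /\
  (cov (randers_fun F) g (cov (randers_fun F) g X) i t +
     \row_k \sum_j riem (randers_fun F i) k j (loc i g t) (vel i g t) * X i t 0 j = 0
   <-> forall w, linEL (sqf (rfun F i)) (loc i g t) (vel i g t) (acc F g i t) (X i t) (derive1 (X i) t) Z w = 0).
Proof.
move=> Ot dt dX dX1; have [dc dv S _ _] := geodesic_curve oO gg Ot dt.
have dX1' : derivable (derive1 (X i)) t 1 by case: dX1.
split; first exact: (covd_derivable S dc dv dX).2 dX1'.
have := covd_covd S dc dv dX dX1.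
have -> : 'D_1 (covd F i (loc i g) (vel i g) (X i) (derive1 (X i))) t = derive1 (cov (randers_fun F) g X i) t.
  by rewrite derive1E.
move=> E; rewrite -(spray_linEL (X i t) (derive1 (X i) t) Z S erefl).
have -> : cov (randers_fun F) g (cov (randers_fun F) g X) i t =
  derive1 (cov (randers_fun F) g X i) t + \row_k \sum_j nonlin (randers_fun F i) k j (loc i g t) (vel i g t) *
     covd F i (loc i g) (vel i g) (X i) (derive1 (X i)) t 0 j by [].
rewrite E; split=> [/rowP H k|H]; last by apply/rowP => k; rewrite !mxE.
by have := H k; rewrite !mxE.
Qed.

Variable X : idx M -> R -> V.
Hypothesis jX : jacobi (randers_fun F) O g X.

Lemma jacobi_curve t i : O t -> dom i (g t) ->
  [/\ is_derive t 1 (X i) (derive1 (X i) t),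
      is_derive t 1 (derive1 (X i)) (derive1 (derive1 (X i)) t) &
      forall w, linEL (sqf (rfun F i)) (loc i g t) (vel i g t) (acc F g i t) (X i t)
        (derive1 (X i) t) (derive1 (derive1 (X i)) t) w = 0].
Proof.
move=> Ot dt; have [_ /(_ t i Ot dt)[d1 d2 jE]] := jX.
have [dc dv S _ _] := geodesic_curve oO gg Ot dt.
have dX := is_derive1_derive1 d1.
have dX1 := is_derive1_derive1 ((covd_derivable S dc dv dX).1 d2).
split; [exact: dX|exact: dX1|].
exact: (jacobi_linear Ot dt dX dX1).2.1 jE.
Qed.

Lemma jacobi_trans t i j : O t -> dom i (g t) -> dom j (g t) ->
  X j t = dd (trans i j) (loc i g t) (X i t).
Proof. by move=> Ot di dj; rewrite ddE; exact: jX.1. Qed.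

Lemma vel_trans t i j : O t -> dom i (g t) -> dom j (g t) ->
  vel j g t = dd (trans i j) (loc i g t) (vel i g t).
Proof.
move=> Ot di dj; have [dc _ _ _ _] := geodesic_curve oO gg Ot di.
have ov : overlap i j (loc i g t) by exists (g t).
apply: derive1_is_derive.
have E : \forall s \near t, trans i j (loc i g s) = loc j g s.
  apply: filterS (geodesic_near oO gg Ot di) => s [Os ds].
  by rewrite /trans /loc /= chartK.
apply: near_eq_is_derive E _.
exact: is_derive1_fun (trans_differentiable ov) dc.
Qed.

(* [F_y(X)], whose derivative is the variation [dspeed] of the speed. *)
Definition momentum i t : R := dd (rfun F i) (loc i g t, vel i g t) (0, X i t).
Definition dspeed i t : R := dd (rfun F i) (loc i g t, vel i g t) (X i t, derive1 (X i) t).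

(** Only a variation inside one tangent space is involved, and there the change of chart acts
    linearly and preserves the metric. *)
Lemma momentum_chart t i j : O t -> dom i (g t) -> dom j (g t) -> momentum i t = momentum j t.
Proof.
move=> Ot di dj; have [_ _ Si _ _] := geodesic_curve oO gg Ot di.
have [_ _ Sj _ _] := geodesic_curve oO gg Ot dj.
have ov : overlap i j (loc i g t) by exists (g t).
rewrite /momentum (vel_trans Ot di dj) (jacobi_trans Ot di dj).
have xE : loc j g t = trans i j (loc i g t) by rewrite /trans /loc /= chartK.
rewrite xE; rewrite xE (vel_trans Ot di dj) in Sj.
have [_ fi _ _] := smooth_at (slit_open i) (rfun_smooth F i) Si.
have [_ fj _ _] := smooth_at (slit_open j) (rfun_smooth F j) Sj.
have H1 := dd_line (0, X i t) (nbhs_singleton fi).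
have H2 := dd_line (0, dd (trans i j) (loc i g t) (X i t)) (nbhs_singleton fj).
apply: (is_derive1_unique H1).
suff -> : (fun s : R => rfun F i ((loc i g t, vel i g t) + s *: (0, X i t))) =
  (fun s : R => rfun F j ((trans i j (loc i g t), dd (trans i j) (loc i g t) (vel i g t)) +
      s *: (0, dd (trans i j) (loc i g t) (X i t)))) by exact: H2.
apply/funext => s.
have -> : (loc i g t, vel i g t) + s *: (0, X i t) = (loc i g t, vel i g t + s *: X i t).
  by congr (_, _); rewrite /= ?scaler0 ?addr0.
rewrite -(rfun_tensor F _ ov) ddD ddZ; congr (rfun F j (_, _)).
by rewrite /= scaler0 addr0.
Qed.

(** Along a geodesic the derivative of F_y is F_x, by Euler-Lagrange, so the product rule gives
    F_x(X) + F_y(X'). *)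
Lemma momentum_derive t i : O t -> dom i (g t) -> is_derive t 1 (momentum i) (dspeed i t).
Proof.
move=> Ot di; have [dc dv S f1 df0] := geodesic_curve oO gg Ot di.
have [dX _ _] := jacobi_curve Ot di.
have [_ _ f2 _] := smooth_at (slit_open i) (rfun_smooth F i) S.
have H := is_derive1_dd V2f (nbhs_singleton f2) (is_derive1_pair dc dv) (is_derive1_pair (is_derive1_cst (0 : V) t) dX).
have E0 : EL (rfun F i) (loc i g t) (vel i g t) (acc F g i t) (X i t) = 0.
  exact: (sqf_EL0 (slit_open i) (rfun_smooth F i) S f1 df0).1 (geodesic_EL oO gg Ot di) _.
move/eqP: E0; rewrite /EL subr_eq0 => /eqP E0.
rewrite E0 -ddD in H.
have -> : dspeed i t = dd (rfun F i) (loc i g t, vel i g t) ((X i t, 0) + (0, derive1 (X i) t)).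
  by rewrite /dspeed; congr (dd _ _ (_, _)); rewrite /= ?addr0 ?add0r.
exact: H.
Qed.

(** After exchanging the order of differentiation, the derivative of the variation of F is the
    variation of F', which [linear_energy] makes zero. *)
Lemma dspeed_derive t i : O t -> dom i (g t) -> is_derive t 1 (dspeed i) 0.
Proof.
move=> Ot di; have [dc dv S f1 df0] := geodesic_curve oO gg Ot di.
have [dX dX1 L] := jacobi_curve Ot di.
have [_ fd f2 _] := smooth_at (slit_open i) (rfun_smooth F i) S.
have H := is_derive1_dd V2f (nbhs_singleton f2) (is_derive1_pair dc dv) (is_derive1_pair dX dX1).
rewrite (dd_sym _ _ (@framed_real R) fd (nbhs_singleton f2)) in H.
have E := linear_energy Vf (slit_open i) (rfun_smooth F i) (@rfun_homogeneous _ _ _ F i) S f1 df0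
  (geodesic_EL oO gg Ot di) L.
by rewrite E in H.
Qed.

(* [momentum] is affine and vanishes at [0] and [l]. *)
Lemma dspeed0 (l : R) : is_interval O -> 0 < l -> `[0, l] `<=` O ->
  (forall i, dom i (g 0) -> X i 0 = 0) -> (forall i, dom i (g l) -> X i l = 0) ->
  forall t i, O t -> dom i (g t) -> dspeed i t = 0.
Proof.
move=> iO l0 lO X0 Xl.
pose m t := momentum (chart_at (g t)) t.
pose m1 t := dspeed (chart_at (g t)) t.
have mE t i : O t -> dom i (g t) -> m t = momentum i t.
  by move=> Ot di; apply: momentum_chart => //; exact: chart_atP.
have dm t i : O t -> dom i (g t) -> is_derive t 1 m (dspeed i t).
  move=> Ot di.
  have E : \forall s \near t, momentum i s = m s.
    by apply: filterS (geodesic_near oO gg Ot di) => s [Os ds]; rewrite (mE s i).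
  exact: near_eq_is_derive E (momentum_derive Ot di).
(* Comparing [dspeed] in two charts directly would bring in second derivatives of the transition
   maps; as the derivative of the function [m], which is free of charts, it needs none. *)
have m1E t i : O t -> dom i (g t) -> m1 t = dspeed i t.
  by move=> Ot di; apply: (is_derive1_unique (dm t _ Ot (chart_atP _))); exact: dm.
have dm1 t : O t -> is_derive t 1 m1 0.
  move=> Ot; have di := chart_atP (g t).
  have E : \forall s \near t, dspeed (chart_at (g t)) s = m1 s.
    by apply: filterS (geodesic_near oO gg Ot di) => s [Os ds]; rewrite (m1E s (chart_at (g t))).
  exact: near_eq_is_derive E (dspeed_derive Ot di).
have cst a b : O a -> O b -> a <= b -> m1 a = m1 b.
  move=> Oa Ob ab.
  have sub x : a <= x <= b -> O x by exact: iO.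
  have [||c _] := @MVT_segment R m1 (fun=> 0) a b ab.
  - by move=> x; rewrite in_itv /= => /andP[ax xb]; apply: dm1; apply: sub; rewrite !ltW.
  - apply: derivable_within_continuous => x; rewrite in_itv /= => xab.
    by case: (dm1 x (sub x xab)).
  by rewrite mul0r => /eqP; rewrite subr_eq0 => /eqP.
have cst' a b : O a -> O b -> m1 a = m1 b.
  by move=> Oa Ob; have [ab|ba] := leP a b; [exact: cst|apply/esym/cst => //; exact: ltW].
have O0 : O 0 by apply: lO; rewrite /= in_itv /= lexx ltW.
have Ol : O l by apply: lO; rewrite /= in_itv /= lexx ltW.
have m0 : m 0 = 0 by rewrite /m /momentum X0 ?dd0 //; exact: chart_atP.
have ml : m l = 0 by rewrite /m /momentum Xl ?dd0 //; exact: chart_atP.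
have [||c cl] := @MVT R m m1 0 l l0.
- move=> x; rewrite in_itv /= => /andP[ax xb]; apply: dm; last exact: chart_atP.
  by apply: lO; rewrite /= in_itv /= !ltW.
- apply: derivable_within_continuous => x; rewrite in_itv /= => xab.
  have Ox : O x by apply: lO; rewrite /= in_itv.
  by case: (dm x _ Ox (chart_atP _)).
rewrite m0 ml !subr0 => /esym/eqP; rewrite mulf_eq0 (gt_eqF l0) orbF => /eqP mc.
move=> t i Ot di; rewrite -m1E // -mc; apply: cst' => //.
by apply: lO; move: cl; rewrite /= !in_itv /= => /andP[c0 cl]; rewrite !ltW.
Qed.

End JacobiCurve.

(** * Twisting Jacobi fields *)

Section PushJacobi.
Variables (R : realType) (n : nat) (M : manifold R n).
Local Notation V := 'rV[R]_n.
Variables (F1 F2 : randers M) (chi : R -> M -> M).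
Hypothesis tw : twist F1 F2 chi.
Variables (O : set R) (g : R -> M).
Hypotheses (oO : open O) (gg : geodesic_open (randers_fun F1) O g).
Let h t := chi t (g t).
Variable X : idx M -> R -> V.
Hypothesis jX : jacobi (randers_fun F1) O g X.
Hypothesis dX0 : forall t i, O t -> dom i (g t) -> dspeed F1 g X i t = 0.
Let Vf := framed_rV R n.
Let RVf := framed_prod (@framed_real R) Vf.

(** The image of [X] under the differential of [chi t] with time frozen. The chart around [g t] is
    an arbitrary choice, which [push_fieldE] removes so that the field can be differentiated in
    [t]. *)
Definition push_field i t : V :=
  dpush0 (cexp chi (chart_at (g t)) i) t (loc (chart_at (g t)) g t) (X (chart_at (g t)) t).

Lemma push_fieldE t i k : O t -> dom k (g t) -> dom i (h t) ->
  push_field i t = dpush0 (cexp chi k i) t (loc k g t) (X k t).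
Proof.
move=> Ot dk di; rewrite /push_field; set k0 := chart_at (g t).
have dk0 : dom k0 (g t) by exact: chart_atP.
have ov : overlap k0 k (loc k0 g t) by exists (g t).
have xE : loc k g t = trans k0 k (loc k0 g t) by rewrite /trans /loc /= chartK.
have D0 : cdom chi k0 i (t, loc k0 g t) by split; [exact: cod_chart|rewrite /loc /= chartK].
have D1 : cdom chi k i (t, loc k g t) by split; [exact: cod_chart|rewrite /loc /= chartK].
rewrite (jacobi_trans jX Ot dk0 dk) /dpush0.
have [<- s0] := dd_slice (X k0 t) (cexp_diff tw D0).
have [<- s1] := dd_slice (dd (trans k0 k) (loc k0 g t) (X k0 t)) (cexp_diff tw D1).
rewrite xE in s1 *.
rewrite -(dd_comp (f := trans k0 k) (g := fun y => cexp chi k i (t, y))) //; last exact: trans_differentiable.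
apply: near_eq_dd s0.
have N := open_nbhs_nbhs (conj (@overlap_open R n M k0 k) ov).
apply: filterS N => y /overlapP[cy dy].
by rewrite /cexp /trans /= chartK.
Qed.

Lemma push_field_derive t i k : O t -> dom k (g t) -> dom i (h t) ->
  is_derive t 1 (push_field i) (dpush1 (cexp chi k i) t (loc k g t) (vel k g t) (X k t) (derive1 (X k) t)).
Proof.
move=> Ot dk di; have [dc _ _ _ _] := geodesic_curve oO gg Ot dk.
have [dX _ _] := jacobi_curve oO gg jX Ot dk.
have E : \forall s \near t, dpush0 (cexp chi k i) s (loc k g s) (X k s) = push_field i s.
  by apply: filterS (push_near tw oO gg Ot dk di) => s [Os ds dis]; rewrite (push_fieldE (k := k)).
apply: near_eq_is_derive E _.
have [_ p1 p2 _] := smooth_at (cdom_open tw k i) (twist_smooth tw k i) (push_cdom dk di).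
have := is_derive1_dd RVf (nbhs_singleton p2) (is_derive1_pair (is_derive_id t 1) dc)
  (is_derive1_pair (is_derive1_cst (0 : R) t) dX).
by rewrite (dd_sym _ _ Vf p1 (nbhs_singleton p2)).
Qed.

Lemma push_field_derive2 t i k : O t -> dom k (g t) -> dom i (h t) ->
  is_derive t 1 (derive1 (push_field i)) (dpush2 (cexp chi k i) t (loc k g t) (vel k g t) (acc F1 g k t)
     (X k t) (derive1 (X k) t) (derive1 (derive1 (X k)) t)).
Proof.
move=> Ot dk di; have [dc dv _ _ _] := geodesic_curve oO gg Ot dk.
have [dX dX1 _] := jacobi_curve oO gg jX Ot dk.
have E : \forall s \near t, dpush1 (cexp chi k i) s (loc k g s) (vel k g s) (X k s) (derive1 (X k) s) =
    derive1 (push_field i) s.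
  apply: filterS (push_near tw oO gg Ot dk di) => s [Os ds dis].
  by rewrite (derive1_is_derive (push_field_derive Os ds dis)).
apply: near_eq_is_derive E _.
have [_ p1 p2 p3] := smooth_at (cdom_open tw k i) (twist_smooth tw k i) (push_cdom dk di).
have p2' := nbhs_singleton p2.
have dq := is_derive1_pair (is_derive_id t 1) dc.
have c0 := is_derive1_cst (0 : R) t.
have H1 := is_derive1_dd2 RVf p2 p3 dq (is_derive1_pair (is_derive1_cst (1 : R) t) dv) (is_derive1_pair c0 dX).
have H2 := is_derive1_dd RVf p2' dq (is_derive1_pair c0 dX1).
have H := is_derive1D H1 H2.
have q1 : \forall y \near (t, loc k g t), differentiable (fun q => dd (cexp chi k i) q (1, vel k g t)) y.
  by apply: filterS p2 => y; apply.
(* In [dpush2] the variation [X] is the outermost derivative, whereas differentiating along the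
   curve puts the jet direction (1, c') outermost. *)
have S3 := dd_sym ((0, X k t) : R * V) ((1, vel k g t) : R * V) Vf q1 (p3 ((1, vel k g t) : R * V)).
rewrite S3 in H.
have perm (a b c d e : V) : a + b + c + (d + e) = a + d + c + (b + e).
  by rewrite -!addrA; congr (_ + _); rewrite addrCA [RHS]addrCA; congr (c + _); rewrite addrCA.
by rewrite /dpush2 perm; exact: H.
Qed.

Lemma push_field_derive1 t i k : O t -> dom k (g t) -> dom i (h t) ->
  derive1 (push_field i) t = dpush1 (cexp chi k i) t (loc k g t) (vel k g t) (X k t) (derive1 (X k) t).
Proof. by move=> Ot dk di; rewrite (derive1_is_derive (push_field_derive Ot dk di)). Qed.

Lemma push_along : along O h push_field.
Proof.
move=> i j t Ot di dj; pose k := chart_at (g t); have dk : dom k (g t) by exact: chart_atP.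
have Di := push_cdom dk di; have Dj := push_cdom dk dj.
have ov : overlap i j (loc i h t) by exists (h t).
rewrite -ddE (push_fieldE Ot dk di) (push_fieldE Ot dk dj) /dpush0.
have [<- si] := dd_slice (X k t) (cexp_diff tw Di).
have [<- sj] := dd_slice (X k t) (cexp_diff tw Dj).
have xE : loc i h t = cexp chi k i (t, loc k g t) by rewrite push_loc.
rewrite xE in ov *.
rewrite -(dd_comp (f := fun y => cexp chi k i (t, y)) (g := trans i j)) //; last exact: trans_differentiable.
apply: near_eq_dd sj.
apply: filterS (near_cdom_slice tw Di) => y [/= cy dy].
by rewrite /cexp /trans /= chartK.
Qed.

Lemma push_jacobi : jacobi (randers_fun F2) O h push_field.
Proof.
split; first exact: push_along.
move=> t i Ot di; pose k := chart_at (g t); have dk : dom k (g t) by exact: chart_atP.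
have [dc dv Sq f1 df0] := geodesic_curve oO gg Ot dk.
have [dX dX1 L] := jacobi_curve oO gg jX Ot dk.
have Dq := push_cdom dk di.
have dY := push_field_derive Ot dk di.
have dY1 := push_field_derive2 Ot dk di.
have hg := push_geodesic tw oO gg.
have dY' : is_derive t 1 (push_field i) (derive1 (push_field i) t).
  by apply: is_derive1_derive1; case: dY.
have [C1 C2] := jacobi_linear oO hg Ot di dY' dY1.
split; [by case: dY|exact: C1|apply/C2 => w].
have aE : acc F2 h i t = push2 (cexp chi k i) t (loc k g t) (vel k g t) (acc F1 g k t).
  have [_ dv2 _ _ _] := geodesic_curve oO hg Ot di.
  exact: is_derive1_unique dv2 (push_derive2 tw oO gg Ot dk di).
rewrite aE (push_field_derive1 Ot dk di) (push_fieldE Ot dk di).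
rewrite -(push_loc chi i dk) -(push_vel tw oO gg Ot dk di).
apply: (twist_jacobi Vf (slit_open k) (slit_open i) (cdom_open tw k i)
  (rfun_smooth F1 k) (rfun_smooth F2 i) (twist_smooth tw k i) (@rfun_homogeneous _ _ _ F1 k)
  (@rfun_homogeneous _ _ _ F2 i) (twistZ tw (i := k) (j := i)) Dq Sq f1 df0 (cexp_onto tw Dq)) => //.
  exact: (geodesic_EL oO gg Ot dk).
exact: dX0.
Qed.

Lemma push_field_eq0 t i : O t -> dom i (h t) -> (forall k, dom k (g t) -> X k t = 0) -> push_field i t = 0.
Proof.
move=> Ot di X0; rewrite (push_fieldE Ot (chart_atP _) di) X0 ?/dpush0 ?dd0 //; exact: chart_atP.
Qed.

Lemma push_field_neq0 t i k : O t -> dom k (g t) -> dom i (h t) -> X k t != 0 -> push_field i t != 0.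
Proof.
move=> Ot dk di; apply: contra_neq => E; have Dq := push_cdom dk di.
have EE := push_fieldE Ot dk di; rewrite E /dpush0 in EE.
by rewrite -(cexp_injK tw (X k t) Dq) -EE dd0.
Qed.

End PushJacobi.

Section PushConjugate.
Variables (R : realType) (n : nat) (M : manifold R n).
Variables (F1 F2 : randers M) (chi : R -> M -> M).
Hypothesis tw : twist F1 F2 chi.

Lemma push_conjugate g l : 0 < l -> conjugate (randers_fun F1) g l ->
  conjugate (randers_fun F2) (fun t => chi t (g t)) l.
Proof.
move=> l0 [ O [h [X [[oO iO lO hg] [gh jX X0 Xl [t [i [tl di Xt]]]]]]]].
have dX0 := dspeed0 oO hg jX iO l0 lO X0 Xl.
have O0 : O 0 by apply: lO; rewrite /= in_itv /= lexx ltW.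
have Ol : O l by apply: lO; rewrite /= in_itv /= lexx ltW.
have Ot : O t by apply: lO.
exists O, (fun t => chi t (h t)), (push_field chi h X).
have hh := push_geodesic tw oO hg.
split; first by split.
split.
- by move=> s sl; rewrite gh.
- exact: (push_jacobi tw oO hg jX dX0).
- by move=> j dj; apply: (push_field_eq0 tw jX).
- by move=> j dj; apply: (push_field_eq0 tw jX).
exists t, (chart_at (chi t (h t))); split => //; first exact: chart_atP.
by apply: (push_field_neq0 tw jX Ot di) => //; exact: chart_atP.
Qed.

Lemma push_geodesic_on J g : geodesic (randers_fun F1) J g ->
  geodesic (randers_fun F2) J (fun t => chi t (g t)).
Proof.
move=> [ O [h [oO iO JO hg gh]]]; exists O, (fun t => chi t (h t)); split => //.
  exact: (push_geodesic tw oO hg).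
by move=> t Jt; rewrite gh.
Qed.

End PushConjugate.

(** * The twists of the navigation problem *)

Section TranslatedIndicatrix.
Variables (R : realType) (n : nat) (M : manifold R n) (F1 F2 : randers M).
Variables (i : idx M) (x w : 'rV[R]_n).
Hypothesis cx : cod i x.
Hypothesis F12 : forall y, rfun F1 i (x, y) = 1 -> rfun F2 i (x, y + w) = 1.

(** The hypothesis concerns unit vectors only; dividing [v] by its length and using homogeneity of
    both metrics gives every speed, and speed 0 separately. *)
Lemma translate_speed v : rfun F2 i (x, v + rfun F1 i (x, v) *: w) = rfun F1 i (x, v).
Proof.
have [->|v0] := eqVneq v 0; first by rewrite rfun0 scale0r addr0 rfun0.
have s0 : 0 < rfun F1 i (x, v) by apply: rfun_gt0.
set s := rfun F1 i (x, v) in s0 *.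
have sn : s != 0 by rewrite gt_eqF.
have -> : v + s *: w = s *: (s^-1 *: v + w) by rewrite scalerDr scalerA divff // scale1r.
rewrite rfunZ ?ltW // F12 ?mulr1 // rfunZ ?invr_ge0 ?ltW // -/s mulVf //.
Qed.

(** If s = F1(-w) were at least 1, then [translate_speed] at -w would give F2((s - 1) w) = s, while
    F2(w) < 1 bounds the left side by s - 1. *)
Lemma translate_small : rfun F2 i (x, w) < 1 -> rfun F1 i (x, - w) < 1.
Proof.
move=> sm; rewrite ltNge; apply/negP => s1.
have := translate_speed (- w); set s := rfun F1 i (x, - w) in s1 *.
rewrite -scaleN1r -scalerDl addrC rfunZ ?subr_ge0 // => E.
have : (s - 1) * rfun F2 i (x, w) <= s - 1 by rewrite ler_piMr ?subr_ge0 // ltW.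
by rewrite E; lra.
Qed.

End TranslatedIndicatrix.

Section NavigationTwists.
Variables (R : realType) (n : nat) (M : manifold R n) (F Ft : randers M).
Variables (W : vfield M) (psi : R -> M -> M).
Hypothesis W_small : forall i x, cod i x -> randers_fun F i x (- W i x) < 1.
Hypothesis Ft_zermelo : zermelo (randers_fun F) W (randers_fun Ft).
Hypothesis psi_flow : flow_on W setT setT psi.
Hypothesis W_killing : killing (randers_fun F) W.
Local Notation V := 'rV[R]_n.
Let Vf := framed_rV R n.
Let RVf := framed_prod (@framed_real R) Vf.

Lemma zermelo_shift i x y : cod i x -> rfun F i (x, y) = 1 -> rfun Ft i (x, y + W i x) = 1.
Proof.
move=> cx Fy; have := Ft_zermelo cx; rewrite predeqE => /(_ (y + W i x))[_]; apply.
by exists y.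
Qed.

Lemma zermelo_unshift i x y : cod i x -> rfun Ft i (x, y) = 1 -> rfun F i (x, y - W i x) = 1.
Proof.
move=> cx Fy; have := Ft_zermelo cx; rewrite predeqE => /(_ y)[+ _].
by move=> /(_ Fy)[z Fz <-]; rewrite addrK.
Qed.

Lemma flow_cdomE i j : cdom psi i j = [set tx : R * V | [/\ setT tx.1, cod i tx.2,
                setT (chart_inv i tx.2) & dom j (psi tx.1 (chart_inv i tx.2))]].
Proof. by apply/seteqP; split=> -[t x] /= => [[]|[_ ? _ ?]]. Qed.

Lemma flow_cdom_open i j : open (cdom psi i j).
Proof. by apply: continuous_cdom_open => t p; exact: (flow_cts psi_flow). Qed.

Lemma flow_cexp_smooth i j : smooth (cdom psi i j) (cexp psi i j).
Proof. by rewrite flow_cdomE; exact: (flow_smooth psi_flow). Qed.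

Lemma flow_cexp_diff i j q : cdom psi i j q -> differentiable (cexp psi i j) q.
Proof. by move=> dq; have [+ _] := smooth_dd (@flow_cexp_smooth i j); apply. Qed.

(** [flow_gen] gives only the value of [derive1]; derivability itself comes from the joint
    smoothness of the flow. *)
Lemma flow_derive t p i : dom i (psi t p) ->
  is_derive t 1 (fun s => chart i (psi s p)) (W i (chart i (psi t p))).
Proof.
move=> di; pose k := chart_at p; have dk : dom k p by exact: chart_atP.
have D : cdom psi k i (t, chart k p) by split; [exact: cod_chart|rewrite /= chartK].
have := is_derive1_fun (flow_cexp_diff D)
  (is_derive1_pair (is_derive_id t 1) (is_derive1_cst (chart k p) t)).
rewrite /cexp /= (_ : (fun s : R => chart i (psi s (chart_inv k (chart k p)))) = fun s => chart i (psi s p)); last first.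
  by apply/funext => s; rewrite chartK.
move=> D1; rewrite -(flow_gen psi_flow I I di).
by apply: is_derive1_derive1; case: D1.
Qed.

Lemma flow_time i j t x : cdom psi i j (t, x) -> dd (cexp psi i j) (t, x) (1, 0) = W j (cexp psi i j (t, x)).
Proof.
move=> D; have [/= cx dj] := D.
have D1 := is_derive1_fun (flow_cexp_diff D)
  (is_derive1_pair (is_derive_id t 1) (is_derive1_cst x t)).
exact: is_derive1_unique D1 (flow_derive dj).
Qed.

(** Invariance of [W] under its own flow: both sides are the derivative at s = 0 of psi_t(psi_s(p))
    = psi_s(psi_t(p)). *)
Lemma flow_field i j t x : cdom psi i j (t, x) -> dd (cexp psi i j) (t, x) (0, W i x) = W j (cexp psi i j (t, x)).
Proof.
move=> D; have [/= cx dj] := D; pose p : M := chart_inv i x.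
have di : dom i (psi 0 p) by rewrite (flow0 psi_flow) //; exact: dom_chart_inv.
have D0 := flow_derive di.
have x0 : chart i (psi 0 p) = x by rewrite (flow0 psi_flow) // chart_invK.
rewrite x0 in D0.
have D1 := is_derive1_fun_at (f := cexp psi i j) (q := (t, x)) (congr1 (pair t) x0) (flow_cexp_diff D)
  (is_derive1_pair (is_derive1_cst t (0 : R)) D0).
apply: (is_derive1_unique D1).
have pE : psi 0 (psi t p) = psi t p by rewrite (flow0 psi_flow).
have dj' : dom j (psi 0 (psi t p)) by rewrite pE.
have := flow_derive dj'; rewrite pE => D2.
apply: near_eq_is_derive D2.
have c0 : {for 0 : R, continuous (fun s => psi s p)}.
  have c : {for 0 : R, continuous (fun s : R => (s, p))}.
    by apply: continuous_pair; [exact: cvg_id|exact: cst_continuous].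
  apply: (@continuous_comp _ _ _ _ (fun tp : R * M => psi tp.1 tp.2) _ c).
  exact: (flow_cts psi_flow).
apply: filterS (near_dom c0 di) => s ds.
by rewrite /cexp /= chartK // -!(flowD psi_flow) // addrC.
Qed.

Lemma flow_isometry i j t x v : cdom psi i j (t, x) ->
  rfun F j (cexp psi i j (t, x), dd (cexp psi i j) (t, x) (0, v)) = rfun F i (x, v).
Proof.
(* [killing] speaks of one-parameter groups with times in a bounded symmetric interval; this radius
   makes the restriction of the global flow reach [t]. *)
move=> D; have [/= cx dj] := D; pose e := `|t| + 1.
have e0 : 0 < e by rewrite ltr_wpDl.
have fl : flow_on W `]-e, e[ setT psi.
  split=> *; [exact: (flow_cts psi_flow)| |exact: (flow0 psi_flow)|exact: (flowD psi_flow)|exact: (flow_gen psi_flow)].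
  by move=> k; apply: Ck_sub (flow_smooth psi_flow _ _ k) => -[a b] [].
have te : t \in `]-e, e[.
  rewrite in_itv /= -ltr_norml /e; lra.
have := W_killing e0 openT fl te (i := i) (j := j) (p := chart_inv i x) v I (dom_chart_inv cx) dj.
rewrite chart_invK //.
have [<- _] := dd_slice v (flow_cexp_diff D).
by rewrite ddE.
Qed.

Lemma flow_dd i j t x a v : cdom psi i j (t, x) ->
  dd (cexp psi i j) (t, x) (a, v) = dd (cexp psi i j) (t, x) (0, v) + a *: W j (cexp psi i j (t, x)).
Proof.
move=> D; rewrite -(flow_time D) -ddZ -ddD; congr (dd _ _ _).
by congr (_, _); rewrite /= ?scaler0 ?addr0 // add0r scaleRM mulr1.
Qed.

Lemma flow_twist : twist F Ft psi.
Proof.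
split.
- by move=> t p; exact: (flow_cts psi_flow).
- exact: flow_cexp_smooth.
- by move=> p; exact: (flow0 psi_flow).
- by move=> s t p; exact: (flowD psi_flow).
- move=> i j t x v D; rewrite (flow_dd _ _ D).
  have cj : cod j (cexp psi i j (t, x)) by case: D => _ dj; exact: cod_chart.
  rewrite -(flow_isometry v D); apply: translate_speed => // y.
  exact: zermelo_shift.
- move=> i j t x D; rewrite (flow_time D).
  have cj : cod j (cexp psi i j (t, x)) by case: D => _ dj; exact: cod_chart.
  (* The roles are reversed: F is the translate of Ft by -W, so F(-W) < 1 yields Ft(W) < 1. *)
  have := @translate_small _ _ _ Ft F j _ (- W j _) cj (fun y => @zermelo_unshift j _ y cj) (W_small cj).
  by rewrite opprK.
Qed.

Let neg_fun (q : R * V) : R * V := (- q.1, q.2).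

Let neg_is_linear : linear neg_fun.
Proof.
move=> c [a b] [a' b']; congr (_, _); rewrite /= opprD; congr (_ - _).
by rewrite !scaleRM mulrN.
Qed.

Let neg : {linear (R * V)%type -> (R * V)%type} := HB.pack neg_fun (GRing.isLinear.Build _ _ _ _ neg_fun neg_is_linear).

Let neg_continuous : continuous neg.
Proof.
move=> q; apply: (continuous_pair (f := fun q : R * V => - q.1) (g := snd)); last exact: cvg_snd.
by apply: (@cvgN _ R^o); exact: cvg_fst.
Qed.

Lemma flowN_dd i j t x v : cdom psi i j (- t, x) ->
  dd (cexp (fun t => psi (- t)) i j) (t, x) v = dd (cexp psi i j) (- t, x) (- v.1, v.2).
Proof.
move=> D.
rewrite (dd_comp (f := neg) (g := cexp psi i j)); last 2 first.
- by apply: linear_differentiable; exact: neg_continuous.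
- exact: flow_cexp_diff.
by rewrite (dd_linear (f := neg)) //; exact: neg_continuous.
Qed.

(** With s = Ft(v), the twisted velocity is the image of [v] minus s W. By [flow_field] it is the
    image of [v - s *: W], which has F-length s by unshifting the indicatrix and keeps it under the
    isometry. The time derivative is -W, so the last clause is the navigation hypothesis F(-W) <
    1. *)
Lemma flowN_twist : twist Ft F (fun t => psi (- t)).
Proof.
split.
- move=> t p.
  have c : {for (t, p), continuous (fun q : R * M => (- q.1, q.2))}.
    by apply: continuous_pair; [apply: cvgN; exact: cvg_fst|exact: cvg_snd].
  by apply: (@continuous_comp _ _ _ _ (fun tp : R * M => psi tp.1 tp.2) _ c); exact: (flow_cts psi_flow).
- move=> i j k.
  have H := @Ck_comp_lin _ _ _ _ k (cdom psi i j) (cexp psi i j) neg (@flow_cdom_open i j) neg_continuous (@flow_cexp_smooth i j k).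
  exact H.
- by move=> p; rewrite oppr0 (flow0 psi_flow).
- by move=> s t p; rewrite opprD (flowD psi_flow).
- move=> i j t x v D; have D' : cdom psi i j (- t, x) by [].
  rewrite flowN_dd //= flow_dd // -(flow_field D') -ddZ -ddD.
  have cx : cod i x by case: D.
  rewrite -[RHS](translate_speed cx (w := - W i x) (F2 := F)); last by move=> y; exact: zermelo_unshift.
  rewrite -(flow_isometry _ D'); congr (rfun _ _ (_, dd _ _ _)).
  by congr (_, _); rewrite /= ?scaler0 ?addr0 // scaleNr scalerN.
- move=> i j t x D; have D' : cdom psi i j (- t, x) by [].
  have cj : cod j (cexp psi i j (- t, x)) by case: D => _ dj; exact: cod_chart.
  rewrite flowN_dd //= flow_dd //.
  have -> : dd (cexp psi i j) (- t, x) (0, 0) = 0 by rewrite dd0.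
  by rewrite add0r scaleN1r; exact: (W_small cj).
Qed.

End NavigationTwists.

(** * Lengths and distances *)

Lemma near_eq_continuous (T U : topologicalType) (f g : T -> U) (t : T) :
  (\forall s \near t, f s = g s) -> {for t, continuous f} -> {for t, continuous g}.
Proof.
move=> fg fc; rewrite /prop_for /continuous_at -(nbhs_singleton fg).
by apply: cvg_trans fc; exact: near_eq_cvg.
Qed.

Lemma continuous_sum (R : realType) (T : topologicalType) (V : normedModType R) (I : finType)
    (f : I -> T -> V) (t : T) : (forall i, {for t, continuous (f i)}) ->
  {for t, continuous (fun s => \sum_i f i s)}.
Proof.
move=> fc; elim: (index_enum I) => [|i r IH].
  have -> : (fun s => \sum_(i <- [::]) f i s) = fun=> 0 by apply/funext => s; rewrite big_nil.
  exact: cst_continuous.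
have -> : (fun s => \sum_(j <- i :: r) f j s) = fun s => f i s + \sum_(j <- r) f j s.
  by apply/funext => s; rewrite big_cons.
by apply: cvgD; [exact: fc|exact: IH].
Qed.

Lemma continuous_dd (R : realType) (T : topologicalType) (V W : normedModType R) (f : V -> W)
    (z a : T -> V) (t : T) : framed V ->
  (forall v, differentiable (fun y => dd f y v) (z t)) ->
  {for t, continuous z} -> {for t, continuous a} ->
  {for t, continuous (fun s => dd f (z s) (a s))}.
Proof.
move=> [I [e [l [lc le]]]] df zc ac.
have -> : (fun s => dd f (z s) (a s)) = fun s => \sum_i l i (a s) *: dd f (z s) (e i).
  by apply/funext => s; exact: dd_frame.
apply: continuous_sum => i; apply: cvgZ.
  exact: (continuous_comp ac (lc i _)).
apply: (continuous_comp (g := fun y => dd f y (e i)) zc).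
exact: differentiable_continuous.
Qed.

(** Zero velocities are included: curves in the definition of the distance may stop, where the
    metric is continuous but smoothness was established only off the zero section. *)
Lemma rfun_continuous (R : realType) (n : nat) (M : manifold R n) (F : randers M) i x v :
  cod i x -> {for (x, v), continuous (rfun F i)}.
Proof.
move=> cx.
have ac k l : {for (x, v), continuous (fun q : 'rV[R]_n * 'rV[R]_n => r_alpha F i q.1 k l)}.
  apply: (continuous_comp (f := fst) (g := fun y => r_alpha F i y k l)); first exact: cvg_fst.
  exact: (smooth_entry F i k l 0%N).
have bc k : {for (x, v), continuous (fun q : 'rV[R]_n * 'rV[R]_n => r_beta F i q.1 0 k)}.
  apply: (continuous_comp (f := fst) (g := fun y => r_beta F i y 0 k)); first exact: cvg_fst.
  exact: (smooth_covec F i k 0%N).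
have vc k : {for (x, v), continuous (fun q : 'rV[R]_n * 'rV[R]_n => q.2 0 k)}.
  apply: (continuous_comp (f := snd) (g := fun w : 'rV[R]_n => w 0 k)); first exact: cvg_snd.
  exact: coord_continuous.
have ca : {for (x, v), continuous (fun q : 'rV[R]_n * 'rV[R]_n => Num.sqrt (quad (r_alpha F i q.1) q.2 q.2))}.
  apply: (continuous_comp (f := fun q : 'rV[R]_n * 'rV[R]_n => quad (r_alpha F i q.1) q.2 q.2)); last exact: sqrt_continuous.
  have -> : (fun q : 'rV[R]_n * 'rV[R]_n => quad (r_alpha F i q.1) q.2 q.2) =
      fun q => \sum_l (\sum_k q.2 0 k * r_alpha F i q.1 k l) * q.2 0 l.
    by apply/funext => q; rewrite /quad mxE; apply: eq_bigr => l _; rewrite !mxE.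
  apply: (continuous_sum (V := R)) => l; apply: cvgM; last exact: vc.
  by apply: (continuous_sum (V := R)) => k; apply: cvgM; [exact: vc|exact: ac].
have cb : {for (x, v), continuous (fun q : 'rV[R]_n * 'rV[R]_n => covec (r_beta F i q.1) q.2)}.
  have -> : (fun q : 'rV[R]_n * 'rV[R]_n => covec (r_beta F i q.1) q.2) =
      fun q => \sum_k q.2 0 k * r_beta F i q.1 0 k.
    by apply/funext => q; rewrite /covec mxE; apply: eq_bigr => l _; rewrite !mxE.
  by apply: (continuous_sum (V := R)) => k; apply: cvgM; [exact: vc|exact: bc].
exact: cvgD ca cb.
Qed.

Section C1Curves.
Variables (R : realType) (n : nat) (M : manifold R n).
Local Notation V := 'rV[R]_n.
Variables (F : randers M) (O : set R) (g : R -> M).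
Hypotheses (oO : open O) (gg : C1_open O g).

Lemma C1_derive t i : O t -> dom i (g t) ->
  is_derive t 1 (loc i g) (vel i g t) /\ {for t, continuous (vel i g)}.
Proof. by move=> Ot di; have [_ /(_ i di)[d c]] := gg Ot; split; [exact: is_derive1_derive1 d|exact: c]. Qed.

Lemma C1_near t i : O t -> dom i (g t) -> \forall s \near t, O s /\ dom i (g s).
Proof.
move=> Ot dt; have [gc _] := gg Ot.
by apply: filterI (near_dom gc dt); apply: open_nbhs_nbhs.
Qed.

Lemma C1_vel_trans t i j : O t -> dom i (g t) -> dom j (g t) ->
  vel j g t = dd (trans i j) (loc i g t) (vel i g t).
Proof.
move=> Ot di dj; have [dc _] := C1_derive Ot di.
have ov : overlap i j (loc i g t) by exists (g t).
apply: derive1_is_derive.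
have E : \forall s \near t, trans i j (loc i g s) = loc j g s.
  apply: filterS (C1_near Ot di) => s [Os ds].
  by rewrite /trans /loc /= chartK.
apply: near_eq_is_derive E _.
exact: is_derive1_fun (trans_differentiable ov) dc.
Qed.

Lemma speed_chart t i : O t -> dom i (g t) ->
  speed (randers_fun F) g t = rfun F i (loc i g t, vel i g t).
Proof.
move=> Ot di; have dk := chart_atP (g t); set k := chart_at (g t) in dk.
have ov : overlap i k (loc i g t) by exists (g t).
rewrite -(rfun_tensor F _ ov) -(C1_vel_trans Ot di dk) /rfun /speed /=.
by rewrite -/k /loc /trans /= chartK.
Qed.

Lemma speed_continuous t : O t -> {for t, continuous (speed (randers_fun F) g)}.
Proof.
move=> Ot; have dk := chart_atP (g t); set k := chart_at (g t) in dk.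
have [dc vc] := C1_derive Ot dk.
have E : \forall s \near t, rfun F k (loc k g s, vel k g s) = speed (randers_fun F) g s.
  by apply: filterS (C1_near Ot dk) => s [Os ds]; rewrite (speed_chart Os ds).
apply: near_eq_continuous E _.
apply: (continuous_comp (f := fun s => (loc k g s, vel k g s)) (g := rfun F k)).
  by apply: continuous_pair => //; exact: is_derive1_continuous dc.
by apply: rfun_continuous; exact: cod_chart.
Qed.

End C1Curves.

Section SpeedBasics.
Variables (R : realType) (n : nat) (M : manifold R n) (F : randers M).

Lemma speed_ge0 (g : R -> M) t : 0 <= speed (randers_fun F) g t.
Proof. by apply: rfun_ge0; apply: cod_chart; exact: chart_atP. Qed.

Lemma speed_near (g h : R -> M) t : (\forall s \near t, g s = h s) ->
  speed (randers_fun F) g t = speed (randers_fun F) h t.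
Proof.
move=> gh; have gt := nbhs_singleton gh; rewrite /speed /loc gt; congr (randers_fun F _ _ _).
rewrite /vel !derive1E; apply: near_eq_derive.
by rewrite /loc; apply: filterS gh => s /= ->.
Qed.

End SpeedBasics.

Section PushC1.
Variables (R : realType) (n : nat) (M : manifold R n).
Local Notation V := 'rV[R]_n.
Variables (F1 F2 : randers M) (chi : R -> M -> M).
Hypothesis tw : twist F1 F2 chi.
Variables (O : set R) (g : R -> M) (tau dtau : R -> R).
Hypotheses (oO : open O) (gg : C1_open O g).
Hypotheses (dt : forall t, O t -> is_derive t 1 tau (dtau t))
  (dtc : forall t, O t -> {for t, continuous dtau}).
Let h t := chi (tau t) (g t).
Let Vf := framed_rV R n.
Let RVf := framed_prod (@framed_real R) Vf.

Lemma push_C1_continuous t : O t -> {for t, continuous h}.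
Proof.
move=> Ot; have [gc _] := gg Ot.
have c : {for t, continuous (fun t => (tau t, g t))}.
  by apply: continuous_pair gc; exact: is_derive1_continuous (dt Ot).
by apply: (@continuous_comp _ _ _ _ (fun tp : R * M => chi tp.1 tp.2) _ c); exact: (twist_cts tw).
Qed.

Lemma push_C1_derive t i k : O t -> dom k (g t) -> dom i (h t) ->
  is_derive t 1 (loc i h) (dd (cexp chi k i) (tau t, loc k g t) (dtau t, vel k g t)).
Proof.
move=> Ot dk di; have [dc _] := C1_derive gg Ot dk.
have E : \forall s \near t, cexp chi k i (tau s, loc k g s) = loc i h s.
  by apply: filterS (C1_near oO gg Ot dk) => s [_ ds]; rewrite /cexp /loc /= chartK.
apply: near_eq_is_derive E _.
apply: is_derive1_fun (is_derive1_pair (dt Ot) dc).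
by apply: (cexp_diff tw); split; [exact: cod_chart|rewrite /loc /= chartK].
Qed.

Lemma push_C1_vel t i k : O t -> dom k (g t) -> dom i (h t) ->
  vel i h t = dd (cexp chi k i) (tau t, loc k g t) (dtau t, vel k g t).
Proof. by move=> Ot dk di; rewrite /vel (derive1_is_derive (push_C1_derive Ot dk di)). Qed.

Lemma push_C1 : C1_open O h.
Proof.
move=> t Ot; split; first exact: push_C1_continuous.
move=> i di; have dk := chart_atP (g t); set k := chart_at (g t) in dk.
split; first by case: (push_C1_derive Ot dk di).
have [dc vc] := C1_derive gg Ot dk.
have E : \forall s \near t, dd (cexp chi k i) (tau s, loc k g s) (dtau s, vel k g s) = vel i h s.
  apply: filterS2 (C1_near oO gg Ot dk) (near_dom (push_C1_continuous Ot) di) => s [Os ds] dis.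
  by rewrite (push_C1_vel Os ds dis).
apply: near_eq_continuous E _.
have D : cdom chi k i (tau t, loc k g t) by split; [exact: cod_chart|rewrite /loc /= chartK].
have [_ _ p2 _] := smooth_at (cdom_open tw k i) (twist_smooth tw k i) D.
apply: (continuous_dd (z := fun s => (tau s, loc k g s)) (a := fun s => (dtau s, vel k g s)) RVf).
- exact: (nbhs_singleton p2).
- by apply: continuous_pair; [exact: is_derive1_continuous (dt Ot)|exact: is_derive1_continuous dc].
- by apply: continuous_pair vc; exact: dtc.
Qed.

End PushC1.

Section PushSpeed.
Variables (R : realType) (n : nat) (M : manifold R n).
Variables (F1 F2 : randers M) (chi : R -> M -> M).
Hypothesis tw : twist F1 F2 chi.

(** Time is made to advance with arc length, so [twist_speed] applies at every instant without any
    reparametrisation to unit speed. *)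
Lemma push_speed O g tau : open O -> C1_open O g ->
  (forall t, O t -> is_derive t 1 tau (speed (randers_fun F1) g t)) ->
  C1_open O (fun t => chi (tau t) (g t)) /\
  forall t, O t -> speed (randers_fun F2) (fun t => chi (tau t) (g t)) t = speed (randers_fun F1) g t.
Proof.
move=> oO gg dt; have sc t (Ot : O t) := speed_continuous (F := F1) oO gg Ot.
have hg := push_C1 tw oO gg dt sc; split; [exact: hg|move=> t Ot].
have dk := chart_atP (g t); set k := chart_at (g t) in dk.
have di := chart_atP (chi (tau t) (g t)); set i := chart_at _ in di.
have D : cdom chi k i (tau t, loc k g t) by split; [exact: cod_chart|rewrite /loc /= chartK].
rewrite (speed_chart F2 oO hg Ot di) (push_C1_vel tw oO gg dt Ot dk di) (speed_chart F1 oO gg Ot dk).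
rewrite -[RHS](twist_speed tw (vel k g t) D); congr (rfun F2 i (_, _)).
by rewrite /cexp /loc /= chartK.
Qed.

(** A flow line is a constant curve twisted with time at rate 1, so its velocity is the image of (1,
    0), which [twist_small] bounds. *)
Lemma flow_line_speed p : C1_open setT (fun t => chi t p) /\
  forall t, speed (randers_fun F2) (fun t => chi t p) t < 1.
Proof.
have g1 : C1_open setT (fun=> p : M).
  move=> t _; split; first exact: cst_continuous.
  move=> i di; split; first exact: derivable_cst.
  have -> : vel i (fun=> p) = fun=> 0 by apply/funext => s; rewrite /vel derive1_cst.
  exact: cst_continuous.
have d1 t : setT t -> is_derive (t : R) 1 id (1 : R) by move=> _; exact: is_derive_id.
have c1 (t : R) : setT t -> {for t, continuous (fun=> 1 : R)} by move=> _; exact: cst_continuous.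
have hg := push_C1 tw openT g1 d1 c1; split => // t.
have dk := chart_atP p; set k := chart_at p in dk.
have di := chart_atP (chi t p); set i := chart_at _ in di.
have D : cdom chi k i (t, chart k p) by split; [exact: cod_chart|rewrite /= chartK].
rewrite (speed_chart F2 openT hg (t := t) I di) (push_C1_vel tw openT g1 d1 (t := t) I dk di).
have -> : vel k (fun=> p) t = 0 by rewrite /vel derive1_cst.
have := twist_small tw D; rewrite /loc /=.
by rewrite {1}/cexp /= chartK.
Qed.

End PushSpeed.

Section Primitives.
Variable R : realType.

Lemma open_itv_extend (O : set R) a b : open O -> a < b -> `[a, b] `<=` O ->
  exists e : R, 0 < e /\ `[a - e, b + e] `<=` O.
Proof.
move=> oO ab abO.
have Oa : O a by apply: abO; rewrite /= in_itv /= lexx ltW.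
have Ob : O b by apply: abO; rewrite /= in_itv /= lexx ltW.
have /nbhs_ballP[ea /= ea0 Ba] := open_nbhs_nbhs (conj oO Oa).
have /nbhs_ballP[eb /= eb0 Bb] := open_nbhs_nbhs (conj oO Ob).
exists (Num.min ea eb / 2).
have m0 : 0 < Num.min ea eb by rewrite lt_min ea0.
have me : Num.min ea eb <= ea by rewrite ge_min lexx.
have me' : Num.min ea eb <= eb by rewrite ge_min lexx orbT.
split; first by rewrite divr_gt0.
move=> x; rewrite /= in_itv /= => /andP[x1 x2].
have [xa|ax] := ltP x a.
  by apply: Ba; rewrite /ball /= ger0_norm; lra.
have [xb|bx] := leP x b; first by apply: abO; rewrite /= in_itv /= ax.
by apply: Bb; rewrite /ball /= ltr0_norm; lra.
Qed.

Lemma continuous_in_within (f : R -> R) (O : set R) a b : (forall t, O t -> {for t, continuous f}) ->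
  `[a, b] `<=` O -> {within `[a, b], continuous f}.
Proof. by move=> fc abO; apply: continuous_in_subspaceT => x; rewrite inE => /abO/fc. Qed.

Lemma ex_primitive (f : R -> R) (O : set R) a b : open O -> a < b -> `[a, b] `<=` O ->
  (forall t, O t -> {for t, continuous f}) ->
  exists (O' : set R) S, [/\ open O', `[a, b] `<=` O', O' `<=` O &
    forall t, O' t -> is_derive t 1 S (f t)].
Proof.
move=> oO ab abO fc; have [e [e0 eO]] := open_itv_extend oO ab abO.
(* Starting the integral at [a - e] makes [a] and [b] interior points, so the primitive has
   two-sided derivatives on an open set around the segment. *)
exists (`]a - e, b + e[%classic), (fun x => \int[lebesgue_measure]_(t in `[a - e, x]) f t)%R; split.
- exact: itv_open.
- by move=> x; rewrite /= !in_itv /= => /andP[? ?]; apply/andP; split; lra.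
- move=> x xe; apply: eO; move: xe; rewrite /= !in_itv /= => /andP[? ?].
  by apply/andP; split; exact: ltW.
move=> x; rewrite /= in_itv /= => /andP[x1 x2].
have Ox : O x by apply: eO; rewrite /= in_itv /= !ltW.
have fi : lebesgue_measure.-integrable `[a - e, b + e] (EFin \o f).
  apply: continuous_compact_integrable; first exact: segment_compact.
  exact: continuous_in_within fc eO.
have [d1 d2] := continuous_FTC1_closed x2 fi x1 (fc x Ox).
by rewrite -d2; exact: is_derive1_derive1.
Qed.

Lemma integral_derive (f S : R -> R) (O : set R) a b : a < b -> `[a, b] `<=` O ->
  (forall t, O t -> {for t, continuous f}) ->
  (forall t, O t -> is_derive t 1 S (f t)) ->
  (\int[lebesgue_measure]_(t in `[a, b]) (f t)%:E = (S b - S a)%:E)%E.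
Proof.
move=> ab abO fc dS; rewrite EFinB; apply: continuous_FTC2 => //.
- exact: continuous_in_within fc abO.
- have c x : x \in `[a, b] -> {for x, continuous S}.
    by move=> xab; exact: is_derive1_continuous (dS x (abO x xab)).
  split.
  + move=> x xab; have Ox : O x by apply: abO; exact: subset_itv_oo_cc.
    by case: (dS x Ox).
  + by apply: cvg_at_right_filter; apply: c; rewrite in_itv /= lexx ltW.
  + by apply: cvg_at_left_filter; apply: c; rewrite in_itv /= lexx ltW.
- move=> x xab; have Ox : O x by apply: abO; exact: subset_itv_oo_cc.
  exact: derive1_is_derive (dS x Ox).
Qed.

End Primitives.

Section Arcs.
Variables (R : realType) (n : nat) (M : manifold R n) (F : randers M).
Notation spd := (speed (randers_fun F)).

(** At the two endpoints the speeds may differ, since the curves agree on one side only; inside they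
    agree, and the endpoints form a null set. *)
Lemma len_eq_on (g h : R -> M) (a b : R) : measurable_fun `[a, b] (spd h) ->
  (forall t, t \in `[a, b] -> g t = h t) ->
  measurable_fun `[a, b] (spd g) /\ len (randers_fun F) a b g = len (randers_fun F) a b h.
Proof.
move=> mh gh.
have E : {in `]a, b[, spd h =1 spd g}.
  move=> t tab; apply: speed_near.
  have N : \forall s \near t, s \in `]a, b[ by exact: near_in_itvoo.
  by apply: filterS N => s sab; rewrite gh //; exact: subset_itv_oo_cc.
have mh' : measurable_fun `]a, b[ (spd h).
  by apply: measurable_funS mh; [exact: measurable_itv|exact: subset_itv_oo_cc].
have mg : measurable_fun `]a, b[ (spd g).
  by apply: eq_measurable_fun mh' => t; rewrite inE; exact: E.
split; first exact: measurable_fun_itv_cc mg.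
exact: (eq_integral_itv_bounded true false mg mh' (fun t tab => esym (E t tab))).
Qed.

Lemma C1_speed_measurable (h : R -> M) (O : set R) a b : open O -> C1_open O h -> `[a, b] `<=` O ->
  measurable_fun `[a, b] (spd h).
Proof.
move=> oO hh abO; apply: subspace_continuous_measurable_fun; first exact: measurable_itv.
apply: continuous_in_within abO => t Ot; exact: (speed_continuous (F := F) oO hh Ot).
Qed.

Lemma len_cat (g : R -> M) (a b c : R) : a <= b -> b <= c ->
  measurable_fun `[a, b] (spd g) -> measurable_fun `[b, c] (spd g) ->
  measurable_fun `[a, c] (spd g) /\
  len (randers_fun F) a c g = (len (randers_fun F) a b g + len (randers_fun F) b c g)%E.
Proof.
move=> ab bc m1 m2.
have m2' : measurable_fun `]b, c] (spd g).
  by apply: measurable_funS m2; [exact: measurable_itv|exact: subset_itv_oc_cc].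
have acE : `[a, c]%classic = `[a, b] `|` `]b, c] by rewrite (@itv_bndbnd_setU _ _ _ (BRight b)) // bnd_simp.
have mac : measurable_fun `[a, c] (spd g) by rewrite acE; apply/measurable_funU.
split; first exact: mac.
rewrite /len acE ge0_integral_setU //=.
- congr (_ + _)%E; apply: integral_itv_obnd_cbnd.
  exact/measurable_EFinP.
- by apply/measurable_EFinP; rewrite -acE.
- by move=> x _; rewrite lee_fin; exact: speed_ge0.
- apply/disj_setPS => x [/=]; rewrite !in_itv /= => /andP[_ xb] /andP[bx _].
  by move: (lt_le_trans bx xb); rewrite ltxx.
Qed.

(* [S] is an arc length of [g].  Carrying it along makes reparametrisation and
   twisting of arcs a matter of the chain rule, without change of variables. *)
Definition arc_on (g : R -> M) (S : R -> R) (a b : R) : Prop :=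
  exists O : set R, [/\ open O, `[a, b] `<=` O, C1_open O g & forall t, O t -> is_derive t 1 S (spd g t)].

Definition arc (p q : M) (L : R) : Prop :=
  exists g S a b, [/\ a < b, arc_on g S a b, g a = p, g b = q & L = S b - S a].

Lemma len_arc_on g S a b : a < b -> arc_on g S a b ->
  len (randers_fun F) a b g = (S b - S a)%:E.
Proof.
move=> ab [ O [oO abO hg dS]].
exact: (integral_derive ab abO (fun t Ot => speed_continuous (F := F) oO hg Ot) dS).
Qed.

Lemma ex_arc_on (g : R -> M) (O : set R) a b : open O -> C1_open O g -> a < b -> `[a, b] `<=` O ->
  exists S, arc_on g S a b.
Proof.
move=> oO hg ab abO.
have [ O' [S [oO' abO' O'O dS]]] := ex_primitive oO ab abO (fun t Ot => speed_continuous (F := F) oO hg Ot).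
exists S, O'; split => // t /O'O; exact: hg.
Qed.

Lemma arc_rescale p q L a b : a < b -> arc p q L ->
  exists g S, [/\ arc_on g S a b, g a = p, g b = q & L = S b - S a].
Proof.
move=> ab [g [S [c [d [cd [ O [oO cdO hg dS]] gc gd ->]]]]].
pose k := (d - c) / (b - a); pose A t := c + k * (t - a).
have ba0 : b - a != 0 by rewrite subr_eq0 gt_eqF.
have k0 : 0 < k by rewrite divr_gt0 // subr_gt0.
have Aa : A a = c by rewrite /A subrr mulr0 addr0.
have Ab : A b = d by rewrite /A /k divfK // addrC subrK.
have dA t : is_derive (t : R) 1 A k.
  have H := is_derive1D (is_derive1_cst c t) (is_derive1M (is_derive1_cst k t) (is_derive1B (is_derive_id t 1) (is_derive1_cst a t))).
  by move: H; rewrite subr0 add0r mul0r mulr1 ?add0r ?addr0.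
have Ac t : {for t, continuous A} by exact: is_derive1_continuous (dA t).
have comp (V : normedModType R) (f : R -> V) t df : is_derive (A t) 1 f df ->
    is_derive t 1 (fun s => f (A s)) (k *: df).
  move=> [fd <-]; have fd' : differentiable f (A t) by exact/derivable1_diffP.
  have := is_derive1_fun fd' (dA t).
  rewrite -[X in dd f _ X]mulr1 -scaleRM ddZ ddE -deriveE //.
have D t i : O (A t) -> dom i (g (A t)) -> is_derive t 1 (loc i (g \o A)) (k *: vel i g (A t)).
  by move=> Ot di; have [d1 _] := C1_derive hg Ot di; exact: comp d1.
have oP : open (A @^-1` O) by apply: open_comp oO => t _; exact: Ac.
have vE t i : O (A t) -> dom i (g (A t)) -> vel i (g \o A) t = k *: vel i g (A t).
  by move=> Ot di; exact: derive1_is_derive (D t i Ot di).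
have gA : C1_open (A @^-1` O) (g \o A).
  move=> t Ot; have [gAc _] := hg _ Ot.
  have gAt : {for t, continuous (g \o A)} by exact: continuous_comp (Ac t) gAc.
  split => // i di; split; first by case: (D t i Ot di).
  have [_ vc] := C1_derive hg Ot di.
  have E : \forall s \near t, k *: vel i g (A s) = vel i (g \o A) s.
    apply: filterS2 (near_dom gAt di) (open_nbhs_nbhs (conj oP Ot)) => s ds Os.
    by rewrite vE.
  apply: near_eq_continuous E _.
  apply: cvgZ; first exact: cst_continuous.
  exact: continuous_comp (Ac t) vc.
exists (g \o A), (S \o A); rewrite /= Aa Ab; split => //.
exists (A @^-1` O); split => //.
- move=> t; rewrite /= in_itv /= => /andP[at_ tb]; apply: cdO; rewrite /= in_itv /=.
  have h1 : 0 <= k * (t - a) by rewrite mulr_ge0 ?subr_ge0 // ltW.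
  have h2 : k * (t - a) <= k * (b - a) by rewrite ler_wpM2l ?lerB // ltW.
  have h3 : k * (b - a) = d - c by rewrite /k divfK.
  by rewrite /A; apply/andP; split; lra.
- move=> t Ot; have di := chart_atP (g (A t)); set i := chart_at _ in di.
  rewrite (speed_chart F oP gA Ot di) (vE t i Ot di) rfunZ ?ltW //.
  rewrite -[rfun _ _ _](speed_chart F oO hg Ot di).
  exact: comp (dS _ Ot).
Qed.

(** Turns the empty chain into an actual curve on a nondegenerate interval, the base case of
    [chain_piecewise]. *)
Lemma arc0 p : arc p p 0.
Proof.
exists (fun=> p), (fun=> 0), 0, 1; split; [exact: ltr01| |by []|by []|by rewrite subrr].
have hp : C1_open setT (fun=> p : M).
  move=> t _; split; first exact: cst_continuous.
  move=> i di; split; first exact: derivable_cst.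
  have -> : vel i (fun=> p) = fun=> 0 by apply/funext => s; rewrite /vel derive1_cst.
  exact: cst_continuous.
exists setT; split; [exact: openT|by []|exact: hp|move=> t _].
rewrite (speed_chart F openT hp (t := t) I (chart_atP p)).
have -> : vel (chart_at p) (fun=> p) t = 0 by rewrite /vel derive1_cst.
by rewrite rfun0; exact: is_derive1_cst.
Qed.

End Arcs.

(** * Chains of arcs in place of piecewise C^1 curves *)

Section Chains.
Variables (R : realType) (n : nat) (M : manifold R n) (F : randers M).
Notation spd := (speed (randers_fun F)).
Notation length := (len (randers_fun F)).

(** A piecewise C^1 curve reduced to its endpoints and length, without parameter interval or
    corners; concatenation and twisting then go arc by arc. *)
Inductive chain (p : M) : M -> R -> Prop :=
| chain_nil : chain p p 0
| chain_rcons q r L L' : chain p q L -> arc F q r L' -> chain p r (L + L').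

Lemma chain_cat p q r L L' : chain p q L -> chain q r L' -> chain p r (L + L').
Proof.
move=> pq; elim: r L' / => [|r s L1 L2 _ IH rs]; first by rewrite addr0.
by rewrite addrA; apply: chain_rcons IH rs.
Qed.

Lemma chain_arc p q L : arc F p q L -> chain p q L.
Proof. by move=> pq; rewrite -(add0r L); apply: chain_rcons pq; exact: chain_nil. Qed.

Lemma steps_le (N : nat) (s : nat -> R) : (forall k, (k < N)%N -> s k < s k.+1) ->
  forall j k, (j <= k)%N -> (k <= N)%N -> s j <= s k.
Proof.
move=> sS j; elim=> [|k IH]; first by rewrite leqn0 => /eqP->.
rewrite leq_eqVlt => /orP[/eqP->//|jk kN].
exact: le_trans (IH jk (ltnW kN)) (ltW (sS k kN)).
Qed.

(** Induction over the corners. Measurability of the speed up to the current corner is carried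
    along, because additivity of the integral requires it. *)
Lemma piecewise_chain (a b : R) g : piecewise_C1 a b g ->
  exists L, chain (g a) (g b) L /\ length a b g = L%:E.
Proof.
move=> [N [s [sa sb P]]].
have sS k : (k < N)%N -> s k < s k.+1 by move=> /P[].
suff H k : (k <= N)%N -> measurable_fun `[a, s k] (spd g) /\
    exists L, chain (g a) (g (s k)) L /\ length a (s k) g = L%:E.
  by have [_] := H N (leqnn N); rewrite sb.
elim: k => [_|k IH kN].
  rewrite sa; split; first by rewrite set_itv1; exact: measurable_fun_set1.
  exists 0; split; first exact: chain_nil.
  by rewrite /len set_itv1 integral_set1.
have [mk [L [cL lL]]] := IH (ltnW kN).
have [sk [ O [h [oO kO hh gh]]]] := P k kN.
have [S [ O' [oO' kO' hh' dS]]] := ex_arc_on F oO hh sk kO.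
have onh : arc_on F h S (s k) (s k.+1) by exists O'.
have mh := C1_speed_measurable F oO hh kO.
have [mg lg] := len_eq_on mh gh.
have ask : a <= s k by rewrite -sa; exact: (steps_le sS (leq0n k) (ltnW kN)).
have [mc lc] := len_cat ask (ltW sk) mk mg.
split; first exact: mc.
exists (L + (S (s k.+1) - S (s k))); split; last first.
  by rewrite EFinD lc lL lg (len_arc_on sk onh).
have lk : s k \in `[s k, s k.+1] by rewrite in_itv /= lexx ltW.
have rk : s k.+1 \in `[s k, s k.+1] by rewrite in_itv /= lexx ltW.
apply: (chain_rcons cL); exists h, S, (s k), (s k.+1).
split; [exact: sk|exact: onh|exact: esym (gh _ lk)|exact: esym (gh _ rk)|by []].
Qed.

(** The interval is left free so that the induction can squeeze the shorter chain into [0, b/2] and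
    put the last arc on [b/2, b]. *)
Lemma chain_piecewise p q L : chain p q L -> forall b, 0 < b ->
  exists g, [/\ piecewise_C1 0 b g, g 0 = p, g b = q, measurable_fun `[0, b] (spd g) & length 0 b g = L%:E].
Proof.
have single p' q' L' (b : R) : 0 < b -> arc F p' q' L' ->
  exists g, [/\ piecewise_C1 0 b g, g 0 = p', g b = q', measurable_fun `[0, b] (spd g) & length 0 b g = L'%:E].
  move=> b0 /(arc_rescale b0)[g [S [[ O [oO bO hg dS]] g0 gb ->]]].
  exists g; split; [|exact: g0|exact: gb| |].
  - exists 1%N, (fun k => if k == 0%N then 0 else b); split; [by []|by []|move=> k].
    rewrite ltnS leqn0 => /eqP->; split; [exact: b0|exists O, g].
    by split; [exact: oO|exact: bO|exact: hg|].
  - exact: (C1_speed_measurable F oO hg bO).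
  - by apply: (len_arc_on b0); exists O.
elim: q L / => [|q r L L' _ IH qr] b b0; first by apply: single => //; exact: arc0.
have b20 : 0 < b / 2 by rewrite divr_gt0.
have b2b : b / 2 < b by lra.
have [g1 [[N [s [s0 sN P]]] g10 g1b m1 l1]] := IH _ b20.
have [g2 [S [[ O [oO bO hg dS]] g20 g2b L'E]]] := arc_rescale b2b qr.
have sS k : (k < N)%N -> s k < s k.+1 by move=> /P[].
pose g t := if t <= b / 2 then g1 t else g2 t.
have gg1 (t : R) : t \in `[0, b / 2] -> g t = g1 t.
  by rewrite in_itv /= /g => /andP[_ ->].
have gg2 (t : R) : t \in `[b / 2, b] -> g t = g2 t.
  rewrite in_itv /= /g => /andP[bt _]; case: (leP t (b / 2)) => // tb.
  by have -> : t = b / 2; [apply/le_anti; rewrite tb|rewrite g1b g20].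
clearbody g.
have [ma la] := len_eq_on m1 gg1.
have [mb lb] := len_eq_on (C1_speed_measurable F oO hg bO) gg2.
have [mc lc] := len_cat (ltW b20) (ltW b2b) ma mb.
exists g; split.
- exists N.+1, (fun k => if (k <= N)%N then s k else b); split; [exact: s0|by rewrite ltnn|move=> k].
  rewrite ltnS => kN'; have /orP[/eqP->|kN] : (k == N) || (k < N)%N by rewrite -leq_eqVlt.
    rewrite /= leqnn ltnn sN; split; [exact: b2b|exists O, g2].
    by split; [exact: oO|exact: bO|exact: hg|exact: gg2].
  rewrite /= kN (ltnW kN); have [sk [ O1 [h [oO1 kO1 hh gh]]]] := P k kN.
  split; first exact: sk.
  exists O1, h; split; [exact: oO1|exact: kO1|exact: hh|move=> t tk].
  have h1 : s 0%N <= s k := steps_le sS (leq0n k) (ltnW kN).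
  have h2 : s k.+1 <= s N := steps_le sS kN (leqnn N).
  rewrite s0 in h1; rewrite sN in h2.
  have th : t \in `[0, b / 2].
    move: tk; rewrite !in_itv /= => /andP[kt tk].
    by rewrite (le_trans h1 kt) (le_trans tk h2).
  exact: etrans (gg1 t th) (gh t tk).
- by rewrite -g10; apply: gg1; rewrite in_itv /= lexx ltW.
- by rewrite -g2b; apply: gg2; rewrite in_itv /= lexx ltW.
- exact: mc.
- have on2 : arc_on F g2 S (b / 2) b := ex_intro _ O (And4 oO bO hg dS).
  have E1 : length 0 (b / 2) g = L%:E by exact (eq_trans la l1).
  have E3 := len_arc_on b2b on2.
  have E4 := eq_trans lb E3.
  have E2 : length (b / 2) b g = L'%:E by exact (eq_trans E4 (f_equal EFin (esym L'E))).
  have E5 := eq_trans lc (congr2 adde E1 E2).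
  exact E5.
Qed.

Lemma chain_dist p q L : chain p q L -> (dist (randers_fun F) p q <= L%:E)%E.
Proof.
move=> /chain_piecewise /(_ 1 ltr01)[g [gp g0 g1 _ gl]].
by apply: ereal_inf_lbound; exists g.
Qed.

(** Distances enter only through strict upper bounds, each witnessed by one chain, so neither
    attainment of the infimum nor infinite values need attention. *)
Lemma dist_ltP p q (x : R) : (dist (randers_fun F) p q < x%:E)%E <-> exists L, chain p q L /\ L < x.
Proof.
split=> [/ereal_inf_lt[_ [g [gp g0 g1 ->]]] gx|[L [cL Lx]]].
  have [L [cL lL]] := piecewise_chain gp.
  by exists L; rewrite -g0 -g1; split => //; rewrite -lte_fin -lL.
by apply: le_lt_trans (chain_dist cL) _; rewrite lte_fin.
Qed.

End Chains.

Section UnitSpeed.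
Variables (R : realType) (n : nat) (M : manifold R n) (F : randers M).

Lemma geodesic_C1 O (g : R -> M) : open O -> geodesic_open (randers_fun F) O g ->
  C1_open O g /\ forall t, O t -> speed (randers_fun F) g t = 1.
Proof.
move=> oO gg; have c1 : C1_open O g.
  move=> t Ot; have [gc _] := gg t Ot; split => // i di.
  have [d1' d2 _ _ _] := geodesic_curve oO gg Ot di; have [d1 _] := d1'.
  by split; [exact: d1|exact: is_derive1_continuous d2].
split => // t Ot; have di := chart_atP (g t); rewrite (speed_chart F oO c1 Ot di).
by have [_ _ _] := geodesic_curve oO gg Ot di.
Qed.

Lemma geodesic_arc (l : R) (g : R -> M) : 0 < l -> geodesic (randers_fun F) `[0, l] g ->
  len (randers_fun F) 0 l g = l%:E /\ arc F (g 0) (g l) l.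
Proof.
move=> l0 [ O [h [oO iO lO hg gh]]].
have [hc h1] := geodesic_C1 oO hg.
have on : arc_on F h id 0 l.
  exists O; split; [exact: oO|exact: lO|exact: hc|move=> t Ot].
  by rewrite (h1 t Ot); exact: is_derive_id.
have [_ ->] := len_eq_on (C1_speed_measurable F oO hc lO) gh.
split; first by rewrite (len_arc_on l0 on) subr0.
have l1 : 0 \in `[0, l] by rewrite in_itv /= lexx ltW.
have l2 : l \in `[0, l] by rewrite in_itv /= lexx ltW.
exists h, id, 0, l.
by split; [exact: l0|exact: on|exact: esym (gh _ l1)|exact: esym (gh _ l2)|rewrite subr0].
Qed.

Lemma minimal_dist (l : R) (g : R -> M) : 0 < l -> geodesic (randers_fun F) `[0, l] g ->
  minimal_geodesic (randers_fun F) l g <-> dist (randers_fun F) (g 0) (g l) = l%:E.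
Proof.
move=> l0 gg; have [ll _] := geodesic_arc l0 gg; rewrite /minimal_geodesic ll.
by split=> [[]|].
Qed.

End UnitSpeed.

(** * Distances and cut points under a twist *)

Section PushDistance.
Variables (R : realType) (n : nat) (M : manifold R n).
Variables (F1 F2 : randers M) (chi : R -> M -> M).
Hypothesis tw : twist F1 F2 chi.

Lemma push_arc s p q L : arc F1 p q L -> arc F2 (chi s p) (chi (s + L) q) L.
Proof.
move=> [g [S [a [b [ab [ O [oO abO hg dS]] ga gb ->]]]]].
(* The clock reads [s] at the start of the arc and [s + L] at its end, so consecutive arcs of a
   chain fit together. *)
pose tau t := S t + (s - S a).
have dt t : O t -> is_derive t 1 tau (speed (randers_fun F1) g t).
  move=> Ot; have := is_derive1D (dS t Ot) (is_derive1_cst (s - S a) t).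
  by rewrite addr0.
have [hc hs] := push_speed tw oO hg dt.
exists (fun t => chi (tau t) (g t)), S, a, b; split; [exact: ab| | | |by []].
- exists O; split; [exact: oO|exact: abO|exact: hc|move=> t Ot].
  by rewrite (hs t Ot); exact: dS.
- by rewrite ga /tau addrC subrK.
- by rewrite gb /tau; congr (chi _ _); ring.
Qed.

Lemma push_chain s p q L : chain F1 p q L -> chain F2 (chi s p) (chi (s + L) q) L.
Proof.
elim: q L / => [|q r L L' _ IH qr]; first by rewrite addr0; exact: chain_nil.
by apply: chain_rcons IH _; rewrite addrA; exact: push_arc.
Qed.

Lemma flow_arc p d : 0 < d -> exists L, arc F2 p (chi d p) L /\ L < d.
Proof.
move=> d0; have [hc hs] := flow_line_speed tw p.
have [S [ O [oO dO hO dS]]] := ex_arc_on F2 openT hc d0 (fun _ _ => I).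
exists (S d - S 0); split.
  exists (fun t => chi t p), S, 0, d.
  by split; [exact: d0|exists O|exact: (twist0 tw)|by []|by []].
have Sc : {within `[0, d], continuous S}.
  apply: continuous_in_subspaceT => x; rewrite inE => /dO Ox.
  exact: is_derive1_continuous (dS x Ox).
have [|c _ ->] := MVT (df := speed (randers_fun F2) (fun t => chi t p)) d0 _ Sc.
  by move=> x xd; apply: dS; apply: dO; exact: subset_itv_oo_cc.
by rewrite subr0 gtr_pMl.
Qed.

(** A chain of length L < s is twisted to one ending at [chi L p], as the clock has advanced by L
    only; the remaining time s - L is spent on the flow line, which costs less than s - L. *)
Lemma push_dist_lt q p s : 0 < s -> (dist (randers_fun F1) q p < s%:E)%E ->
  (dist (randers_fun F2) q (chi s p) < s%:E)%E.
Proof.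
move=> s0 /dist_ltP[L [cL Ls]]; apply/dist_ltP.
have := push_chain 0 cL; rewrite add0r (twist0 tw) => c1.
have sL : 0 < s - L by rewrite subr_gt0.
have [L' [aL' L's]] := flow_arc (chi L p) sL.
exists (L + L'); split; last by lra.
by apply: (chain_rcons c1); move: aL'; rewrite -(twistD tw) addrC subrK.
Qed.

Lemma dist_flow p d : 0 < d -> (dist (randers_fun F2) p (chi d p) < d%:E)%E.
Proof. by move=> d0; apply: push_dist_lt => //; apply/dist_ltP; exists 0; split => //; exact: chain_nil. Qed.

End PushDistance.

Section PushCut.
Variables (R : realType) (n : nat) (M : manifold R n).
Variables (F1 F2 : randers M) (chi : R -> M -> M).
Hypotheses (tw : twist F1 F2 chi) (tw' : twist F2 F1 (fun t => chi (- t))).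

(** The twisted geodesic has length [l], which bounds the distance above; a shorter F2-distance
    would, by the inverse twist, shorten the F1-distance, which is [l]. *)
Lemma push_minimal (l : R) g : 0 < l -> minimal_geodesic (randers_fun F1) l g ->
  minimal_geodesic (randers_fun F2) l (fun t => chi t (g t)).
Proof.
move=> l0 mg; have [gg _] := mg; have /(minimal_dist l0 gg) dl := mg.
have hg := push_geodesic_on tw gg; apply/(minimal_dist l0 hg).
rewrite (twist0 tw); apply/le_anti/andP; split.
  have [_ /chain_arc/chain_dist] := geodesic_arc l0 hg.
  by rewrite (twist0 tw).
rewrite leNgt; apply/negP => /(push_dist_lt tw' l0).
by rewrite (twistNK tw) dl ltxx.
Qed.

End PushCut.

(** The matrix of [cut_point] with its witnesses exposed, since the time by which the point is moved
    must be compared with the length. *)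
Definition cut_geodesic (R : realType) (n : nat) (M : manifold R n) (F : randers M) (q p : M) (l : R) g :=
  [/\ 0 < l, minimal_geodesic (randers_fun F) l g, g 0 = q, g l = p &
    forall l' h, l < l' -> (forall t, t \in `[0, l] -> h t = g t) ->
      ~ minimal_geodesic (randers_fun F) l' h].

Lemma cut_geodesic_dist (R : realType) (n : nat) (M : manifold R n) (F : randers M) (q p : M) (l : R) g :
  cut_geodesic F q p l g -> dist (randers_fun F) q p = l%:E.
Proof. by move=> [l0 mg <- <- _]; have [gg _] := mg; apply/(minimal_dist l0 gg). Qed.

Section PushCutPoint.
Variables (R : realType) (n : nat) (M : manifold R n).
Variables (F1 F2 : randers M) (chi : R -> M -> M).
Hypotheses (tw : twist F1 F2 chi) (tw' : twist F2 F1 (fun t => chi (- t))).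

(** A minimal extension of the twisted geodesic would twist back to a minimal extension of [g]. *)
Lemma push_cut q p l g : cut_geodesic F1 q p l g ->
  cut_geodesic F2 q (chi l p) l (fun t => chi t (g t)).
Proof.
move=> [l0 mg gq gp ext]; split; [exact: l0| | | |].
- exact: (push_minimal tw tw').
- by rewrite (twist0 tw).
- by rewrite gp.
move=> l' h ll' hE mh; have l'0 := lt_trans l0 ll'.
have twN : twist F1 F2 (fun t => chi (- - t)).
  by have -> : (fun t => chi (- - t)) = chi by apply/funext => t; rewrite opprK.
apply: (ext l' (fun t => chi (- t) (h t)) ll' _ (push_minimal tw' twN l'0 mh)).
by move=> t tl; rewrite hE // (twistNK tw).
Qed.

(* If l' > l, following the flow line from [phat] during the time l' - l and then
   twisting back gives a chain from [q] to [chi (- l) phat] shorter than l'. *)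
Lemma cut_dist_eq q phat l l' : dist (randers_fun F2) q phat = l%:E -> 0 < l' ->
  dist (randers_fun F1) q (chi (- l) phat) = l'%:E -> l' = l.
Proof.
move=> dl l'0 dl'; apply/le_anti/andP; split; rewrite leNgt; apply/negP => ll'.
  have d0 : 0 < l' - l by rewrite subr_gt0.
  have /dist_ltP[L2 [c2 L2d]] := dist_flow tw phat d0.
  have /dist_ltP[L1 [c1 L1d]] : (dist (randers_fun F2) q phat < (l' - L2)%:E)%E by rewrite dl lte_fin; lra.
  have : (dist (randers_fun F2) q (chi (l' - l) phat) < l'%:E)%E.
    by apply/dist_ltP; exists (L1 + L2); split; [exact: chain_cat c1 c2|lra].
  move=> /(push_dist_lt tw' l'0); rewrite -(twistD tw) addrAC subrr add0r.
  by rewrite dl' ltxx.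
have l0 := lt_trans l'0 ll'.
have : (dist (randers_fun F1) q (chi (- l) phat) < l%:E)%E by rewrite dl' lte_fin.
by move=> /(push_dist_lt tw l0); rewrite (twistK tw) dl ltxx.
Qed.

End PushCutPoint.

Theorem lemma3p6 (R : realType) (n : nat) (M : manifold R n)
    (F Ft : randers M) (W : vfield M) (psi : R -> M -> M)
    (F_not_flat : ~ flat (randers_fun F))
    (W_small : forall i x, cod i x -> randers_fun F i x (- W i x) < 1)
    (Ft_zermelo : zermelo (randers_fun F) W (randers_fun Ft))
    (psi_flow : flow_on W setT setT psi)
    (W_killing : killing (randers_fun F) W) :
  [/\
      forall (J : set R) (Pt : R -> M), is_interval J ->
        geodesic (randers_fun Ft) J Pt <->
        exists P : R -> M, geodesic (randers_fun F) J P /\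
          forall t, J t -> Pt t = psi t (P t),
      forall (l : R) (Pt : R -> M), 0 < l ->
        geodesic (randers_fun Ft) `[0, l] Pt ->
        conjugate (randers_fun Ft) Pt l <->
        conjugate (randers_fun F) (fun t => psi (- t) (Pt t)) l
    &
      forall (q phat : M) (l : R), dist (randers_fun Ft) q phat = l%:E ->
        cut_point (randers_fun Ft) q phat <->
        cut_point (randers_fun F) q (psi (- l) phat)].
Proof.
have tw : twist F Ft psi := flow_twist W_small Ft_zermelo psi_flow W_killing.
have tw' : twist Ft F (fun t => psi (- t)) := flowN_twist W_small Ft_zermelo psi_flow W_killing.
split.
- move=> J Pt _; split=> [gPt|[P [gP PtE]]].
    exists (fun t => psi (- t) (Pt t)); split; first exact: (push_geodesic_on tw' gPt).
    by move=> t _; rewrite (twistK tw).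
  have [ O [h [oO iO JO hg Ph]]] := push_geodesic_on tw gP.
  by exists O, h; split => // t Jt; rewrite PtE // Ph.
- move=> l Pt l0 _; split=> [cPt|cP]; first exact: (push_conjugate tw' l0 cPt).
  have -> : Pt = fun t => psi t (psi (- t) (Pt t)) by apply/funext => t; rewrite (twistK tw).
  exact: (push_conjugate tw l0 cP).
- have tw2 : twist F Ft (fun t => psi (- - t)).
    by have -> : (fun t => psi (- - t)) = psi by apply/funext => t; rewrite opprK.
  move=> q phat l dl; split=> -[l' [g cg]].
    (* The length of a minimal geodesic is the distance of its endpoints, so the length hidden in
       [cut_point] is [l]. *)
    have [ll'] : l%:E = l'%:E by rewrite -dl; exact: (cut_geodesic_dist (g := g)).
    (* The F-geodesic is the inverse twist of the Ft-geodesic, so (iii) in this direction is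
       [push_cut] for the reversed flow. *)
    by rewrite ll'; exists l', (fun t => psi (- t) (g t)); exact: (push_cut tw' tw2 cg).
  (* Here the hidden length is an F-distance while [l] is an Ft-distance; [cut_dist_eq] identifies
     them, so that twisting by [l'] returns to [phat]. *)
  have [l'0 _ _ _ _] := cg; have dl' : dist (randers_fun F) q (psi (- l) phat) = l'%:E.
    exact: (cut_geodesic_dist (g := g)).
  have ll' := cut_dist_eq tw tw' dl l'0 dl'.
  exists l', (fun t => psi t (g t)); have := push_cut tw tw' cg.
  by rewrite -[in psi l' _]ll' (twistK tw).
Qed.
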